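(* Let $p=p(n)>0$ satisfy $np\to\infty$, and let $(G_n)$ be a sequence of graphs with $|G_n|=n$ satisfying the bounded density assumption: there is a constant $C$ and a function $n_0(\varepsilon)$ such that, for every $\varepsilon>0$, every $n\ge n_0(\varepsilon)$, and any $A,B\subset V(G_n)$ with $|A|,|B|\ge\varepsilon n$, we have $d_p(A,B)\le C+\varepsilon$. Let $\kappa$ be a bounded kernel. Then $d_{\mathrm{part}}(G_n,\kappa)\to0$ if and only if $d_{\mathrm{cut}}(G_n,\kappa)\to0$.
   Context: Graphs are finite and simple. A sequence $(G_n)$ with $|G_n|=n$, $V(G_n)=\{1,\dots,n\}$, need only be defined for $n$ in an infinite subset of $\mathbb{N}$; limits are along that subset. For (not necessarily disjoint) sets $A,B$ of vertices of $G=G_n$, $e_G(A,B)$ is the number of ordered pairs $(i,j)$ with $i\in A$, $j\in B$, $ij\in E(G)$, and $d_p(A,B)=e_G(A,B)/(p|A||B|)$, where $p=p(n)$. A kernel is a symmetric measurable function $\kappa:[0,1]^2\to[0,\infty)$. The cut norm of an integrable $W:[0,1]^2\to\mathbb{R}$ is $\|W\|_{\mathrm{cut}}=\sup_{S,T}\left|\int_{S\times T}W(x,y)\,dx\,dy\right|$, the supremum being over measurable $S,T\subset[0,1]$. For kernels, $d_{\mathrm{cut}}(\kappa_1,\kappa_2)=\inf_\tau\|\kappa_1-\kappa_2^{(\tau)}\|_{\mathrm{cut}}$, where $\tau$ runs over measure-preserving bijections $[0,1]\to[0,1]$ and $\kappa^{(\tau)}(x,y)=\kappa(\tau(x),\tau(y))$.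 To a graph $G$ with vertex set $\{1,\dots,n\}$ associate the kernel $\kappa_G$ equal to $1/p(n)$ on $((i-1)/n,i/n]\times((j-1)/n,j/n]$ whenever $ij\in E(G)$, and $0$ elsewhere; $d_{\mathrm{cut}}(G,\kappa)$ means $d_{\mathrm{cut}}(\kappa_G,\kappa)$. Partition metric. For $k\ge2$ and a partition $\Pi=(P_1,\dots,P_k)$ of $V(G_n)$ into $k$ non-empty parts, let $M_\Pi(G_n)=(d_p(P_i,P_j))_{1\le i,j\le k}$, a symmetric matrix regarded as a point of $\mathbb{R}^{k(k+1)/2}$. Let $\mathcal{M}_k(G_n)$ be the set of all $M_\Pi(G_n)$ with $\Pi$ ranging over all partitions into $k$ parts that are balanced, i.e. $\bigl||P_i|-|P_j|\bigr|\le1$ for all $i,j$ (so $\mathcal{M}_k(G_n)=\emptyset$ if $k>n$). For a bounded kernel $\kappa$, $\mathcal{M}_k(\kappa)$ is the closure of the set of all matrices $\bigl(k^2\int_{P_i\times P_j}\kappa\bigr)_{1\le i,j\le k}$, where $(P_1,\dots,P_k)$ ranges over partitions of $[0,1]$ into $k$ measurable sets of measure exactly $1/k$. For each $k$ all these sets lie in a compact cube $B_k=[0,C_k]^{k(k+1)/2}$ for a suitable constant $C_k$. Let $d_{\mathrm H}$ be the Hausdorff metric, with respect to the $\ell_\infty$ distance, on non-empty compact subsets of $B_k$, with $d_{\mathrm H}(\emptyset,X)=C_k$ for every non-empty compact set $X$. Then $d_{\mathrm{part}}(X,Y)=d\bigl((\mathcal{M}_k(X))_{k\ge2},(\mathcal{M}_k(Y))_{k\ge2}\bigr)$,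 where $X,Y$ are graphs or bounded kernels and $d$ is any metric inducing the product topology on the product over $k\ge2$ of these spaces of compact sets. In particular, $d_{\mathrm{part}}(G_n,\kappa)\to0$ if and only if $d_{\mathrm H}(\mathcal{M}_k(G_n),\mathcal{M}_k(\kappa))\to0$ for each fixed $k\ge2$. *)

(* Defs.v *)
From HB Require Import structures.
From mathcomp Require Import all_boot all_order all_algebra.
From mathcomp Require Import ring lra.
From mathcomp Require Import all_classical all_reals all_analysis.

Set Implicit Arguments.
Unset Strict Implicit.
Unset Printing Implicit Defensive.

Import Order.TTheory GRing.Theory Num.Theory.
Import numFieldNormedType.Exports.

Local Open Scope classical_set_scope.
Local Open Scope ring_scope.

(* Vertices are numbered from 0: [i : 'I_n] stands for the vertex i + 1. *)
Record sgraph (n : nat) := SGraph {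
  adj : rel 'I_n;
  adj_sym : symmetric adj;
  adj_irr : irreflexive adj
}.

Section graph_density.
Context {R : realType}.
Variables (n : nat) (p : R) (G : sgraph n).

Definition edge_count (A B : {set 'I_n}) : nat :=
  #|[pred ij : 'I_n * 'I_n | [&& ij.1 \in A, ij.2 \in B & adj G ij.1 ij.2]]|.

Definition density (A B : {set 'I_n}) : R :=
  (edge_count A B)%:R / (p * #|A|%:R * #|B|%:R).

Definition balanced_partition (k : nat) (P : 'I_k -> {set 'I_n}) : Prop :=
  [/\ forall i, (0 < #|P i|)%N,
      forall i j v, v \in P i -> v \in P j -> i = j,
      forall v, exists i, v \in P i &
      forall i j, (#|P i| <= #|P j|.+1)%N].

Definition graph_matrices (k : nat) : set 'M[R]_k :=
  [set M | exists2 P : 'I_k -> {set 'I_n}, balanced_partition P &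
           M = \matrix_(i, j) density (P i) (P j)].

(* The half-open cells ((i-1)/n, i/n], shifted to match the vertex numbering. *)
Definition graph_kernel : R * R -> R := fun z =>
  if [exists i : 'I_n, exists j : 'I_n,
        [&& adj G i j, i%:R / n%:R < z.1 <= i.+1%:R / n%:R
                     & j%:R / n%:R < z.2 <= j.+1%:R / n%:R]]
  then p^-1 else 0.

End graph_density.

Definition bounded_density {R : realType} (S : set nat) (p : nat -> R)
    (G : forall n, sgraph n) : Prop :=
  exists (C : R) (n0 : R -> nat), forall eps : R, 0 < eps ->
  forall n, S n -> (n0 eps <= n)%N ->
  forall A B : {set 'I_n}, eps * n%:R <= #|A|%:R -> eps * n%:R <= #|B|%:R ->
  density (p n) (G n) A B <= C + eps.

Section kernels.
Context {R : realType}.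
Implicit Types (kappa W : R * R -> R) (tau : R -> R).

Local Notation mu := (@lebesgue_measure R).
Local Notation mu2 := (mu \x mu)%E.
Local Notation I01 := (`[0, 1]%classic : set R).

(* Kernels are functions on the plane whose values off the unit square are
   irrelevant. *)
Definition is_kernel kappa : Prop :=
  [/\ measurable_fun (I01 `*` I01) kappa,
      forall x y, I01 x -> I01 y -> kappa (x, y) = kappa (y, x) &
      forall x y, I01 x -> I01 y -> 0 <= kappa (x, y)].

Definition bounded_kernel kappa : Prop :=
  is_kernel kappa /\
  exists B : R, forall x y, I01 x -> I01 y -> kappa (x, y) <= B.

Definition cut_norm W : \bar R :=
  ereal_sup [set r | exists S T : set R,
    [/\ measurable S, measurable T, S `<=` I01, T `<=` I01 &
        r = `| \int[mu2]_(z in S `*` T) (W z)%:E |%E]].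

Definition measure_preserving_bij tau : Prop :=
  [/\ set_bij I01 I01 tau, measurable_fun I01 tau &
      forall A, measurable A -> A `<=` I01 -> mu (I01 `&` tau @^-1` A) = mu A].

Definition rearrange kappa tau : R * R -> R :=
  fun z => kappa (tau z.1, tau z.2).

Definition d_cut kappa1 kappa2 : \bar R :=
  ereal_inf [set cut_norm (fun z => kappa1 z - rearrange kappa2 tau z)
            | tau in measure_preserving_bij].

Definition equal_partition (k : nat) (P : 'I_k -> set R) : Prop :=
  [/\ forall i, measurable (P i),
      trivIset setT P,
      \bigcup_i P i = I01 &
      forall i, mu (P i) = (k%:R^-1)%:E].

Definition kernel_matrices kappa (k : nat) : set 'M[R]_k :=
  closure [set M | exists2 P : 'I_k -> set R, equal_partition P &
    M = \matrix_(i, j) (k%:R ^+ 2 * \int[mu2]_(z in P i `*` P j) kappa z)].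

End kernels.

(* The cube [0, c]^(k(k+1)/2), as a set of symmetric matrices.  On these, the
   entrywise maximum norm of ['M[R]_k] is the l_oo norm. *)
Definition cube {R : realType} (c : R) (k : nat) : set 'M[R]_k :=
  [set M | M^T = M /\ forall i j, 0 <= M i j <= c].

Arguments cube {R} c k _.
Arguments graph_matrices {R n} p G k _.
Arguments kernel_matrices {R} kappa k _.

Section hausdorff.
Context {R : realType}.

Record cube_compact (c : {posnum R}) (k : nat) := CubeCompact {
  cc_set :> set 'M[R]_k;
  cc_compact : compact cc_set;
  cc_cube : cc_set `<=` cube c%:num k
}.

HB.instance Definition _ c k := gen_eqMixin (cube_compact c k).
HB.instance Definition _ c k := gen_choiceMixin (cube_compact c k).

Definition dist_to k (x : 'M[R]_k) (Y : set 'M[R]_k) : R :=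
  inf [set `|x - y| | y in Y].

Definition excess k (X Y : set 'M[R]_k) : R :=
  sup [set dist_to x Y | x in X].

Definition d_H c k (X Y : cube_compact c k) : R :=
  if `[< X = set0 :> set _ >] then
    if `[< Y = set0 :> set _ >] then 0 else c%:num
  else if `[< Y = set0 :> set _ >] then c%:num
  else Num.max (excess X Y) (excess Y X).

Lemma cube_dist (c : R) k (x y : 'M[R]_k) :
  0 <= c -> cube c k x -> cube c k y -> `|x - y| <= c.
Proof.
move=> c0 [_ x0c] [_ y0c]; rewrite [leLHS]/Num.norm/= mx_normrE.
apply/bigmax_leP; split => // -[i j] _ /=; rewrite !mxE ler_norml.
have /andP[? ?] := x0c i j; have /andP[? ?] := y0c i j.
by apply/andP; split; lra.
Qed.

Lemma dist_to_ge0 k (x : 'M[R]_k) Y : 0 <= dist_to x Y.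
Proof.
have [->|/set0P[y Yy]] := eqVneq Y set0; first by rewrite /dist_to image_set0 inf0.
by apply: lb_le_inf; [exists `|x - y|, y | move=> _ [z _ <-]].
Qed.

Lemma dist_to_le k (x y : 'M[R]_k) (Y : set 'M[R]_k) :
  Y y -> dist_to x Y <= `|x - y|.
Proof.
by move=> Yy; apply: ge_inf; [exists 0 => _ [z _ <-] | exists y].
Qed.


Lemma excess_ge0 k (X Y : set 'M[R]_k) : 0 <= excess X Y.
Proof.
rewrite /excess; set E := [set _ | _ in _].
have [|nE] := pselect (has_sup E); last by rewrite sup_out.
move=> [[r [x Xx _]] Eub]; apply: le_trans (dist_to_ge0 x Y) _.
by apply: ub_le_sup => //; exists x.
Qed.

Lemma dist_to_excess c k (X Y : cube_compact c k) x :
  Y !=set0 -> cc_set X x -> dist_to x Y <= excess X Y.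
Proof.
move=> [y Yy] Xx; apply: ub_le_sup; last by exists x.
exists c%:num => _ [z Xz <-]; apply: le_trans (dist_to_le z Yy) _.
by apply: cube_dist => //; [exact: (cc_cube Xz) | exact: (cc_cube Yy)].
Qed.

Lemma excess_le_cube c k (X Y : cube_compact c k) :
  X !=set0 -> Y !=set0 -> excess X Y <= c%:num.
Proof.
move=> [x Xx] [y Yy]; apply: ge_sup; first by exists (dist_to x Y), x.
move=> _ [z Xz <-]; apply: le_trans (dist_to_le z Yy) _.
by apply: cube_dist => //; [exact: (cc_cube Xz) | exact: (cc_cube Yy)].
Qed.

Lemma excess_triangle c k (Y X Z : cube_compact c k) :
  X !=set0 -> Y !=set0 -> Z !=set0 -> excess X Z <= excess X Y + excess Y Z.
Proof.
move=> [x0 Xx0] Y0 Z0; apply: ge_sup; first by exists (dist_to x0 Z), x0.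
move=> _ [x Xx <-]; apply: le_trans (lerD (dist_to_excess Y0 Xx) (lexx _)).
rewrite -lerBlDr; apply: lb_le_inf; first by case: Y0 => y Yy; exists `|x - y|, y.
move=> _ [y Yy <-]; rewrite lerBlDr.
apply: le_trans (lerD (lexx _) (dist_to_excess Z0 Yy)).
rewrite -lerBlDl; apply: lb_le_inf; first by case: Z0 => z Zz; exists `|y - z|, z.
move=> _ [z Zz <-]; rewrite lerBlDl; apply: le_trans (dist_to_le x Zz) _.
exact: ler_distD.
Qed.

Lemma excess0_sub c k (X Y : cube_compact c k) :
  Y !=set0 -> excess X Y <= 0 -> X `<=` Y.
Proof.
move=> Y0 XY0 x Xx.
have Ycl : closed (Y : set 'M[R]_k).
  by apply: compact_closed (@cc_compact _ _ Y); exact: norm_hausdorff.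
apply: Ycl => B /nbhs_ballP[e /= e0 sB].
have hl : has_inf [set `|x - y| | y in (Y : set _)].
  by split; [case: Y0 => y Yy; exists `|x - y|, y | exists 0 => _ [z _ <-]].
have [_ [y Yy <-] xye] := inf_adherent e0 hl.
exists y; split => //; apply: sB; rewrite -ball_normE /=.
apply: lt_le_trans xye _; rewrite gerDr.
exact: le_trans (dist_to_excess Y0 Xx) XY0.
Qed.

Lemma cube_compact_eq c k (X Y : cube_compact c k) :
  X = Y :> set 'M[R]_k -> X = Y.
Proof.
case: X Y => [X cX sX] [Y cY sY] /= XY; subst Y.
by congr CubeCompact; exact: Prop_irrelevance.
Qed.

Variant d_H_spec c k (X Y : cube_compact c k) : R -> Type :=
| DHBothEmpty of X = set0 :> set _ & Y = set0 :> set _ : d_H_spec X Y 0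
| DHLeftEmpty of X = set0 :> set _ & Y !=set0 : d_H_spec X Y c%:num
| DHRightEmpty of X !=set0 & Y = set0 :> set _ : d_H_spec X Y c%:num
| DHNonEmpty of X !=set0 & Y !=set0 :
    d_H_spec X Y (Num.max (excess X Y) (excess Y X)).

Lemma d_HP c k (X Y : cube_compact c k) : d_H_spec X Y (d_H X Y).
Proof.
rewrite /d_H; case: asboolP => [X0|/eqP/set0P X0];
  case: asboolP => [Y0|/eqP/set0P Y0]; by constructor.
Qed.

Lemma d_Hxx c k (X : cube_compact c k) : d_H X X = 0.
Proof.
case: d_HP => // [->/set0P/eqP//|/set0P/eqP//|[x Xx] _].
rewrite maxxx; apply/le_anti; rewrite excess_ge0 andbT.
apply: ge_sup; first by exists (dist_to x X), x.
by move=> _ [y Xy <-]; rewrite (le_trans (dist_to_le y Xy))// subrr normr0.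
Qed.

Lemma d_H_positivity c k (X Y : cube_compact c k) : d_H X Y = 0 -> X = Y.
Proof.
case: d_HP => [X0 Y0 _|_ _ /eqP|_ _ /eqP|X0 Y0 XY0]; rewrite ?gt_eqF//.
  by apply: cube_compact_eq; rewrite X0 Y0.
apply: cube_compact_eq; apply/seteqP; split; apply: excess0_sub => //.
  by rewrite -XY0 le_max lexx.
by rewrite -XY0 le_max lexx orbT.
Qed.

Lemma d_H_sym c k (X Y : cube_compact c k) : d_H X Y = d_H Y X.
Proof. by rewrite /d_H; do 2 case: asboolP => //; rewrite maxC. Qed.

Lemma d_H_triangle c k (Y X Z : cube_compact c k) :
  d_H X Z <= d_H X Y + d_H Y Z.
Proof.
have ne0 (A : cube_compact c k) : A !=set0 -> A = set0 :> set _ -> False.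
  by move=> [x Ax] A0; rewrite A0 in Ax.
have e0 (A B : cube_compact c k) : 0 <= Num.max (excess A B) (excess B A).
  by rewrite le_max excess_ge0.
have ec (A B : cube_compact c k) :
    A !=set0 -> B !=set0 -> Num.max (excess A B) (excess B A) <= c%:num.
  by move=> A0 B0; rewrite ge_max !excess_le_cube.
case: (d_HP X Z) => X0 Z0; case: (d_HP X Y) => X1 Y1; case: (d_HP Y Z) => Y2 Z2;
  try solve [by case: (ne0 X) | by case: (ne0 Y) | by case: (ne0 Z)];
  rewrite ?addr0 ?add0r ?addr_ge0 ?lerDl ?lerDr //.
- by apply: le_trans (ec _ _ X0 Z0) _; rewrite lerDl.
- rewrite ge_max; apply/andP; split.
    apply: le_trans (excess_triangle X0 Y1 Z0) _.
    by rewrite lerD// le_max lexx.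
  apply: le_trans (excess_triangle Z0 Y1 X0) _.
  by rewrite addrC lerD// le_max lexx orbT.
Qed.

HB.instance Definition _ c k := @isMetric.Build R (cube_compact c k)
  (@d_H c k) (@d_Hxx c k) (@d_H_positivity c k) (@d_H_sym c k)
  (@d_H_triangle c k).

Lemma compact_cube (c : R) k : compact (cube c k).
Proof.
pose lo (i j : 'I_k) := if (i <= j)%N then i else j.
pose hi (i j : 'I_k) := if (i <= j)%N then j else i.
pose f (v : 'rV[R]_(k * k)) : 'M[R]_k :=
  \matrix_(i, j) v ord0 (mxvec_index (lo i j) (hi i j)).
have lohi i j : lo i j = lo j i /\ hi i j = hi j i.
  rewrite /lo /hi; case: (ltngtP i j) => // ij.
  by split; apply: val_inj.
pose box := [set v : 'rV[R]_(k * k) | forall q, `[0, c]%classic (v ord0 q)].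
have -> : cube c k = f @` box.
  apply/seteqP; split=> [M [Msym M0c]|_ [v v0c <-]].
    exists (mxvec M); first by move=> q; case/mxvec_indexP: q => i j;
      rewrite mxvecE /= in_itv/=; exact: M0c.
    apply/matrixP => i j; rewrite mxE mxvecE /lo /hi; case: ifP => // _.
    by rewrite -[in LHS]Msym mxE.
  split; first by apply/matrixP => i j; rewrite !mxE; case: (lohi i j) => -> ->.
  by move=> i j; rewrite mxE; have := v0c (mxvec_index (lo i j) (hi i j));
    rewrite /= in_itv.
apply: continuous_compact; last first.
  apply: (@rV_compact _ _ (fun=> `[0, c]%classic)) => _; exact: segment_compact.
apply: continuous_subspaceT => v A [P nP sPA].
have FF : Filter (nbhs v) by exact: nbhs_filter.
suff : \forall w \near v, forall i j, P i j (f w i j).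
  by apply: filterS => w; exact: sPA.
have nij i j : \forall w \near v, P i j (f w i j).
  have := nP i j; rewrite /f mxE => /coord_continuous.
  by rewrite nbhs_simpl; apply: (@filterS _ _ FF) => w; rewrite /= mxE.
exact: (filter_forall FF (fun i => filter_forall FF (nij i))).
Qed.

End hausdorff.

Section profile.
Context {R : realType}.
(* [C k] is the side of the cube of k x k matrices; only k >= 2 matters.  It is
   positive so that the distance from the empty set separates points. *)
Variable C : nat -> {posnum R}.

Definition empty_compact c k : cube_compact c k :=
  @CubeCompact R c k set0 (@compact0 _) (@sub0set _ _).

(* Sets that are not compact subsets of the cube are sent to the empty set. *)
Definition to_cube_compact c k (A : set 'M[R]_k) : cube_compact c k :=
  match pselect (compact A /\ A `<=` cube c%:num k) with
  | left h => CubeCompact h.1 h.2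
  | right _ => empty_compact c k
  end.

(* The index [j] stands for the number of parts k = j + 2. *)
Definition profile_space : topologicalType :=
  prod_topology (fun j => cube_compact (C j.+2) j.+2).

Definition profile (M : forall k, set 'M[R]_k) : profile_space :=
  fun j => to_cube_compact (C j.+2) (M j.+2).

Definition d_part (d : profile_space -> profile_space -> R)
    (M1 M2 : forall k, set 'M[R]_k) : R :=
  d (profile M1) (profile M2).

(* On the sets of matrices of graphs and bounded kernels that lie in the cube,
   [to_cube_compact] does not resort to its default value. *)
Lemma to_cube_compactK (c : {posnum R}) k (A : set 'M[R]_k) :
  compact A -> A `<=` cube c%:num k -> to_cube_compact c A = A :> set _.
Proof. by move=> cA sA; rewrite /to_cube_compact; case: pselect => // -[]. Qed.

Lemma graph_matrices_compact n (p : R) (G : sgraph n) k :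
  compact (graph_matrices p G k).
Proof.
apply: finite_compact.
pose F (Q : {ffun 'I_k -> {set 'I_n}}) : 'M[R]_k :=
  \matrix_(i, j) density p G (Q i) (Q j).
apply: (@sub_finite_set _ _ (F @` [set: {ffun 'I_k -> {set 'I_n}}])).
  move=> _ [P _ ->]; exists (finfun P) => //.
  by apply/matrixP => i j; rewrite !mxE !ffunE.
exact/finite_image/finite_finset.
Qed.

Lemma kernel_matrices_compact (c : R) (kappa : R * R -> R) k :
  kernel_matrices kappa k `<=` cube c k -> compact (kernel_matrices kappa k).
Proof.
move=> sub; apply: subclosed_compact (@compact_cube R c k) sub.
exact: closed_closure.
Qed.

End profile.

Definition metrizes {R : realType} (T : topologicalType) (d : T -> T -> R) :=
  [/\ forall x y, d x y = 0 <-> x = y,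
      forall x y, d x y = d y x,
      forall x y z, d x z <= d x y + d y z &
      forall x (A : set T),
        nbhs x A <-> exists2 e, 0 < e & [set y | d x y < e] `<=` A].

(* Main.v *)
Require Import Defs.
From mathcomp Require Import all_boot all_order all_algebra.
From mathcomp Require Import ring lra zify.
From mathcomp Require Import all_classical all_reals all_analysis.
From mathcomp Require Import measurable_realfun.

(** Both metrics are compared with one object: the kernel [kappa] averaged
over the cells of a grid of [m] intervals.  By [kernel_grid_approx] this step
kernel [c] is close to [kappa] in [L^1], hence in cut norm, and its integral
over [A x B] depends only on the masses of [A] and [B] inside the [m] cells.

Convergence in cut metric gives convergence of the sets of matrices
([cut_close_matrices_close]).  Let the kernel of the graph be close to
[kappa^(tau)] in cut norm.  A partition of [[0, 1]] into [k] parts of equal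
measure, pulled back along [tau], meets the interval of each vertex in [k]
masses, that is, in a fractional partition of the vertex set, whose matrix is
nearly that of the given partition ([kernel_partition_to_graph]).  Rounding
each vertex independently at random gives [e(P_i, P_j) / (p n^2)] the right
mean and a variance of order at most the sum of the [(deg v / (p n^2))^2],
which is [O(1 / (n p))] since the degrees are less than [n] and their sum is
[O(p n^2)]; this is where [n p -> oo] enters ([graph_rounding], in
derandomized form).  Moving few vertices makes the parts balanced
([near_rounding_balanced]).  Conversely the parts of a balanced partition of
the graph, seen as subsets of [[0, 1]], meet each cell
[tau^-1(cell)] in certain masses; cutting the cell into intervals with nearly
these lengths gives a partition of [[0, 1]] with nearly the same matrix
([graph_partition_to_kernel]).

Convergence of the sets of matrices gives convergence in cut metric
([matrices_close_cut_close]).  The partition of [[0, 1]] into the grid cells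
has matrix [c], so the graph has a balanced labelling [lam] of its vertices by
cells whose matrix is near [c].  It is enough that [G] is close in cut norm to
the function [c (lam u) (lam v)]: sorting the vertices by label then permutes
their intervals so that this function nearly becomes the step kernel of [c]
([labels_cut_close]).  Suppose that some vertex sets [A], [A'] violate this by
more than [delta].  With [<f, G>] the sum of [f u v / (p n^2)] over the ordered
pairs of adjacent vertices, put [test_value f = 2 <f, G> - |f|_2^2].  It is at
least [|c|_2^2 - o(1)] at [f = c o lam], and adding [delta] or [- delta] times
the indicator of [A x A'] raises it by at least [delta^2].  The new function
takes finitely many values determined by the labels [(lam, 1_A, 1_A')], so, up to
few vertices, it is constant on the pairs of blocks of a balanced partition
into [K] blocks, [K] large.  Completing the square, its test value is at most
the mean square of the densities of these blocks.  Closeness for [k = K]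
provides a partition of [[0, 1]] into [K] equal parts with nearly the same
matrix, and by Jensen's inequality the mean square of a matrix of [kappa] is at
most [|c|_2^2 + o(1)] ([label_energy_le]).  So [delta^2 = o(1)]
([cut_deviation_bound]), a contradiction. *)

Set Implicit Arguments.
Unset Strict Implicit.
Unset Printing Implicit Defensive.

Import Order.TTheory GRing.Theory Num.Theory.
Import numFieldNormedType.Exports.

Local Open Scope classical_set_scope.
Local Open Scope ring_scope.

(** * Bilinear forms with weights between 0 and 1 *)

Section extreme.
Local Open Scope set_scope.
Local Open Scope ring_scope.
Context {R : realDomainType}.

(** A linear form on the cube of weights is extremal at the indicator of a
set: that of the indices with coefficients of one sign. *)
Lemma linear_form_extreme n (b x : 'I_n -> R) (d : R) :
  (forall A : {set 'I_n}, `|\sum_(u in A) b u| <= d) ->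
  (forall u, 0 <= x u <= 1) -> `|\sum_u b u * x u| <= d.
Proof.
move=> bd x01; rewrite ler_norml; apply/andP; split.
  have := bd [set u | b u <= 0]; rewrite ler_norml => /andP[+ _].
  move/le_trans; apply; rewrite big_mkcond /=; apply: ler_sum => u _.
  rewrite inE; have /andP[x0 x1] := x01 u; case: ifP => [b0|/negbT].
    by rewrite -subr_ge0 -{2}[b u]mulr1 -mulrBr mulr_le0// subr_le0.
  by rewrite -ltNge => /ltW b0; rewrite mulr_ge0.
have := bd [set u | 0 <= b u]; rewrite ler_norml => /andP[_].
apply: le_trans; rewrite [leRHS]big_mkcond /=; apply: ler_sum => u _.
rewrite inE; have /andP[x0 x1] := x01 u; case: ifP => [b0|/negbT].
  by rewrite -[leRHS]mulr1 ler_wpM2l.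
by rewrite -ltNge => /ltW b0; rewrite mulr_le0_ge0.
Qed.

(** The linear case is applied to each of the two arguments in turn.  With it,
a bound over pairs of vertex sets controls the integrals over all measurable
rectangles, which meet the interval of a vertex in an arbitrary mass. *)
Lemma bilinear_form_extreme n (a : 'I_n -> 'I_n -> R) (d : R) :
  (forall A B : {set 'I_n}, `|\sum_(u in A) \sum_(v in B) a u v| <= d) ->
  forall x y : 'I_n -> R,
  (forall u, 0 <= x u <= 1) -> (forall u, 0 <= y u <= 1) ->
  `|\sum_u \sum_v a u v * x u * y v| <= d.
Proof.
move=> ad x y x01 y01; rewrite exchange_big /=.
under eq_bigr do rewrite -mulr_suml.
apply: linear_form_extreme => // B.
rewrite exchange_big /=; under eq_bigr do rewrite -mulr_suml.
exact: linear_form_extreme.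
Qed.

End extreme.

(** * Sorting vertices by label and cutting into blocks *)

Section sorting.
Local Open Scope set_scope.
Local Open Scope nat_scope.

Definition label_class n k (b : 'I_n -> 'I_k) (i : 'I_k) : {set 'I_n} :=
  [set v | b v == i].

(** In any order sorted by label, the class with label [l] occupies the
positions from [class_start b l] on. *)
Definition class_start n k (b : 'I_n -> 'I_k) (l : nat) : nat :=
  #|[set v | b v < l]|.

Lemma sorting_perm n k (b : 'I_n -> 'I_k) :
  exists s : 'I_n -> 'I_n, injective s /\ forall u v, b u < b v -> s u < s v.
Proof.
pose r := fun u v : 'I_n => b u <= b v.
pose w := sort r (enum 'I_n).
have rtr : transitive r by move=> y x z; exact: leq_trans.
have rtot : total r by move=> x y; exact: leq_total.
have wuniq : uniq w by rewrite sort_uniq enum_uniq.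
have wsize : size w = n by rewrite size_sort size_enum_ord.
have win v : v \in w by rewrite mem_sort mem_enum.
have lt_w v : index v w < n by rewrite -[ltnRHS]wsize index_mem.
exists (fun v => Ordinal (lt_w v)); split=> [u v [] /(congr1 (nth u w))|u v buv].
  by rewrite !nth_index.
rewrite ltnNge; apply/negP => /= vu.
have := sorted_leq_nth rtr (fun x => leqnn _) u (sort_sorted rtot (enum 'I_n)).
move=> /(_ (index v w) (index u w)); rewrite !inE !index_mem !win.
by move=> /(_ isT isT vu); rewrite !nth_index // /r leqNgt buv.
Qed.

Lemma card_ord_below n t : t <= n -> #|[set v : 'I_n | v < t]| = t.
Proof.
move=> tn; have wI : injective (widen_ord tn).
  by move=> x y /(congr1 val) /= /val_inj.
rewrite -[RHS]card_ord -[RHS](card_imset _ wI).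
apply: eq_card => v; rewrite inE; apply/idP/imsetP => [vt|[w _ ->]] /=.
  by exists (Ordinal vt) => //; apply: val_inj.
exact: ltn_ord.
Qed.

Lemma card_ord_between n t1 t2 : t2 <= n ->
  #|[set v : 'I_n | t1 <= v < t2]| = t2 - t1.
Proof.
move=> t2n; have [t12|t21] := leqP t1 t2; last first.
  have -> : t2 - t1 = 0 by lia.
  apply: eq_card0 => v; rewrite !inE; apply/negP => /andP[v1 v2].
  by have := leq_trans v2 (leq_trans (ltnW t21) v1); rewrite ltnn.
transitivity #|[set v : 'I_n | v < t2] :\: [set v : 'I_n | v < t1]|; last first.
  rewrite cardsDS; first by rewrite !card_ord_below// (leq_trans t12).
  by apply/fintype.subsetP => v; rewrite !inE => /leq_trans; exact.
by apply: eq_card => v; rewrite !inE -leqNgt.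
Qed.

(** The map [s] is a bijection that is monotone in the label, so it maps the
vertices of smaller label below the position of [v] and reaches every position
up to it from labels at most that of [v]. *)
Lemma class_start_sorted n k (b : 'I_n -> 'I_k) (s : 'I_n -> 'I_n) : injective s ->
  (forall u v, b u < b v -> s u < s v) ->
  forall v : 'I_n, class_start b (b v) <= s v < class_start b (b v).+1.
Proof.
move=> sI sb v; apply/andP; split.
  rewrite -[leqRHS](card_ord_below (ltnW (ltn_ord (s v)))).
  rewrite -[leqLHS](card_imset _ sI); apply/subset_leq_card/fintype.subsetP => _ /imsetP[u + ->].
  by rewrite !inE; exact: sb.
have sS : bijective s by exact: injF_bij.
rewrite -[leqLHS](card_ord_below (ltn_ord (s v))) -[leqRHS](card_imset _ sI).
apply/subset_leq_card/fintype.subsetP => w; rewrite inE ltnS => wv.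
have [g _ gK] := sS; rewrite -(gK w); apply: imset_f; rewrite inE ltnS.
by rewrite leqNgt; apply/negP => /sb; rewrite gK ltnNge wv.
Qed.

(** Cutting [n] positions into the [K] blocks [t * K %/ n] gives intervals of
positions; block [i] starts at the ceiling of [i * n / K]. *)
Lemma block_mem n K t i : 0 < K -> 0 < n ->
  (t * K %/ n == i) = ((i * n + K.-1) %/ K <= t < (i.+1 * n + K.-1) %/ K).
Proof.
move=> K0 n0; apply/eqP/idP => [<-|].
  have := divn_eq (t * K) n; have := ltn_pmod (t * K) n0.
  set q := t * K %/ n; set r := (t * K) %% n => rn tK.
  apply/andP; split; last by rewrite leq_divRL//; nia.
  by rewrite -ltnS ltn_divLR//; nia.
move=> /andP[h1 h2].
have {}h1 : i * n <= t * K.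
  by move: h1; rewrite -ltnS ltn_divLR//; nia.
have {}h2 : t * K < i.+1 * n by move: h2; rewrite leq_divRL//; nia.
by apply/eqP; rewrite eqn_leq leq_divRL// h1 andbT -ltnS ltn_divLR// h2.
Qed.

Lemma block_lt n K (t : 'I_n) : 0 < K -> t * K %/ n < K.
Proof.
move=> K0; have n0 : 0 < n by case: t => t; lia.
by rewrite ltn_divLR// mulnC ltn_pmul2l.
Qed.

Lemma card_block n K i : 0 < K -> 0 < n -> i < K ->
  n %/ K <= #|[set t : 'I_n | t * K %/ n == i]| <= (n.-1 %/ K).+1.
Proof.
move=> K0 n0 iK.
under eq_finset do rewrite block_mem//.
rewrite card_ord_between; last first.
  rewrite -ltnS ltn_divLR//; nia.
have e1 := divn_eq (i * n + K.-1) K; have l1 := ltn_pmod (i * n + K.-1) K0.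
have e2 := divn_eq (i.+1 * n + K.-1) K; have l2 := ltn_pmod (i.+1 * n + K.-1) K0.
set q1 := (_ %/ K) in e1 *; set q2 := (_ %/ K) in e2 *.
set r1 := (_ %% K) in e1 l1; set r2 := (_ %% K) in e2 l2.
have E : q2 * K + r2 = q1 * K + r1 + n by rewrite -e1 -e2; nia.
have e3 := divn_eq n K; have l3 := ltn_pmod n K0.
have e4 := divn_eq n.-1 K; have l4 := ltn_pmod n.-1 K0.
set q3 := n %/ K in e3 *; set q4 := n.-1 %/ K in e4 *.
have lo : (q1 + q3) * K < q2.+1 * K by rewrite mulnDl mulSn; lia.
have hi : q2 * K < (q1 + q4).+2 * K by rewrite !mulSn mulnDl; lia.
rewrite !ltn_pmul2r// in lo hi.
by clearbody q1 q2 q3 q4; clear - lo hi; lia.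
Qed.

Lemma card_block_le n K i : 0 < K -> 0 < n -> i < K ->
  #|[set t : 'I_n | t * K %/ n == i]| <= (n %/ K).+1.
Proof.
move=> K0 n0 iK; have /andP[_ /leq_trans] := card_block K0 n0 iK; apply.
by rewrite ltnS leq_div2r// leq_pred.
Qed.

End sorting.

Section off_boundary.
Local Open Scope set_scope.
Local Open Scope nat_scope.

(** A labelling [b] into [k] classes, sorted by [s], would ideally send the
vertices of label [i] to the positions between [i n / k] and [(i + 1) n / k].
It fails for [v] when the interval from [s v] to [s v + 1] is not inside this
range. *)
Definition off_boundary n k (b : 'I_n -> 'I_k) (s : 'I_n -> 'I_n) : {set 'I_n} :=
  [set v | ~~ ((b v * n <= s v * k) && ((s v).+1 * k <= (b v).+1 * n))].

Lemma card_window n (s : 'I_n -> 'I_n) t H : injective s ->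
  #|[set v | (t <= s v + H) && (s v <= t + H)]| <= (2 * H).+1.
Proof.
move=> sI; have [n0|n0] := posnP n.
  by rewrite (leq_trans (max_card _))// card_ord n0.
rewrite -(card_imset _ sI).
apply: (@leq_trans #|[set v : 'I_n | t - H <= v < minn n (t + H).+1]|).
  apply/subset_leq_card/fintype.subsetP => _ /imsetP[v + ->].
  by rewrite !inE leq_min ltn_ord ltnS leq_subLR [H + _]addnC => /andP[-> ->].
by rewrite card_ord_between ?geq_minl//; lia.
Qed.

(** If every class starts within [H] of its ideal position, a misplaced vertex
sits within [H] of one of the [k + 1] starts, because its label differs from
the ideal one only between the actual and the ideal start. *)
Lemma card_off_boundary n k (b : 'I_n -> 'I_k) (s : 'I_n -> 'I_n) H : injective s ->
  (forall u v, b u < b v -> s u < s v) ->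
  (forall l, l <= k -> class_start b l * k <= l * n + k * H) ->
  (forall l, l <= k -> l * n <= class_start b l * k + k * H) ->
  #|off_boundary b s| <= k.+1 * (2 * H).+1.
Proof.
move=> sI sb up lo.
apply: (@leq_trans #|\bigcup_(l < k.+1)
    [set v | (class_start b l <= s v + H) && (s v <= class_start b l + H)]|).
  apply/subset_leq_card/fintype.subsetP => v; rewrite inE negb_and -!ltnNge.
  have /andP[s1 s2] := class_start_sorted sI sb v.
  have k0 : 0 < k by case: (b v) => i; lia.
  case/orP => [lt1|lt2].
    apply/bigcupP; exists (widen_ord (leqnSn k) (b v)) => //.
    rewrite inE /= (leq_trans s1 (leq_addr _ _))/=.
    rewrite -(leq_pmul2r k0); have := lo (b v) (ltnW (ltn_ord _)).
    by rewrite mulnDl [H * k]mulnC; move: lt1; lia.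
  apply/bigcupP; exists (lift ord0 (b v)) => //.
  rewrite inE /= /bump /= add1n (leq_trans (ltnW s2) (leq_addr _ _)) andbT.
  rewrite -ltnS -(ltn_pmul2r k0); have := up (b v).+1 (ltn_ord _).
  by rewrite -addSn mulnDl [H * k]mulnC; move: lt2; lia.
apply: (@leq_trans (\sum_(l < k.+1) (2 * H).+1)); last first.
  by rewrite sum_nat_const card_ord.
apply: (@leq_trans (\sum_(l < k.+1)
    #|[set v | (class_start b l <= s v + H) && (s v <= class_start b l + H)]|)).
  elim/big_rec2: _ => [|l x y _ xy]; first by rewrite cards0.
  by rewrite (leq_trans (leq_card_setU _ _))// leq_add2l.
by apply: leq_sum => l _; exact: card_window.
Qed.

End off_boundary.

(** * Balanced partitions as labellings *)

Section balanced_labels.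
Local Open Scope set_scope.
Local Open Scope ring_scope.
Context {R : realType}.

Definition balanced_label n k (b : 'I_n -> 'I_k) :=
  (forall i, (0 < #|label_class b i|)%N) /\
  (forall i j, (#|label_class b i| <= #|label_class b j|.+1)%N).

Lemma graph_matricesP n (p : R) (G : sgraph n) k (M : 'M[R]_k) :
  graph_matrices p G k M <-> exists2 b : 'I_n -> 'I_k, balanced_label b &
    M = \matrix_(i, j) density p G (label_class b i) (label_class b j).
Proof.
split=> [[P [Pgt0 Pdis Pcov Pbal] ->]|[b [bgt0 bbal] ->]].
  have /choice[b bP] := Pcov.
  have Pb i : P i = label_class b i.
    apply/setP => v; rewrite inE; apply/idP/eqP => [vi|<-//].
    exact: Pdis (bP v) vi.
  exists b; first by split=> [i|i j]; rewrite -!Pb.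
  by apply/matrixP => i j; rewrite !mxE !Pb.
exists (label_class b) => //; split=> //.
- by move=> i j v; rewrite !inE => /eqP <- /eqP.
- by move=> v; exists (b v); rewrite inE.
Qed.

Lemma sum_card_label n k (b : 'I_n -> 'I_k) :
  (\sum_i #|label_class b i| = n)%N.
Proof.
rewrite -[RHS]card_ord -sum1_card (partition_big b xpredT)//=.
apply: eq_bigr => i _; rewrite -sum1_card.
by apply: eq_bigl => v; rewrite inE.
Qed.

(** All classes differ from class [i] by at most one vertex; summing over the
classes compares [k] times its size with [n]. *)
Lemma balanced_label_card n k (b : 'I_n -> 'I_k) i : (0 < n)%N ->
  balanced_label b ->
  `|#|label_class b i|%:R / n%:R - k%:R^-1 :> R| <= n%:R^-1.
Proof.
move=> n0 [_ bal]; set a := #|label_class b i|.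
have k0 : (0 < k)%N by case: i {a} => i; case: k b bal.
have le1 : (k * a <= n + k)%N.
  rewrite -(sum_card_label b) -[k in (_ + k)%N]card_ord -sum1_card -big_split /=.
  rewrite -[X in (X * a)%N]card_ord -sum_nat_const; apply: leq_sum => j _.
  by rewrite addn1 bal.
have le2 : (n <= k * a + k)%N.
  rewrite -{1}(sum_card_label b) addnC -mulnS -[X in (X * _)%N]card_ord -sum_nat_const.
  by apply: leq_sum => j _; exact: bal.
have n0' : 0 < n%:R :> R by rewrite ltr0n.
have k0' : 0 < k%:R :> R by rewrite ltr0n.
have {}le1 : k%:R * a%:R <= n%:R + k%:R :> R by rewrite -natrM -natrD ler_nat.
have {}le2 : n%:R <= k%:R * a%:R + k%:R :> R by rewrite -natrM -natrD ler_nat.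
rewrite -(ler_pM2r (mulr_gt0 n0' k0')) mulKf ?gt_eqF//.
rewrite -[X in _ * X]gtr0_norm ?mulr_gt0// -normrM mulrBl.
rewrite mulrA mulfVK ?gt_eqF// [n%:R * _]mulrC mulKf ?gt_eqF//.
by rewrite ler_norml; apply/andP; split; lra.
Qed.

Lemma block_label_balanced n k (s : 'I_n -> 'I_n) (k0 : (0 < k)%N) :
  injective s -> (k <= n)%N ->
  balanced_label (fun v => Ordinal (block_lt (s v) k0)).
Proof.
move=> sI kn; have n0 : (0 < n)%N by exact: leq_trans kn.
have card i : #|label_class (fun v => Ordinal (block_lt (s v) k0)) i| =
    #|[set t : 'I_n | (t * k %/ n == i)%N]|.
  rewrite -[LHS](card_imset _ sI); apply: eq_card => t.
  have [g _ gK] : bijective s by exact: injF_bij.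
  apply/imsetP/idP => [[v + ->]|]; rewrite !inE; first by move/eqP <-.
  by move=> ti; exists (g t) => //; rewrite inE -val_eqE /= gK.
split=> [i|i j]; rewrite !card.
  have /andP[+ _] := card_block k0 n0 (ltn_ord i).
  by apply: leq_trans; rewrite divn_gt0.
have /andP[_ /leq_trans] := card_block k0 n0 (ltn_ord i); apply.
have /andP[le _] := card_block k0 n0 (ltn_ord j).
by rewrite ltnS (leq_trans _ le)// leq_div2r// leq_pred.
Qed.

Lemma class_start_sum n k (b : 'I_n -> 'I_k) l :
  class_start b l = (\sum_(i < k | (i < l)%N) #|label_class b i|)%N.
Proof.
rewrite /class_start -sum1_card (partition_big b (fun i : 'I_k => (i < l)%N))/=.
  apply: eq_bigr => i il; rewrite -sum1_card; apply: eq_bigl => v.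
  by rewrite !inE; case: eqP => [->|]; rewrite ?il ?andbF.
by move=> v; rewrite inE.
Qed.

(** The errors of at most [k] class sizes add up. *)
Lemma class_start_near n k (b : 'I_n -> 'I_k) (H : nat) :
  (forall i, `|#|label_class b i|%:R - n%:R / k%:R :> R| <= H%:R / k%:R) ->
  (0 < k)%N -> forall l, (l <= k)%N ->
  (class_start b l * k <= l * n + k * H)%N /\
  (l * n <= class_start b l * k + k * H)%N.
Proof.
move=> near k0 l lk; have k0' : 0 < k%:R :> R by rewrite ltr0n.
have : `|(class_start b l)%:R - (l%:R * (n%:R / k%:R)) :> R| <= H%:R.
  have -> : l%:R * (n%:R / k%:R) = \sum_(i < k | (i < l)%N) (n%:R / k%:R) :> R.
    rewrite sumr_const mulr_natl; congr (_ *+ _).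
    by rewrite -[LHS](card_ord_below lk); apply: eq_card => i; rewrite !inE.
  rewrite class_start_sum natr_sum -sumrB (le_trans (ler_norm_sum _ _ _))//.
  apply: le_trans (ler_sum _ (fun i _ => near i)) _.
  apply: (@le_trans _ _ (\sum_(i < k) (H%:R / k%:R : R))).
    by rewrite big_mkcond /=; apply: ler_sum => i _; case: ifP.
  by rewrite sumr_const card_ord -[leLHS]mulr_natr mulfVK ?gt_eqF.
have -> : l%:R * (n%:R / k%:R) = (l * n)%N%:R / k%:R :> R by rewrite mulrA natrM.
rewrite ler_norml => /andP[h1 h2].
have := ler_wpM2r (ltW k0') h2; have := ler_wpM2r (ltW k0') h1.
rewrite mulrBl mulfVK ?gt_eqF// mulNr -!natrM => h3 h4.
have : (l * n)%:R <= (class_start b l * k + H * k)%:R :> R by rewrite natrD; lra.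
have : (class_start b l * k)%:R <= (l * n + H * k)%:R :> R by rewrite natrD; lra.
by rewrite !ler_nat => ? ?; split; lia.
Qed.

End balanced_labels.

(** * Rounding fractional partitions *)

Section rounding.
Local Open Scope set_scope.
Local Open Scope ring_scope.
Context {R : realFieldType}.

Lemma exists_le_average k (w y : 'I_k -> R) (M : R) :
  (forall i, 0 <= w i) -> \sum_i w i = 1 -> \sum_i w i * y i <= M ->
  exists i, y i <= M.
Proof.
move=> w0 w1 wy; apply: contrapT => /forallNP nle.
have lt_M i : M < y i by rewrite ltNge; apply/negP/nle.
have : \sum_i w i * (y i - M) <= 0.
  by under eq_bigr do rewrite mulrBr; rewrite sumrB -mulr_suml w1 mul1r subr_le0.
rewrite le_eqVlt ltNge sumr_ge0 ?orbF; last first.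
  by move=> i _; rewrite mulr_ge0// subr_ge0 ltW.
rewrite psumr_eq0 => [/allP w_eq0|i _]; last by rewrite mulr_ge0// subr_ge0 ltW.
have : \sum_i w i = 0.
  apply: big1 => i _; have := w_eq0 i (mem_index_enum _).
  by rewrite mulf_eq0 subr_eq0 (gt_eqF (lt_M i)) orbF => /eqP.
by rewrite w1 => /eqP; rewrite oner_eq0.
Qed.

(** The weight [x v i] is the share of vertex [v] in part [i]. *)
Definition fractional n k (x : 'I_n -> 'I_k -> R) :=
  forall v, (forall i, 0 <= x v i) /\ \sum_i x v i = 1.

Definition one_hot k (i : 'I_k) : 'I_k -> R := fun j => (j == i)%:R.

Definition set_row n k (x : 'I_n -> 'I_k -> R) v r :=
  fun u => if u == v then r else x u.

Lemma sum_one_hot k (i : 'I_k) : \sum_j one_hot i j = 1.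
Proof.
rewrite (bigD1 i)//= /one_hot eqxx big1 ?addr0// => j /negbTE ji.
by rewrite ji.
Qed.

Lemma fractional_set_row n k (x : 'I_n -> 'I_k -> R) v i :
  fractional x -> fractional (set_row x v (one_hot i)).
Proof.
move=> fx u; rewrite /set_row; case: eqP => // _; split=> [j|].
  by rewrite /one_hot.
exact: sum_one_hot.
Qed.

(** The method of conditional expectations for a sum of squares.  Each [F l]
is a martingale when the rows are replaced one by one by a random unit vector
with distribution [x v]; so the mean of [(F l - F l x)^2] grows by at most
[D(v)^2] at step [v], and some choice of the unit vector does not exceed the
mean. *)
Lemma derandomized_rounding n k (L : finType)
    (F : L -> ('I_n -> 'I_k -> R) -> R) (D : 'I_n -> R) (x : 'I_n -> 'I_k -> R) :
  (forall l x v, fractional x ->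
     \sum_i x v i * F l (set_row x v (one_hot i)) = F l x) ->
  (forall l x v i, fractional x ->
     `|F l (set_row x v (one_hot i)) - F l x| <= D v) ->
  fractional x ->
  exists b : 'I_n -> 'I_k,
    \sum_l (F l (fun v => one_hot (b v)) - F l x) ^+ 2
      <= #|L|%:R * \sum_v D v ^+ 2.
Proof.
move=> Fmean Fdev fx.
(* The invariant after the vertices in a list have been rounded; the bound is
over the same list. *)
suff [x' [fx' hot le_x']] : exists x', [/\ fractional x',
    (forall v, v \in index_enum 'I_n -> exists i, x' v = one_hot i) &
    \sum_l (F l x' - F l x) ^+ 2 <= #|L|%:R * \sum_v D v ^+ 2].
  have /choice[b xb] : forall v, exists i, x' v = one_hot i.
    by move=> v; apply: hot; exact: mem_index_enum.
  by exists b; rewrite (_ : (fun v => _) = x')//; apply/funext => v.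
elim: (index_enum _) => [|v s [x' [fx' hot le_x']]].
  exists x; split=> //; rewrite big_nil mulr0 big1// => l _.
  by rewrite subrr expr0n.
have [x'0 x'1] := fx' v.
pose Psi i := \sum_l (F l (set_row x' v (one_hot i)) - F l x) ^+ 2.
have [] := @exists_le_average k (x' v) Psi
  (\sum_l (F l x' - F l x) ^+ 2 + #|L|%:R * D v ^+ 2) x'0 x'1.
  under eq_bigr do rewrite /Psi mulr_sumr.
  rewrite exchange_big /= mulr_natl -sumr_const -big_split /=.
  apply: ler_sum => l _.
  under eq_bigr => i _.
    rewrite (_ : _ * _ = (F l x' - F l x) ^+ 2 * x' v i +
      (2 * (F l x' - F l x)) *
        (x' v i * F l (set_row x' v (one_hot i)) - x' v i * F l x') +
      x' v i * (F l (set_row x' v (one_hot i)) - F l x') ^+ 2); last by ring.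
    over.
  rewrite !big_split /= -!mulr_sumr sumrB Fmean// -mulr_suml x'1 mul1r subrr.
  rewrite mulr1 mulr0 addr0 lerD2l -[leRHS]mul1r -x'1 mulr_suml.
  apply: ler_sum => i _; apply: ler_wpM2l => //.
  rewrite -[leLHS]real_normK ?num_real//.
  by rewrite lerXn2r ?nnegrE ?(le_trans _ (Fdev l x' v i fx'))// Fdev.
move=> i le_i; exists (set_row x' v (one_hot i)); split.
- exact: fractional_set_row.
- move=> u; rewrite inE /set_row; case: eqP => [_ _|_ /= /hot//].
  by exists i.
- by rewrite big_cons mulrDr addrC (le_trans le_i)// lerD2r.
Qed.

End rounding.

Section edge_form.
Local Open Scope set_scope.
Local Open Scope ring_scope.
Context {R : realType}.
Variables (n : nat) (p : R) (G : sgraph n).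
Hypothesis p_gt0 : 0 < p.
Implicit Types x y : 'I_n -> R.

(** The number of edges from [A] to [B], divided by [p n^2], extended
bilinearly from indicators to arbitrary weights on the vertices. *)
Definition edge_form x y : R :=
  (p * n%:R ^+ 2)^-1 * \sum_u \sum_v (adj G u v)%:R * (x u * y v).

Definition set_ind (A : {set 'I_n}) : 'I_n -> R := fun v => (v \in A)%:R.

Definition point_ind (v : 'I_n) : 'I_n -> R := fun u => (u == v)%:R.

Lemma edge_form_sym x y : edge_form x y = edge_form y x.
Proof.
rewrite /edge_form exchange_big /=; congr (_ * _).
apply: eq_bigr => u _; apply: eq_bigr => v _.
by rewrite adj_sym [y u * _]mulrC.
Qed.

Lemma edge_formDl x y z : edge_form (fun u => x u + y u) z =
  edge_form x z + edge_form y z.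
Proof.
rewrite /edge_form -mulrDr -big_split /=; congr (_ * _); apply: eq_bigr => u _.
by rewrite -big_split /=; apply: eq_bigr => v _; ring.
Qed.

Lemma edge_formZl a x z : edge_form (fun u => a * x u) z = a * edge_form x z.
Proof.
rewrite /edge_form [RHS]mulrCA; congr (_ * _); rewrite mulr_sumr.
by apply: eq_bigr => u _; rewrite mulr_sumr; apply: eq_bigr => v _; ring.
Qed.

Lemma edge_formDr x y z : edge_form z (fun u => x u + y u) =
  edge_form z x + edge_form z y.
Proof. by rewrite edge_form_sym edge_formDl !(edge_form_sym _ z). Qed.

Lemma edge_formZr a x z : edge_form z (fun u => a * x u) = a * edge_form z x.
Proof. by rewrite edge_form_sym edge_formZl edge_form_sym. Qed.

Lemma edge_form_coef_ge0 : 0 <= (p * n%:R ^+ 2)^-1.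
Proof. by rewrite invr_ge0 mulr_ge0 ?exprn_ge0// ltW. Qed.

Lemma le_edge_form x x' y y' :
  (forall u, 0 <= x u <= x' u) -> (forall u, 0 <= y u <= y' u) ->
  edge_form x y <= edge_form x' y'.
Proof.
move=> xx' yy'; apply: ler_wpM2l; first exact: edge_form_coef_ge0.
apply: ler_sum => u _; apply: ler_sum => v _; apply: ler_wpM2l => //.
by have /andP[? ?] := xx' u; have /andP[? ?] := yy' v; exact: ler_pM.
Qed.

Lemma edge_form_ge0 x y :
  (forall u, 0 <= x u) -> (forall u, 0 <= y u) -> 0 <= edge_form x y.
Proof.
move=> x0 y0; rewrite mulr_ge0 ?edge_form_coef_ge0// sumr_ge0// => u _.
by rewrite sumr_ge0// => v _; rewrite !mulr_ge0.
Qed.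

(** There are no loops.  Therefore [edge_form] is affine in each row of a
fractional partition although both of its arguments depend on that row. *)
Lemma edge_form_point_point v : edge_form (point_ind v) (point_ind v) = 0.
Proof.
rewrite /edge_form big1 ?mulr0// => u _; rewrite big1// => w _.
rewrite /point_ind; case: eqP => [->|]; last by rewrite mul0r mulr0.
by case: eqP => [->|]; rewrite ?adj_irr ?mul0r// !mulr0.
Qed.

Lemma edge_form_edge_count (A B : {set 'I_n}) :
  edge_form (set_ind A) (set_ind B) =
  (edge_count G A B)%:R / (p * n%:R ^+ 2).
Proof.
rewrite /edge_form mulrC; congr (_ / _).
rewrite /edge_count -sum1_card natr_sum [RHS]big_mkcond /=.
rewrite pair_bigA /=; apply: eq_bigr => -[u v] _ /=.
rewrite inE /= /set_ind -!natrM.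
by case: (u \in A); case: (v \in B); case: (adj G u v).
Qed.

(** The degree of a vertex is at most [n]. *)
Lemma edge_form_point_le v : (0 < n)%N ->
  edge_form (point_ind v) (fun=> 1) <= (p * n%:R)^-1.
Proof.
move=> n0; rewrite /edge_form (bigD1 v)//= [X in _ + X]big1 ?addr0; last first.
  move=> u /negbTE uv; rewrite big1// => w _.
  by rewrite /point_ind uv mul0r mulr0.
apply: le_trans (_ : (p * n%:R ^+ 2)^-1 * n%:R <= _).
  apply: ler_wpM2l; first exact: edge_form_coef_ge0.
  rewrite -[X in _ <= X%:R]card_ord -sumr_const; apply: ler_sum => w _.
  by rewrite /point_ind eqxx !mulr1; case: adj.
by rewrite expr2 mulrA invfM -mulrA mulVf ?mulr1// pnatr_eq0 -lt0n.
Qed.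

Lemma edge_form_sum_point y :
  \sum_v edge_form (point_ind v) y = edge_form (fun=> 1) y.
Proof.
rewrite /edge_form -mulr_sumr exchange_big /=; congr (_ * _).
apply: eq_bigr => u _; rewrite exchange_big /=; apply: eq_bigr => w _.
rewrite (bigD1 u)//= big1 ?addr0; last first.
  by move=> v /negbTE vu; rewrite /point_ind eq_sym vu mul0r mulr0.
by rewrite /point_ind eqxx.
Qed.

(** The rounding is applied jointly to the [k^2] edge forms between parts and
the [k] part sizes.  Replacing the row of [v] changes them by at most [D v = 2
deg(v) / (p n^2) + 1 / n]; as [deg v <= n], the sum of the squares is bounded
by [1 / (p n)] times the total edge density, plus [2 / n]. *)
Lemma graph_rounding k (x : 'I_n -> 'I_k -> R) : (0 < n)%N -> fractional x ->
  exists b : 'I_n -> 'I_k, let E := (k ^ 2 + k)%:R *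
      (8 * edge_form (fun=> 1) (fun=> 1) / (p * n%:R) + 2 / n%:R) in
    (forall i j, (edge_form (set_ind (label_class b i)) (set_ind (label_class b j))
      - edge_form (x^~ i) (x^~ j)) ^+ 2 <= E) /\
    (forall i, (#|label_class b i|%:R / n%:R - (\sum_u x u i) / n%:R) ^+ 2 <= E).
Proof.
move=> n0 fx; have n0' : 0 < n%:R :> R by rewrite ltr0n.
pose F (l : ('I_k * 'I_k) + 'I_k) (x : 'I_n -> 'I_k -> R) : R :=
  match l with
  | inl (i, j) => edge_form (x^~ i) (x^~ j)
  | inr i => (\sum_u x u i) / n%:R
  end.
pose D v := 2 * edge_form (point_ind v) (fun=> 1) + n%:R^-1.
have row (y : 'I_n -> 'I_k -> R) v i j : (set_row y v (one_hot i))^~ j =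
    fun u => y u j + (one_hot i j - y v j) * point_ind v u.
  apply/funext => u; rewrite /set_row /point_ind; case: eqP => [->|_].
    by rewrite mulr1 addrC subrK.
  by rewrite mulr0 addr0.
have F2 (y : 'I_n -> 'I_k -> R) v l i j : F (inl (i, j)) (set_row y v (one_hot l)) =
    F (inl (i, j)) y + (one_hot l i - y v i) * edge_form (point_ind v) (y^~ j)
      + (one_hot l j - y v j) * edge_form (y^~ i) (point_ind v).
  rewrite /F !row !(edge_formDl, edge_formDr, edge_formZl, edge_formZr).
  by rewrite edge_form_point_point; ring.
have F1 (y : 'I_n -> 'I_k -> R) v l i : F (inr i) (set_row y v (one_hot l)) =
    F (inr i) y + (one_hot l i - y v i) / n%:R.
  rewrite /F -mulrDl; congr (_ / _).
  rewrite (bigD1 v)//= [in RHS](bigD1 v)//= addrAC; congr (_ + _).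
    by rewrite /set_row eqxx; ring.
  by apply: eq_bigr => u /negbTE uv; rewrite /set_row uv.
have wmean (y : 'I_n -> 'I_k -> R) v i : fractional y ->
    \sum_l y v l * (one_hot l i - y v i) = 0.
  move=> fy; have [_ y1] := fy v.
  under eq_bigr do rewrite mulrBr.
  rewrite sumrB -mulr_suml y1 mul1r (bigD1 i)//= /one_hot eqxx mulr1.
  by rewrite big1 ?addr0 ?subrr// => l /negbTE li; rewrite eq_sym li mulr0.
have dev1 (y : 'I_n -> 'I_k -> R) v l i : fractional y ->
    `|one_hot l i - y v i| <= 1.
  move=> fy; have [y0 y1] := fy v.
  have yle1 : y v i <= 1.
    by rewrite -y1 (bigD1 i)//= lerDl sumr_ge0.
  have := y0 i; rewrite /one_hot ler_norml; case: eqP => _ /= ?; lra.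
have y01 (y : 'I_n -> 'I_k -> R) u j : fractional y -> 0 <= y u j <= 1.
  by move=> fy; have [y0 y1] := fy u; rewrite y0 -y1 (bigD1 j)//= lerDl sumr_ge0.
have pt01 v u : 0 <= point_ind v u <= point_ind v u.
  by rewrite lexx andbT /point_ind ler0n.
have [//||b Hb] := @derandomized_rounding R n k _ F D x _ _ fx.
- move=> [[i j]|i] y v fy.
    have lin (w f a e c e' : R) : w * (f + a * e + c * e') =
        w * f + (w * a) * e + (w * c) * e' by ring.
    under eq_bigr do rewrite F2 lin.
    rewrite !big_split /= -!mulr_suml !wmean//.
    by have [_ ->] := fy v; rewrite mul1r !mul0r !addr0.
  have lin (w f a e : R) : w * (f + a / e) = w * f + (w * a) / e by ring.
  under eq_bigr do rewrite F1 lin.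
  rewrite big_split /= -!mulr_suml wmean//.
  by have [_ ->] := fy v; rewrite mul1r !mul0r !addr0.
- move=> [[i j]|i] y v l fy.
    have cancel (f a c : R) : f + a + c - f = a + c by ring.
    rewrite F2 cancel.
    rewrite (le_trans (ler_normD _ _))// /D.
    rewrite (normrM (one_hot l i - _)) (normrM (one_hot l j - _)).
    rewrite -[leLHS]addr0 lerD ?invr_ge0//.
    rewrite mulr2n mulrDl !mul1r; apply: lerD.
      rewrite -[leRHS]mul1r; apply: ler_pM => //; first exact: dev1.
      rewrite ger0_norm; last first.
        by apply: edge_form_ge0 => u; [rewrite /point_ind|have /andP[] := y01 y u j fy].
      by apply: le_edge_form => // u; exact: y01.
    rewrite -[leRHS]mul1r; apply: ler_pM => //; first exact: dev1.
      rewrite ger0_norm; last first.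
      by apply: edge_form_ge0 => u; [have /andP[] := y01 y u i fy|rewrite /point_ind].
    by rewrite [leRHS]edge_form_sym; apply: le_edge_form => // u; exact: y01.
  rewrite F1 addrAC subrr add0r normrM -[leLHS]add0r lerD//.
    rewrite mulr_ge0// edge_form_ge0// => u; by rewrite /point_ind.
  rewrite [X in _ * X]ger0_norm ?invr_ge0//.
  by rewrite -[leRHS]mul1r ler_wpM2r ?invr_ge0// dev1.
exists b; set E := (X in _ * X).
have DE : \sum_v D v ^+ 2 <= E.
  rewrite /E; apply: le_trans (_ : \sum_v (8 / (p * n%:R) *
      edge_form (point_ind v) (fun=> 1) + 2 / n%:R * n%:R^-1) <= _).
    apply: ler_sum => v _; rewrite /D.
    have := edge_form_point_le v n0.
    have : 0 <= edge_form (point_ind v) (fun=> 1).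
      by apply: edge_form_ge0 => // u; rewrite /point_ind.
    set e := edge_form _ _; set q := (p * _)^-1 => e0 eq.
    have : 0 <= n%:R^-1 :> R by rewrite invr_ge0.
    set m := n%:R^-1 => m0.
    have : e * e <= q * e by rewrite ler_wpM2r.
    have : 0 <= (2 * e - m) ^+ 2 by rewrite sqr_ge0.
    nra.
  rewrite big_split /= -mulr_sumr edge_form_sum_point sumr_const card_ord.
  rewrite -[X in _ + X]mulr_natr mulfVK ?gt_eqF//.
  by rewrite mulrAC lexx.
have card : #|{: ('I_k * 'I_k) + 'I_k}| = (k ^ 2 + k)%N.
  by rewrite card_sum card_prod !card_ord -mulnn.
rewrite card in Hb.
have {}Hb : \sum_l (F l (fun v => one_hot (b v)) - F l x) ^+ 2 <= (k ^ 2 + k)%:R * E.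
  by apply: le_trans Hb _; rewrite ler_wpM2l.
have each l : (F l (fun v => one_hot (b v)) - F l x) ^+ 2 <= (k ^ 2 + k)%:R * E.
  apply: le_trans Hb; rewrite (bigD1 l)//= lerDl sumr_ge0// => l' _.
  exact: sqr_ge0.
have ind i : (fun v => one_hot (b v) i) = set_ind (label_class b i).
  by apply/funext => v; rewrite /one_hot /set_ind inE eq_sym.
split=> [i j|i]; first by have := each (inl (i, j)); rewrite /F /= !ind.
have := each (inr i); rewrite /F /= (_ : \sum_u one_hot (b u) i = #|label_class b i|%:R) //.
rewrite -sum1_card natr_sum [RHS]big_mkcond /=; apply: eq_bigr => u _.
by rewrite /one_hot inE eq_sym; case: eqP.
Qed.

End edge_form.

(** * Densities and roundings in large graphs *)

Section large_graphs.
Local Open Scope set_scope.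
Local Open Scope ring_scope.
Context {R : realType}.

Lemma near_within_large (S : set nat) (Q : nat -> Prop) :
  (\forall n \near \oo, Q n) -> \forall n \near within S \oo, Q n.
Proof. by move=> nQ; rewrite near_withinE; apply: filterS nQ. Qed.

Lemma near_within_nat (S : set nat) (N : nat) :
  \forall n \near within S \oo, (N <= n)%N.
Proof. by apply: near_within_large; exact: nbhs_infty_ge. Qed.

Lemma near_within_real (S : set nat) (r : R) :
  \forall n \near within S \oo, r <= n%:R.
Proof. by apply: near_within_large; exact: nbhs_infty_ger. Qed.

Lemma near_within_mem (S : set nat) : \forall n \near within S \oo, S n.
Proof. exact: withinT. Qed.

Lemma density_edge_form n (p : R) (G : sgraph n) (A B : {set 'I_n}) :
  0 < p -> (0 < n)%N -> density p G A B =
  edge_form p G (set_ind A) (set_ind B) / ((#|A|%:R / n%:R) * (#|B|%:R / n%:R)).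
Proof.
move=> p0 n0; rewrite edge_form_edge_count /density.
have n0' : n%:R != 0 :> R by rewrite pnatr_eq0 -lt0n.
have p0' : p != 0 by rewrite gt_eqF.
have [->|A0] := posnP #|A|; first by rewrite !(mul0r, mulr0, invr0).
have [->|B0] := posnP #|B|; first by rewrite !(mul0r, mulr0, invr0).
have {}A0 : #|A|%:R != 0 :> R by rewrite pnatr_eq0 -lt0n.
have {}B0 : #|B|%:R != 0 :> R by rewrite pnatr_eq0 -lt0n.
by field; rewrite n0' p0' A0 B0.
Qed.

Lemma set_ind01 n (A : {set 'I_n}) u : 0 <= (set_ind A u : R) <= 1.
Proof. by rewrite /set_ind; case: (u \in A); rewrite /= ?lexx ?ler01. Qed.

Lemma set_indT n : set_ind [set: 'I_n] = (fun=> 1 : R).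
Proof. by apply/funext => u; rewrite /set_ind inE. Qed.

Variables (S : set nat) (p : nat -> R) (G : forall n, sgraph n).
Hypothesis p_gt0 : forall n, S n -> 0 < p n.
Hypothesis bounded : bounded_density S p G.

Lemma edge_form_bounded : exists2 D : R, 0 < D &
  \forall n \near within S \oo, edge_form (p n) (G n) (fun=> 1) (fun=> 1) <= D.
Proof.
have [C [n0 bd]] := bounded; exists (`|C| + 1); first by rewrite ltr_wpDl.
near=> n; have Sn : S n by near: n; exact: near_within_mem.
have n_gt0 : (0 < n)%N by near: n; exact: near_within_nat.
have := bd 1 ltr01 n Sn _ [set: _] [set: _]; rewrite cardsT card_ord mul1r lexx.
rewrite density_edge_form ?p_gt0// cardsT card_ord divff ?pnatr_eq0 -?lt0n//.
rewrite mulr1 divr1 set_indT => le.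
apply: le_trans (le _ isT isT) _; last by rewrite lerD2r ler_norm.
by near: n; exact: near_within_nat.
Unshelve. all: by end_near. Qed.

(** Only sets of linear size fall under the bounded density assumption, so a
small set [U] is first enlarged to one of size about [g n].  The number of
edges leaving it is then at most [3 (|C| + 1) g p n^2]. *)
Lemma edge_form_small (eta : R) : 0 < eta -> exists2 g : R, 0 < g &
  \forall n \near within S \oo, forall U : {set 'I_n}, #|U|%:R <= g * n%:R ->
    edge_form (p n) (G n) (set_ind U) (fun=> 1) <= eta.
Proof.
move=> eta0; have [C [n0 bd]] := bounded.
pose C1 := `|C| + 1; have C1_gt0 : 0 < C1 by rewrite ltr_wpDl.
pose g := Num.min (1 / 2) (eta / (3 * C1)).
have g0 : 0 < g by rewrite lt_min !divr_gt0// mulr_gt0.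
have g_half : g <= 1 / 2 by rewrite ge_min lexx.
have g_eta : g * (3 * C1) <= eta.
  by rewrite -ler_pdivlMr ?mulr_gt0// ge_min lexx orbT.
exists g => //; near=> n => U Ug.
have Sn : S n by near: n; exact: near_within_mem.
have n_gt0 : (0 < n)%N by near: n; exact: near_within_nat.
have nR_gt0 : 0 < n%:R :> R by rewrite ltr0n.
have gn1 : 1 <= g * n%:R.
  by rewrite mulrC -ler_pdivrMr//; near: n; exact: near_within_real.
(* The first [t] vertices serve as padding: [U] together with them has at
least [g n] and at most [3 g n] vertices. *)
pose t := (Num.truncn (g * n%:R)).+1.
have t_gt : g * n%:R < t%:R by rewrite truncnS_gt.
have t_le : t%:R <= g * n%:R + 1.
  by rewrite -natr1 lerD2r truncn_le// ltW// mulr_gt0.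
have tn : (t <= n)%N.
  rewrite -(ler_nat R); apply: le_trans t_le _.
  have := ler_wpM2r (ltW nR_gt0) g_half.
  suff : 2 <= n%:R :> R by lra.
  by near: n; exact: near_within_real.
pose U' := U :|: [set v : 'I_n | (v < t)%N].
have U'_ge : g * n%:R <= #|U'|%:R.
  apply: (le_trans (ltW t_gt)); rewrite ler_nat -{1}(card_ord_below tn).
  exact/subset_leq_card/finset.subsetUr.
have U'_le : #|U'|%:R <= 3 * g * n%:R.
  have : #|U'|%:R <= #|U|%:R + t%:R :> R.
    rewrite -natrD ler_nat -[X in (_ + X)%N](card_ord_below tn).
    exact: leq_card_setU.
  lra.
have nT : g * n%:R <= #|[set: 'I_n]|%:R.
  by rewrite cardsT card_ord ler_piMl ?ltW// (le_lt_trans g_half)//; lra.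
have nn0 : (n0 g <= n)%N by near: n; exact: near_within_nat.
have := bd g g0 n Sn nn0 U' [set: _] U'_ge nT.
rewrite density_edge_form ?p_gt0// cardsT card_ord divff ?gt_eqF// mulr1 set_indT.
have U'_gt0 : 0 < #|U'|%:R / n%:R :> R.
  by rewrite divr_gt0// (lt_le_trans _ U'_ge)// mulr_gt0.
rewrite ler_pdivrMr// => le.
apply: (@le_trans _ _ (edge_form (p n) (G n) (set_ind U') (fun=> 1))).
  apply: le_edge_form; first exact: p_gt0.
    move=> u; rewrite /set_ind inE; case: (u \in U) => /=; rewrite ?ler01 ?lexx ?ler0n//.
  by move=> u; rewrite ler01 lexx.
apply: (le_trans le); apply: (@le_trans _ _ (C1 * (#|U'|%:R / n%:R))).
  rewrite ler_wpM2r ?(ltW U'_gt0)// lerD ?ler_norm// (le_trans g_half)//; lra.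
apply: (@le_trans _ _ (C1 * (3 * g))); last by lra.
by rewrite ler_wpM2l ?(ltW C1_gt0)// ler_pdivrMr.
Unshelve. all: by end_near. Qed.

End large_graphs.

Section perturbation.
Local Open Scope set_scope.
Local Open Scope ring_scope.
Context {R : realType}.

Lemma edge_form_norm_le n (p : R) (G : sgraph n) (x y x' y' : 'I_n -> R) :
  0 < p -> (forall u, `|x u| <= x' u) -> (forall u, `|y u| <= y' u) ->
  `|edge_form p G x y| <= edge_form p G x' y'.
Proof.
move=> p0 xx' yy'; rewrite /edge_form normrM ger0_norm ?edge_form_coef_ge0//.
apply: ler_wpM2l; first exact: edge_form_coef_ge0.
apply: le_trans (ler_norm_sum _ _ _) _; apply: ler_sum => u _.
apply: le_trans (ler_norm_sum _ _ _) _; apply: ler_sum => v _.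
by rewrite normrM normr_nat ler_wpM2l// normrM ler_pM.
Qed.

(** Two pairs of weights that agree outside [U] differ by weights supported on
[U], and each argument is changed separately. *)
Lemma edge_form_perturb n (p : R) (G : sgraph n) (U : {set 'I_n})
    (x y x' y' : 'I_n -> R) : 0 < p ->
  (forall u, 0 <= x u <= 1) -> (forall u, 0 <= y u <= 1) ->
  (forall u, 0 <= x' u <= 1) -> (forall u, 0 <= y' u <= 1) ->
  (forall u, u \notin U -> x u = x' u /\ y u = y' u) ->
  `|edge_form p G x y - edge_form p G x' y'|
    <= 2 * edge_form p G (set_ind U) (fun=> 1).
Proof.
move=> p0 x01 y01 x'01 y'01 off.
have -> : edge_form p G x y - edge_form p G x' y' =
    edge_form p G (fun u => x u + -1 * x' u) y +
    edge_form p G x' (fun u => y u + -1 * y' u).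
  by rewrite edge_formDl edge_formDr edge_formZl edge_formZr; ring.
rewrite mulrDl mul1r; apply: le_trans (ler_normD _ _) _; apply: lerD.
  apply: edge_form_norm_le => // u; last first.
    by have /andP[y0 y1] := y01 u; rewrite ger0_norm.
  rewrite /set_ind; case: (boolP (u \in U)) => [_|/off[-> _]] /=; last first.
    by rewrite mulN1r subrr normr0.
  by have := x01 u; have := x'01 u; rewrite ler_norml; lra.
rewrite [leRHS]edge_form_sym; apply: edge_form_norm_le => // u.
  by have /andP[y0 y1] := x'01 u; rewrite ger0_norm.
rewrite /set_ind; case: (boolP (u \in U)) => [_|/off[_ ->]] /=; last first.
  by rewrite mulN1r subrr normr0.
by have := y01 u; have := y'01 u; rewrite ler_norml; lra.
Qed.

End perturbation.

Section large_graph_partitions.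
Local Open Scope set_scope.
Local Open Scope ring_scope.
Context {R : realType}.
Variables (S : set nat) (p : nat -> R) (G : forall n, sgraph n).
Hypothesis p_gt0 : forall n, S n -> 0 < p n.
Hypothesis np_infty : n%:R * p n @[n --> within S \oo] --> +oo.
Hypothesis bounded : bounded_density S p G.

(** The normalization [p |P_i| |P_j|] of a density is [p n^2 / k^2] up to a
factor [1 + O(k / n)], and the number of edges is [O(p n^2)]. *)
Lemma near_density_balanced k (eta : R) : (0 < k)%N -> 0 < eta ->
  \forall n \near within S \oo, forall b : 'I_n -> 'I_k, balanced_label b ->
  forall i j, `|density (p n) (G n) (label_class b i) (label_class b j) -
    k%:R ^+ 2 * edge_form (p n) (G n) (set_ind (label_class b i))
                                      (set_ind (label_class b j))| <= eta.
Proof.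
move=> k0 eta0; have [D D0 Dbd] := edge_form_bounded p_gt0 bounded.
have k0' : 1 <= k%:R :> R by rewrite (ler_nat R 1).
near=> n => b bal i j.
have Sn : S n by near: n; exact: near_within_mem.
have n_gt0 : (0 < n)%N by near: n; exact: near_within_nat.
have nR_gt0 : 0 < n%:R :> R by rewrite ltr0n.
have eD : edge_form (p n) (G n) (fun=> 1) (fun=> 1) <= D by near: n.
rewrite density_edge_form ?p_gt0//.
set e := edge_form _ _ _ _.
have e0 : 0 <= e.
  by apply: edge_form_ge0 => [|u|u]; rewrite ?p_gt0// /set_ind.
have {}eD : e <= D.
  apply: le_trans eD; apply: le_edge_form => [|u|u]; rewrite ?p_gt0//.
    exact: set_ind01.
  exact: set_ind01.
have := balanced_label_card (R := R) i n_gt0 bal.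
have := balanced_label_card (R := R) j n_gt0 bal.
set a := _ / n%:R; set c := #|label_class b i|%:R / _ => aj ai.
pose h : R := n%:R^-1; rewrite -/h in aj ai.
have h0 : 0 < h by rewrite invr_gt0.
have kh : k%:R * h <= 1 / 2.
  rewrite ler_pdivrMr// mul1r -ler_pdivrMl// mulrC; near: n.
  exact: near_within_real.
have hE : 12 * k%:R ^+ 3 * D * h <= eta.
  rewrite ler_pdivrMr// -ler_pdivrMl//; near: n; exact: near_within_real.
pose a1 := k%:R * a; pose c1 := k%:R * c.
have near1 z : `|z - k%:R^-1| <= h -> `|k%:R * z - 1| <= k%:R * h.
  move=> zh; have -> : k%:R * z - 1 = k%:R * (z - k%:R^-1).
    by rewrite mulrBr divff// gt_eqF// (lt_le_trans ltr01).
  by rewrite normrM ger0_norm// ler_wpM2l.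
have {}ai : `|c1 - 1| <= k%:R * h by exact: near1.
have {}aj : `|a1 - 1| <= k%:R * h by exact: near1.
have kn0 : k%:R != 0 :> R by rewrite pnatr_eq0 -lt0n.
move: ai aj; rewrite 2!ler_norml => /andP[c1l c1u] /andP[a1l a1u].
have c1_gt : 1 / 2 <= c1 by lra.
have a1_gt : 1 / 2 <= a1 by lra.
have an0 : a != 0 by apply: contraTneq a1_gt => a0; rewrite /a1 a0; lra.
have cn0 : c != 0 by apply: contraTneq c1_gt => a0; rewrite /c1 a0; lra.
have ac : 1 / 4 <= c1 * a1 by nra.
have -> : e / (c * a) - k%:R ^+ 2 * e = k%:R ^+ 2 * e * ((1 - c1 * a1) / (c1 * a1)).
  by rewrite /c1 /a1; field; rewrite kn0 an0 cn0.
have ke0 : 0 <= k%:R ^+ 2 * e by apply: mulr_ge0 => //; exact: exprn_ge0.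
rewrite normrM [X in X * _]ger0_norm//.
rewrite normrM normfV [X in _ / X]ger0_norm; last by lra.
have d3 : `|1 - c1 * a1| <= 3 * k%:R * h by rewrite ler_norml; apply/andP; split; nra.
apply: le_trans hE.
have -> : 12 * k%:R ^+ 3 * D * h = k%:R ^+ 2 * D * (12 * k%:R * h) by ring.
have ca0 : 0 < c1 * a1 by lra.
apply: ler_pM.
- by [].
- by rewrite divr_ge0// ltW.
- by rewrite ler_wpM2l ?exprn_ge0.
rewrite ler_pdivrMr; last by lra.
by apply: (le_trans d3); nra.
Unshelve. all: by end_near. Qed.

(** The rounded partition has parts of size [n / k + o(n)].  Sorting it and
cutting the sorted order into equal blocks makes it exactly balanced; this
moves only the few vertices in [off_boundary], which carry few edges. *)
Lemma near_rounding_balanced k (eta : R) : (0 < k)%N -> 0 < eta ->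
  \forall n \near within S \oo, forall x : 'I_n -> 'I_k -> R, fractional x ->
  (forall i, \sum_u x u i = n%:R / k%:R) ->
  exists2 b : 'I_n -> 'I_k, balanced_label b & forall i j,
  `|edge_form (p n) (G n) (set_ind (label_class b i)) (set_ind (label_class b j))
    - edge_form (p n) (G n) (x^~ i) (x^~ j)| <= eta.
Proof.
move=> k0 eta0; have [D D0 Dbd] := edge_form_bounded p_gt0 bounded.
have [g g0 small] := edge_form_small p_gt0 bounded (divr_gt0 eta0 (ltr0n R 4)).
have k1 : 1 <= k%:R :> R by rewrite (ler_nat R 1).
have k_gt0 : 0 < k%:R :> R by exact: lt_le_trans k1.
pose c := 4 * k%:R * (k%:R + 1) : R.
have c0 : 0 < c by rewrite /c !mulr_gt0 ?ltr_wpDl.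
pose rho := Num.min (eta / 2) (g / c).
have rho0 : 0 < rho by rewrite lt_min !divr_gt0.
have rho_eta : rho <= eta / 2 by rewrite ge_min lexx.
have rho_g : c * rho <= g by rewrite mulrC -ler_pdivlMr// ge_min lexx orbT.
pose kk : R := (k ^ 2 + k)%:R.
have kk0 : 0 < kk by rewrite ltr0n addn_gt0 k0 orbT.
near=> n => x fx xsum.
have Sn : S n by near: n; exact: near_within_mem.
have kn : (k <= n)%N by near: n; exact: near_within_nat.
have n_gt0 : (0 < n)%N by exact: leq_trans kn.
have nR_gt0 : 0 < n%:R :> R by rewrite ltr0n.
have pn0 := p_gt0 Sn.
have eD : edge_form (p n) (G n) (fun=> 1) (fun=> 1) <= D by near: n.
have e0 : 0 <= edge_form (p n) (G n) (fun=> 1) (fun=> 1) by exact: edge_form_ge0.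
have [b0 /=] := graph_rounding (G n) pn0 n_gt0 fx; rewrite -/kk.
set E := kk * _ => -[b0e b0m].
have Erho : E <= rho ^+ 2.
  rewrite /E -ler_pdivlMl// [leRHS]mulrC; set t := rho ^+ 2 / kk.
  have t0 : 0 < t by rewrite divr_gt0 ?exprn_gt0.
  have t2_gt0 : 0 < t / 2 by rewrite divr_gt0.
  have : 8 * edge_form (p n) (G n) (fun=> 1) (fun=> 1) / (p n * n%:R) <= t / 2.
    rewrite ler_pdivrMr ?mulr_gt0// -ler_pdivrMl//.
    apply: (@le_trans _ _ ((t / 2)^-1 * (8 * D))).
      apply: ler_wpM2l; first by rewrite invr_ge0 divr_ge0// ltW.
      exact: ler_wpM2l.
    by rewrite [p n * _]mulrC; near: n; move/cvgryPge: np_infty; apply.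
  have : 2 / n%:R <= t / 2.
    rewrite ler_pdivrMr// -ler_pdivrMl//.
    by near: n; exact: near_within_real.
  lra.
have sq_le (z : R) : z ^+ 2 <= E -> `|z| <= rho.
  move=> zE; rewrite -(@ler_pXn2r _ 2)// ?nnegrE ?(ltW rho0)//.
  by rewrite real_normK ?num_real// (le_trans zE).
(* Class sizes are off by at most [rho * n <= H / k]. *)
pose H := (Num.truncn (k%:R * rho * n%:R)).+1.
have H_ge : k%:R * rho * n%:R <= H%:R by rewrite ltW// truncnS_gt.
have H_le : H%:R <= k%:R * rho * n%:R + 1.
  by rewrite -natr1 lerD2r truncn_le// !mulr_ge0 ?ltW.
have [s [sI sb]] := sorting_perm b0.
have near_class i :
    `|#|label_class b0 i|%:R - n%:R / k%:R| <= H%:R / k%:R :> R.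
  have := sq_le _ (b0m i); rewrite xsum mulrAC divff ?gt_eqF// mul1r => le.
  rewrite ler_pdivlMr//; apply: le_trans H_ge.
  rewrite -mulrA [leRHS]mulrC ler_wpM2r ?(ltW k_gt0)//.
  rewrite -ler_pdivrMr// -[n%:R^-1]gtr0_norm ?invr_gt0// -normrM mulrBl.
  by rewrite [n%:R / _ / _]mulrAC divff ?gt_eqF// mul1r.
pose U := off_boundary b0 s.
have U_le : #|U|%:R <= g * n%:R.
  have : (#|U| <= k.+1 * (2 * H).+1)%N.
    by apply: card_off_boundary => // l lk; have [] := class_start_near near_class k0 lk.
  rewrite -(ler_nat R) natrM -[k.+1%:R]natr1 -[(2 * H).+1%:R]natr1 natrM => le.
  apply: (le_trans le).
  have n_big : 6 * (k%:R + 1) <= g * n%:R.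
    by rewrite -ler_pdivrMl//; near: n; exact: near_within_real.
  have : c * rho * n%:R <= g * n%:R by rewrite ler_wpM2r// ltW.
  have : (k%:R + 1) * (2 * H%:R + 1) <=
      (k%:R + 1) * (2 * (k%:R * rho * n%:R + 1) + 1) :> R.
    by rewrite ler_wpM2l ?addr_ge0//; lra.
  have -> : c * rho * n%:R = 4 * (k%:R + 1) * (k%:R * rho * n%:R) by rewrite /c; ring.
  by move=> h1 h2; apply: (le_trans h1); lra.
pose b v := Ordinal (block_lt (s v) k0).
exists b; first exact: block_label_balanced.
have bU v : v \notin U -> b v = b0 v.
  rewrite inE negbK => /andP[h1 h2]; apply: val_inj => /=.
  apply/eqP; rewrite eqn_leq leq_divRL// h1 andbT -ltnS ltn_divLR//.
  by apply: leq_trans h2; rewrite ltn_pmul2r.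
move=> i j; have indU l u : u \notin U -> set_ind (label_class b l) u =
    set_ind (label_class b0 l) u :> R by move=> uU; rewrite /set_ind !inE bU.
have := @edge_form_perturb R n (p n) (G n) U
  (set_ind (label_class b i)) (set_ind (label_class b j))
  (set_ind (label_class b0 i)) (set_ind (label_class b0 j)) pn0
  (set_ind01 _) (set_ind01 _) (set_ind01 _) (set_ind01 _)
  (fun u uU => conj (indU i u uU) (indU j u uU)).
have smallU : edge_form (p n) (G n) (set_ind U) (fun=> 1) <= eta / 4.
  by move: U U_le {bU indU}; near: n.
have := sq_le _ (b0e i j).
by rewrite !ler_norml => /andP[? ?] /andP[? ?]; apply/andP; split; lra.
Unshelve. all: by end_near. Qed.

End large_graph_partitions.

(** * Integrals of bounded kernels over rectangles *)

Section rect_integral.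
Context {R : realType}.
Local Notation mu := (@lebesgue_measure R).
Local Notation mu2 := (mu \x mu)%E.
Local Notation I01 := (`[0, 1]%classic : set R).
Implicit Types (h : R * R -> R) (A B : set R).

Lemma measurable_I01 : measurable I01.
Proof. exact: measurable_itv. Qed.

Lemma mu_I01 : mu I01 = 1%E.
Proof. by rewrite lebesgue_measure_itv/= lte_fin ltr01 oppr0 addr0. Qed.

Definition mass A : R := fine (mu A).

Definition unit_sub A := measurable A /\ A `<=` I01.

Lemma unit_sub_I01 : unit_sub I01.
Proof. by split => //; exact: measurable_I01. Qed.

Lemma unit_sub_setIl A B : unit_sub A -> measurable B -> unit_sub (A `&` B).
Proof. by move=> [mA AI] mB; split; [exact: measurableI|move=> x [/AI]]. Qed.

Lemma mu_unit_sub_le1 A : unit_sub A -> (mu A <= 1)%E.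
Proof.
by move=> [mA AI]; rewrite -mu_I01 le_measure// ?inE//; exact: measurable_I01.
Qed.

Lemma mass_fin A : unit_sub A -> mu A = (mass A)%:E.
Proof.
move=> uA; rewrite fineK// ge0_fin_numE//.
by rewrite (le_lt_trans (mu_unit_sub_le1 uA))// ltry.
Qed.

Lemma mass_ge0 A : 0 <= mass A.
Proof. exact: fine_ge0. Qed.

Lemma mass0 : mass set0 = 0.
Proof. by rewrite /mass measure0. Qed.

Lemma le_mass A B : unit_sub A -> unit_sub B -> A `<=` B -> mass A <= mass B.
Proof.
move=> uA uB AB; rewrite -lee_fin -!mass_fin// le_measure// inE.
  by case: uA.
by case: uB.
Qed.

Lemma mass_I01 : mass I01 = 1.
Proof. by rewrite /mass mu_I01. Qed.

(** Finite additivity, for the sets on which a function with values in [nat]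
is constant. *)
Lemma mass_additive A (alpha : R -> nat) N : unit_sub A ->
  (forall a, measurable (I01 `&` alpha @^-1` [set a])) ->
  (forall x, A x -> (alpha x < N)%N) ->
  mass A = \sum_(a < N) mass (A `&` alpha @^-1` [set val a]).
Proof.
move=> uA malpha alphaN; have [mA AI] := uA.
have cutE a : A `&` alpha @^-1` [set a] =
    A `&` (I01 `&` alpha @^-1` [set a]).
  by rewrite setIA; congr (_ `&` _); rewrite setIidl.
have uAa a : unit_sub (A `&` alpha @^-1` [set a]).
  by rewrite cutE; exact: unit_sub_setIl.
apply: EFin_inj; rewrite -mass_fin// -sumEFin.
under eq_bigr do rewrite -mass_fin//.
rewrite -(measure_bigsetU mu (F := fun a => A `&` alpha @^-1` [set a])).
- congr (mu _); rewrite -(bigcup_mkord N (fun a => A `&` alpha @^-1` [set a])).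
  apply/seteqP; split=> [x Ax|x [a _ []]//].
  by exists (alpha x) => //=; exact: alphaN.
- by move=> a; case: (uAa a).
- by move=> i j _ _ [x [[_ <-] [_ <-]]].
Qed.

Definition bounded_meas h :=
  measurable_fun (I01 `*` I01) h /\
  exists B : R, forall z, (I01 `*` I01) z -> `|h z| <= B.

Definition rect_integral h A B : R := \int[mu2]_(z in A `*` B) h z.

Definition l1_norm h : R := rect_integral (fun z => `|h z|) I01 I01.

Lemma measurable_rect A B : unit_sub A -> unit_sub B -> measurable (A `*` B).
Proof. by move=> [mA _] [mB _]; exact: measurableX. Qed.

Lemma rect_sub A B : unit_sub A -> unit_sub B -> A `*` B `<=` I01 `*` I01.
Proof. by move=> [_ AI] [_ BI] [x y] [/AI ? /BI]. Qed.

Lemma mu2_rect A B : unit_sub A -> unit_sub B ->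
  mu2 (A `*` B) = (mass A * mass B)%:E.
Proof.
move=> uA uB; have [[mA _] [mB _]] := (uA, uB).
by rewrite product_measure1E// EFinM -!mass_fin.
Qed.

Lemma bounded_meas_integrable h A B : unit_sub A -> unit_sub B ->
  bounded_meas h -> mu2.-integrable (A `*` B) (EFin \o h).
Proof.
move=> uA uB [mh [M hM]]; have uI := unit_sub_I01.
have mII := measurable_rect uI uI; have mAB := measurable_rect uA uB.
apply: (integrableS (mu := mu2) (E := I01 `*` I01)) => //.
  exact: rect_sub.
apply: (measurable_bounded_integrable (mu := mu2)) => //.
  have le1 : (mu2 (I01 `*` I01) <= (mass I01 * mass I01)%:E)%E by rewrite mu2_rect.
  exact: (le_lt_trans le1 (ltry _)).
exists M; split; first exact: num_real.
by move=> r Mr z zI; exact: (le_trans (hM z zI) (ltW Mr)).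
Qed.

Lemma bounded_measD h g : bounded_meas h -> bounded_meas g ->
  bounded_meas (fun z => h z + g z).
Proof.
move=> [mh [M hM]] [mg [N gN]]; split; first exact: measurable_funD.
by exists (M + N) => z zI; rewrite (le_trans (ler_normD _ _))// lerD ?hM ?gN.
Qed.

Lemma bounded_measN h : bounded_meas h -> bounded_meas (fun z => - h z).
Proof.
move=> [mh [M hM]]; split; first exact: measurable_funN.
by exists M => z zI; rewrite normrN hM.
Qed.

Lemma bounded_measB h g : bounded_meas h -> bounded_meas g ->
  bounded_meas (fun z => h z - g z).
Proof. by move=> bh bg; exact: bounded_measD bh (bounded_measN bg). Qed.

Lemma bounded_meas_norm h : bounded_meas h -> bounded_meas (fun z => `|h z|).
Proof.
move=> [mh [M hM]]; split; first exact: measurableT_comp.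
by exists M => z zI; rewrite normr_id hM.
Qed.

Lemma bounded_meas_cst c : bounded_meas (fun=> c).
Proof. by split; [exact: measurable_cst|exists `|c|]. Qed.

Lemma bounded_measZ c h : bounded_meas h -> bounded_meas (fun z => c * h z).
Proof.
move=> [mh [M hM]]; split; first exact: measurable_funM.
by exists (`|c| * M) => z zI; rewrite normrM ler_wpM2l// hM.
Qed.

Lemma bounded_meas_sum (J : Type) (r : seq J) (f : J -> R * R -> R) :
  (forall i, bounded_meas (f i)) -> bounded_meas (fun z => \sum_(i <- r) f i z).
Proof.
move=> bf; elim: r => [|i r IH].
  by under eq_fun do rewrite big_nil; exact: bounded_meas_cst.
by under eq_fun do rewrite big_cons; exact: bounded_measD.
Qed.

Lemma eq_bounded_meas h g : (forall z, (I01 `*` I01) z -> h z = g z) ->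
  bounded_meas h -> bounded_meas g.
Proof.
move=> hg [mh [M hM]]; split.
  by apply: eq_measurable_fun mh => z /[!inE]; exact: hg.
by exists M => z zI; rewrite -hg// hM.
Qed.

Lemma bounded_meas_indic E : measurable E -> bounded_meas (\1_E).
Proof.
move=> mE; split; first exact: measurable_indic.
by exists 1 => z _; rewrite indicE ger0_norm ?lern1 ?leq_b1.
Qed.

Lemma eq_rect_integral h g A B :
  (forall z, (A `*` B) z -> h z = g z) ->
  rect_integral h A B = rect_integral g A B.
Proof. by move=> hg; apply: eq_Rintegral => z /[!inE]; exact: hg. Qed.

Lemma rect_integralD h g A B : unit_sub A -> unit_sub B ->
  bounded_meas h -> bounded_meas g ->
  rect_integral (fun z => h z + g z) A B = rect_integral h A B + rect_integral g A B.
Proof.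
move=> uA uB bh bg; apply: RintegralD; first exact: measurable_rect.
  exact: bounded_meas_integrable.
exact: bounded_meas_integrable.
Qed.

Lemma rect_integralB h g A B : unit_sub A -> unit_sub B ->
  bounded_meas h -> bounded_meas g ->
  rect_integral (fun z => h z - g z) A B = rect_integral h A B - rect_integral g A B.
Proof.
move=> uA uB bh bg; apply: RintegralB; first exact: measurable_rect.
  exact: bounded_meas_integrable.
exact: bounded_meas_integrable.
Qed.

Lemma rect_integralZ c h A B : unit_sub A -> unit_sub B -> bounded_meas h ->
  rect_integral (fun z => c * h z) A B = c * rect_integral h A B.
Proof.
move=> uA uB bh; apply: RintegralZl; first exact: measurable_rect.
exact: bounded_meas_integrable.
Qed.

Lemma rect_integral_sum (J : Type) (r : seq J) (f : J -> R * R -> R) A B :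
  unit_sub A -> unit_sub B -> (forall i, bounded_meas (f i)) ->
  rect_integral (fun z => \sum_(i <- r) f i z) A B =
  \sum_(i <- r) rect_integral (f i) A B.
Proof.
move=> uA uB bf; elim: r => [|i r IH].
  rewrite big_nil -[RHS](mul0r (rect_integral (fun=> 0) A B)).
  rewrite -rect_integralZ//; last exact: bounded_meas_cst.
  by apply: eq_rect_integral => z _; rewrite big_nil mul0r.
rewrite big_cons -IH -rect_integralD//; last exact: bounded_meas_sum.
by apply: eq_rect_integral => z _; rewrite big_cons.
Qed.

Lemma le_rect_integral h g A B : unit_sub A -> unit_sub B ->
  bounded_meas h -> bounded_meas g ->
  (forall z, (A `*` B) z -> h z <= g z) ->
  rect_integral h A B <= rect_integral g A B.
Proof.
move=> uA uB bh bg hg; apply: le_Rintegral => //.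
- exact: measurable_rect.
- exact: bounded_meas_integrable.
- exact: bounded_meas_integrable.
Qed.

Lemma rect_integral_cst c A B : unit_sub A -> unit_sub B ->
  rect_integral (fun=> c) A B = c * (mass A * mass B).
Proof.
move=> uA uB; rewrite /rect_integral Rintegral_cst; last exact: measurable_rect.
congr (_ * _); exact: (congr1 fine (mu2_rect uA uB)).
Qed.

Lemma rect_integral_indic E A B : unit_sub A -> unit_sub B -> measurable E ->
  rect_integral (\1_E) A B = fine (mu2 (E `&` (A `*` B))).
Proof.
move=> uA uB mE; rewrite /rect_integral /Rintegral integral_indic//.
exact: measurable_rect.
Qed.

Lemma rect_integral_norm_le h A B : unit_sub A -> unit_sub B -> bounded_meas h ->
  `|rect_integral h A B| <= rect_integral (fun z => `|h z|) A B.
Proof.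
move=> uA uB bh; apply: le_normr_Rintegral; first exact: measurable_rect.
exact: bounded_meas_integrable.
Qed.

Lemma rect_integral_sub h A B A' B' :
  unit_sub A -> unit_sub B -> unit_sub A' -> unit_sub B' ->
  A `<=` A' -> B `<=` B' -> bounded_meas h -> (forall z, 0 <= h z) ->
  rect_integral h A B <= rect_integral h A' B'.
Proof.
move=> uA uB uA' uB' AA' BB' bh h0; rewrite /rect_integral /Rintegral.
have mAB := measurable_rect uA uB; have mAB' := measurable_rect uA' uB'.
apply: fine_le.
- exact/integrable_fin_num/bounded_meas_integrable.
- exact/integrable_fin_num/bounded_meas_integrable.
- apply: ge0_subset_integral => //.
  + by have /integrableP[] := bounded_meas_integrable uA' uB' bh.
  + by move=> z _; rewrite lee_fin.
  + by move=> [x y] [/AA' ? /BB'].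
Qed.

Lemma rect_integral_le_l1 h A B : unit_sub A -> unit_sub B -> bounded_meas h ->
  `|rect_integral h A B| <= l1_norm h.
Proof.
move=> uA uB bh; apply: le_trans (rect_integral_norm_le uA uB bh) _.
have [[_ AI] [_ BI]] := (uA, uB).
apply: rect_integral_sub => //; try exact: unit_sub_I01.
exact: bounded_meas_norm.
Qed.

Lemma l1_norm_triangle h g k : bounded_meas h -> bounded_meas g -> bounded_meas k ->
  l1_norm (fun z => h z - k z) <=
  l1_norm (fun z => h z - g z) + l1_norm (fun z => g z - k z).
Proof.
move=> bh bg bk; have uI := unit_sub_I01.
have hg := bounded_meas_norm (bounded_measB bh bg).
have gk := bounded_meas_norm (bounded_measB bg bk).
have hk := bounded_meas_norm (bounded_measB bh bk).
rewrite /l1_norm -rect_integralD//; apply: le_rect_integral => //.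
  exact: bounded_measD.
by move=> z _; exact: ler_distD.
Qed.

Lemma cut_norm_le h (e : R) : bounded_meas h ->
  (forall A B, unit_sub A -> unit_sub B -> `|rect_integral h A B| <= e) ->
  (cut_norm h <= e%:E)%E.
Proof.
move=> bh he; apply: ge_ereal_sup => _ [A [B [mA mB AI BI ->]]].
rewrite -EFin_normr_Rintegral ?lee_fin; first exact: he.
  exact: measurableX.
exact: bounded_meas_integrable.
Qed.

Lemma rect_integral_le_cut_norm h A B : bounded_meas h ->
  unit_sub A -> unit_sub B -> (`|rect_integral h A B|%:E <= cut_norm h)%E.
Proof.
move=> bh uA uB; have [[mA AI] [mB BI]] := (uA, uB).
apply: ereal_sup_ubound; exists A, B; split => //.
rewrite -EFin_normr_Rintegral//; first exact: measurableX.
exact: bounded_meas_integrable.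
Qed.

End rect_integral.

Section step_functions.
Context {R : realType}.
Local Notation I01 := (`[0, 1]%classic : set R).
Variables (alpha : R -> nat) (N : nat) (g : nat -> nat -> R).
Hypothesis malpha : forall a, measurable (I01 `&` alpha @^-1` [set a]).
Hypothesis alphaN : forall x, I01 x -> (alpha x < N)%N.

Definition step_fun : R * R -> R := fun z => g (alpha z.1) (alpha z.2).

Let cell a : set R := I01 `&` alpha @^-1` [set a].

Let step_funE z : (I01 `*` I01) z -> step_fun z =
  \sum_(ab : 'I_N * 'I_N) g ab.1 ab.2 * \1_(cell ab.1 `*` cell ab.2) z.
Proof.
case: z => x y [/= Ix Iy].
rewrite (bigD1 (Ordinal (alphaN Ix), Ordinal (alphaN Iy)))//= big1 ?addr0.
  by rewrite indicE mem_set ?mulr1.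
move=> [a b] /= ab; rewrite indicE memNset ?mulr0// => -[[_ /= xa] [_ /= yb]].
by move/eqP: ab; apply; congr (_, _); apply: val_inj.
Qed.

Let mcell a b : measurable (cell a `*` cell b).
Proof. by apply: measurableX; exact: malpha. Qed.

Lemma bounded_meas_step : bounded_meas step_fun.
Proof.
apply: eq_bounded_meas (fun z zI => esym (step_funE zI)) _.
by apply: bounded_meas_sum => ab; apply: bounded_measZ; apply: bounded_meas_indic; exact: mcell.
Qed.

Lemma rect_integral_step A B : unit_sub A -> unit_sub B ->
  rect_integral step_fun A B = \sum_(a < N) \sum_(b < N)
    g a b * (mass (A `&` alpha @^-1` [set val a]) *
             mass (B `&` alpha @^-1` [set val b])).
Proof.
move=> uA uB; rewrite pair_bigA /=.
rewrite (@eq_rect_integral _ _ _ _ _ (fun z zAB => step_funE (rect_sub uA uB zAB))).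
rewrite rect_integral_sum//; last first.
  by move=> ab; apply: bounded_measZ; apply: bounded_meas_indic; exact: mcell.
apply: eq_bigr => -[a b] _ /=; rewrite rect_integralZ//; last first.
  apply: bounded_meas_indic; exact: mcell.
congr (_ * _); rewrite rect_integral_indic//.
have cutE C c : unit_sub C -> C `&` alpha @^-1` [set c] = C `&` cell c.
  by move=> [_ CI]; rewrite setIA; congr (_ `&` _); rewrite setIidl.
have -> : (cell a `*` cell b) `&` (A `*` B) = (A `&` cell a) `*` (B `&` cell b).
  by apply/seteqP; split=> -[x y] [[? ?] [? ?]].
by rewrite !cutE// mu2_rect//; apply: unit_sub_setIl => //; exact: malpha.
Qed.

End step_functions.

(** * Labellings of the unit interval and grids *)

Section unit_labels.
Context {R : realType}.
Local Notation I01 := (`[0, 1]%classic : set R).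
Implicit Types (h : R * R -> R) (alpha : R -> nat).

(** A measurable partition of [[0, 1]] into [N] sets, possibly empty, encoded
by the index of the part of a point. *)
Definition unit_label alpha N :=
  (forall a, measurable (I01 `&` alpha @^-1` [set a])) /\
  (forall x, I01 x -> (alpha x < N)%N).

Definition part alpha a : set R := I01 `&` alpha @^-1` [set a].

Lemma unit_sub_part alpha N a : unit_label alpha N -> unit_sub (part alpha a).
Proof. by move=> [malpha _]; split; [exact: malpha|move=> x []]. Qed.

Lemma rect_integral_restrict h A B : unit_sub A -> unit_sub B ->
  rect_integral h A B =
  rect_integral (fun z => h z * \1_(A `*` B) z) I01 I01.
Proof.
move=> uA uB; rewrite /rect_integral.
rewrite -[in LHS](@setIidr _ (I01 `*` I01) (A `*` B)); last exact: rect_sub.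
rewrite Rintegral_mkcondr; apply: eq_Rintegral => z _.
rewrite /patch indicE; case: (z \in _); first by rewrite mulr1.
by rewrite mulr0.
Qed.

Lemma bounded_meas_restrict h E : measurable E -> bounded_meas h ->
  bounded_meas (fun z => h z * \1_E z).
Proof.
move=> mE [mh [M hM]]; split.
  by apply: measurable_funM => //; exact: measurable_indic.
exists M => z zI; rewrite normrM indicE; case: (z \in E).
  by rewrite normr1 mulr1 hM.
by rewrite normr0 mulr0 (le_trans _ (hM z zI)).
Qed.

Lemma sum_indic_parts alpha N z : unit_label alpha N -> (I01 `*` I01) z ->
  \sum_(ab : 'I_N * 'I_N)
     \1_(part alpha ab.1 `*` part alpha ab.2) z = 1 :> R.
Proof.
case: z => x y [malpha alphaN] [/= Ix Iy].
rewrite (bigD1 (Ordinal (alphaN _ Ix), Ordinal (alphaN _ Iy)))//= big1 ?addr0.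
  by rewrite indicE mem_set.
move=> [a b] /= ab; rewrite indicE memNset// => -[[_ /= xa] [_ /= yb]].
by move/eqP: ab; apply; congr (_, _); apply: val_inj.
Qed.

Lemma rect_integral_parts alpha N h : unit_label alpha N -> bounded_meas h ->
  rect_integral h I01 I01 =
  \sum_(a < N) \sum_(b < N) rect_integral h (part alpha a) (part alpha b).
Proof.
move=> ul bh; rewrite pair_bigA /=.
have uI := @unit_sub_I01 R; have up a := unit_sub_part a ul.
pose f (ab : 'I_N * 'I_N) z := h z * \1_(part alpha ab.1 `*` part alpha ab.2) z.
transitivity (rect_integral (fun z => \sum_(ab : 'I_N * 'I_N) f ab z) I01 I01).
  apply: eq_rect_integral => z zI.
  by rewrite -mulr_sumr (sum_indic_parts ul) ?mulr1.
rewrite rect_integral_sum//; last first.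
  by move=> ab; apply: bounded_meas_restrict => //; exact: measurable_rect.
by apply: eq_bigr => ab _; rewrite [RHS]rect_integral_restrict.
Qed.

Lemma sum_rect_integral_le_l1 alpha N h : unit_label alpha N -> bounded_meas h ->
  \sum_(a < N) \sum_(b < N) `|rect_integral h (part alpha a) (part alpha b)|
    <= l1_norm h.
Proof.
move=> ul bh; rewrite /l1_norm (rect_integral_parts ul (bounded_meas_norm bh)).
apply: ler_sum => a _; apply: ler_sum => b _.
by apply: rect_integral_norm_le => //; exact: unit_sub_part ul.
Qed.

Lemma rect_integral_step_label alpha N (g : nat -> nat -> R) A B :
  unit_label alpha N -> unit_sub A -> unit_sub B ->
  rect_integral (step_fun alpha g) A B = \sum_(a < N) \sum_(b < N)
    g a b * (mass (A `&` alpha @^-1` [set val a]) *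
             mass (B `&` alpha @^-1` [set val b])).
Proof. by move=> [malpha alphaN]; exact: rect_integral_step. Qed.

Lemma bounded_meas_step_label alpha N (g : nat -> nat -> R) :
  unit_label alpha N -> bounded_meas (step_fun alpha g).
Proof. by move=> [malpha alphaN]; exact: (@bounded_meas_step _ alpha N). Qed.

Lemma mass_parts alpha N A : unit_label alpha N -> unit_sub A ->
  mass A = \sum_(a < N) mass (A `&` alpha @^-1` [set val a]).
Proof.
move=> [malpha alphaN] uA; apply: mass_additive => // x Ax.
by apply: alphaN; case: uA => _; apply.
Qed.

End unit_labels.

Section threshold_labels.
Context {R : realType}.
Variables (theta : nat -> R) (N : nat).
Hypothesis theta_homo : forall i j, (i <= j)%N -> theta i <= theta j.

(** The number of interior thresholds below [x]: the index of the half-open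
interval, closed on the right, that contains [x]. *)
Definition threshold_label (x : R) : nat := (\sum_(1 <= a < N) (theta a < x)%R)%N.

Lemma le_threshold_label x a : (0 < a < N)%N ->
  (a <= threshold_label x)%N = (theta a < x).
Proof.
move=> /andP[a0 aN].
have cst1 (s t : nat) (v : nat) : (\sum_(s <= i < t) v = (t - s) * v)%N.
  by rewrite big_const_nat iter_addn_0 mulnC.
apply/idP/idP => [|ax].
  apply: contraTT; rewrite -leNgt -ltnNge => xa.
  rewrite /threshold_label (@big_cat_nat _ _ _ a)//= ?(ltnW aN)//.
  rewrite [X in (_ + X)%N]big_nat_cond [X in (_ + X)%N]big1 ?addn0; last first.
    move=> i; rewrite andbT => /andP[ai _].
    by rewrite ltNge (le_trans xa (theta_homo ai)).
  apply: (@leq_ltn_trans (\sum_(1 <= i < a) 1)%N).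
    by apply: leq_sum => i _; exact: leq_b1.
  by rewrite cst1 muln1; lia.
rewrite /threshold_label (@big_cat_nat _ _ _ a.+1)//= (leq_trans _ (leq_addr _ _))//.
apply: (@leq_trans (\sum_(1 <= i < a.+1) 1)%N); first by rewrite cst1; lia.
rewrite !big_nat; apply: leq_sum => i /andP[_ ia].
by rewrite (le_lt_trans (@theta_homo i a ia) ax).
Qed.

Lemma threshold_label_lt x : (0 < N)%N -> (threshold_label x < N)%N.
Proof.
move=> N0; apply: (@leq_ltn_trans (\sum_(1 <= i < N) 1)%N).
  by apply: leq_sum => i _; exact: leq_b1.
by rewrite big_const_nat iter_addn_0 mul1n; lia.
Qed.

Lemma measurable_threshold_label (f : R -> R) a : measurable_fun [set: R] f ->
  measurable ((fun x => threshold_label (f x)) @^-1` [set a]).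
Proof.
move=> mf.
have mle b : measurable [set x | (b <= threshold_label (f x))%N].
  have [->|b0] := posnP b.
    by rewrite (_ : [set x | _] = setT)//; apply/seteqP; split.
  have [bN|Nb] := ltnP b N.
    rewrite (_ : [set x | _] = f @^-1` [set` `]theta b, +oo[]); last first.
      apply/seteqP; split=> x /=; rewrite in_itv/= andbT.
        by rewrite le_threshold_label ?b0.
      by rewrite le_threshold_label ?b0.
    by rewrite -[X in measurable X]setTI; apply: mf => //; exact: measurable_itv.
  rewrite (_ : [set x | _] = set0)//; apply/seteqP; split=> x //= bx.
  have [N0|N0] := posnP N.
    by move: bx; rewrite /threshold_label N0 big_geq// leqNgt b0.
  by have := leq_trans Nb bx; rewrite leqNgt threshold_label_lt.
rewrite (_ : _ @^-1` _ = [set x | (a <= threshold_label (f x))%N] `\`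
                        [set x | (a.+1 <= threshold_label (f x))%N]).
  exact: measurableD.
apply/seteqP; split=> x /=; first by move=> ->; split => //; rewrite ltnn.
by move=> [h1 /negP h2]; apply/eqP; rewrite eqn_leq h1 andbT leqNgt.
Qed.

End threshold_labels.

Section grid.
Context {R : realType}.
Local Notation I01 := (`[0, 1]%classic : set R).

Definition grid_cell (N : nat) : R -> nat :=
  threshold_label (fun a => a%:R / N%:R) N.

Lemma grid_threshold_homo N i j : (i <= j)%N -> i%:R / N%:R <= j%:R / N%:R :> R.
Proof. by move=> ij; rewrite ler_wpM2r ?invr_ge0// ler_nat. Qed.

Lemma le_grid_cell N x a : (0 < a < N)%N ->
  (a <= grid_cell N x)%N = (a%:R / N%:R < x).
Proof. by move=> aN; apply: le_threshold_label aN => i j; exact: grid_threshold_homo. Qed.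

Lemma grid_cell_lt N x : (0 < N)%N -> (grid_cell N x < N)%N.
Proof. exact: threshold_label_lt. Qed.

Lemma grid_cell_bounds N x : (0 < N)%N -> I01 x ->
  (grid_cell N x)%:R / N%:R <= x <= (grid_cell N x).+1%:R / N%:R.
Proof.
move=> N0; rewrite /= in_itv/= => /andP[x0 x1].
have N0' : 0 < N%:R :> R by rewrite ltr0n.
apply/andP; split.
  have [->|c0] := posnP (grid_cell N x); first by rewrite mul0r.
  by rewrite ltW// -le_grid_cell// c0 grid_cell_lt.
have := grid_cell_lt x N0; rewrite leq_eqVlt => /orP[/eqP ->|lt].
  by rewrite divff ?gt_eqF.
by rewrite leNgt -le_grid_cell ?lt// -ltnNge.
Qed.

Lemma grid_cell_unique N x a : (a < N)%N -> a%:R / N%:R < x <= a.+1%:R / N%:R ->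
  grid_cell N x = a.
Proof.
move=> aN /andP[ax xa]; apply/eqP; rewrite eqn_leq; apply/andP; split.
  have := aN; rewrite leq_eqVlt => /orP[/eqP <-|aN'].
    by rewrite -ltnS grid_cell_lt//; case: (N) aN.
  by rewrite -ltnS ltnNge le_grid_cell ?aN'// -leNgt.
by have [->//|a0] := posnP a; rewrite le_grid_cell ?a0.
Qed.

(** The thresholds of the coarse grid are every [d]-th threshold of the fine
one. *)
Lemma grid_cell_refine N d x : (0 < N)%N -> (0 < d)%N ->
  grid_cell N x = (grid_cell (N * d) x %/ d)%N.
Proof.
move=> N0 d0; have Nd0 : (0 < N * d)%N by rewrite muln_gt0 N0.
have lt1 := grid_cell_lt x N0.
have lt2 : (grid_cell (N * d) x %/ d < N)%N by rewrite ltn_divLR// grid_cell_lt.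
have key a : (0 < a < N)%N ->
    (a <= grid_cell N x)%N = (a <= grid_cell (N * d) x %/ d)%N.
  move=> /andP[a0 aN]; rewrite leq_divRL// !le_grid_cell ?a0//.
    by rewrite !natrM -mulf_div divff ?mulr1// pnatr_eq0 -lt0n.
  by rewrite muln_gt0 a0 d0 ltn_pmul2r.
apply/eqP; rewrite eqn_leq; apply/andP; split.
  by have [->//|c0] := posnP (grid_cell N x); rewrite -key ?c0.
by have [->//|c0] := posnP (grid_cell (N * d) x %/ d)%N; rewrite key ?c0.
Qed.

Lemma measurable_grid_cell N a : measurable (grid_cell N @^-1` [set a]).
Proof.
apply: (measurable_threshold_label N (@grid_threshold_homo N) a (f := id)).
exact: measurable_id.
Qed.

Lemma unit_label_grid N : (0 < N)%N -> unit_label (grid_cell N) N.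
Proof.
move=> N0; split=> [a|x _]; last exact: grid_cell_lt.
by apply: measurableI; [exact: measurable_itv|exact: measurable_grid_cell].
Qed.

Lemma mass_itv (b1 b2 : bool) (x y : R) : x <= y ->
  mass [set` Interval (BSide b1 x) (BSide b2 y)] = y - x.
Proof.
move=> xy; rewrite /mass lebesgue_measure_itv/= lte_fin.
case: ltP => [_//|yx]; rewrite /=.
by apply/esym/eqP; rewrite subr_eq0 eq_le xy yx.
Qed.

(** Cells are half-open, except that the first one also contains the
origin. *)
Lemma part_grid N a : (a < N)%N ->
  part (grid_cell N) a =
  [set` Interval (BSide (a == 0%N) (a%:R / N%:R)) (BRight (a.+1%:R / N%:R))] :> set R.
Proof.
move=> aN; have N0 : (0 < N)%N by exact: leq_trans aN.
have N0' : 0 < N%:R :> R by rewrite ltr0n.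
apply/seteqP; split=> [x [Ix /= xa]|x /=].
  have := grid_cell_bounds N0 Ix; rewrite xa in_itv /= => /andP[le1 ->].
  case: eqP => [->|/eqP]; rewrite andbT /=; first by rewrite mul0r; case/andP: Ix.
  by rewrite -lt0n => a0; rewrite -le_grid_cell ?xa ?a0.
rewrite in_itv /= => /andP[le1 le2].
have x1 : x <= 1.
  by rewrite (le_trans le2)// ler_pdivrMr// mul1r ler_nat.
have le1' : a%:R / N%:R <= x by case: eqP le1 => _ //= /ltW.
have x0 : 0 <= x by apply: le_trans le1'; rewrite divr_ge0.
split; first by rewrite /= in_itv/= x0.
case: eqP le1 => [a0 _|_ /= lt1]; last first.
  by apply: grid_cell_unique => //; apply/andP.
move: x0; rewrite le_eqVlt => /orP[/eqP x0|x0]; last first.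
  by apply: grid_cell_unique => //; rewrite le2 a0 mul0r x0.
rewrite -x0 a0; apply/eqP; rewrite -leqn0 leqNgt; apply/negP => c0.
have : ((grid_cell N 0)%:R / N%:R < 0 :> R).
  by rewrite -le_grid_cell ?leqnn// c0 grid_cell_lt.
by rewrite ltNge divr_ge0.
Qed.

Lemma mass_part_grid N a : (a < N)%N -> mass (part (grid_cell N) a) = N%:R^-1 :> R.
Proof.
move=> aN; rewrite part_grid//.
have N0' : 0 < N%:R :> R by rewrite ltr0n; exact: leq_trans aN.
rewrite mass_itv; last by rewrite ler_pM2r ?invr_gt0// ler_nat.
by rewrite -mulrBl -natrB// subSnn mul1r.
Qed.

End grid.

(** * Approximation of kernels by step kernels on grids *)

Section grid_approximation.
Context {R : realType}.
Local Notation mu := (@lebesgue_measure R).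
Local Notation mu2 := (mu \x mu)%E.
Local Notation I01 := (`[0, 1]%classic : set R).
Local Notation I2 := (I01 `*` I01).

Definition grid_set (j : nat) (F : nat -> nat -> Prop) : set (R * R) :=
  [set z | F (grid_cell (2 ^ j) z.1) (grid_cell (2 ^ j) z.2)].

Lemma measurable_grid_set j F : measurable (grid_set j F).
Proof.
rewrite (_ : grid_set j F = \bigcup_(a in setT) \bigcup_(b in [set b | F a b])
  ((grid_cell (2 ^ j) @^-1` [set a]) `*` (grid_cell (2 ^ j) @^-1` [set b]))).
  apply: bigcup_measurable => a _; apply: bigcup_measurable => b _.
  by apply: measurableX; exact: measurable_grid_cell.
apply/seteqP; split=> [[x y] /= Fxy|[x y] [a _ [b Fab [/= xa yb]]]]; last first.
  by rewrite /grid_set /= xa yb.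
by exists (grid_cell (2 ^ j) x) => //; exists (grid_cell (2 ^ j) y).
Qed.

Lemma grid_set_refine j d F : grid_set j F =
  grid_set (j + d) (fun a b => F (a %/ 2 ^ d)%N (b %/ 2 ^ d)%N).
Proof.
apply/seteqP; split=> -[x y]; rewrite /grid_set /= expnD;
  by rewrite -!grid_cell_refine// expn_gt0.
Qed.

(** Sets that agree with a union of squares of a dyadic grid up to a set of
small measure in the unit square.  They form a sigma-algebra, dyadic grids
being nested, and so exhaust the Borel sets of the plane. *)
Definition grid_approximable : set (set (R * R)) :=
  [set E | measurable E /\ forall e : R, 0 < e -> exists j F,
     (mu2 (I2 `&` (E `+` grid_set j F)) <= e%:E)%E].

Let mI2 : measurable I2.
Proof. exact: measurable_rect unit_sub_I01 unit_sub_I01. Qed.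

Let le_mu2 (A B : set (R * R)) : measurable A -> measurable B -> A `<=` B ->
  (mu2 A <= mu2 B)%E.
Proof. by move=> mA mB AB; apply: (le_measure mu2) => //; rewrite inE. Qed.

Let mu2U (A B : set (R * R)) : measurable A -> measurable B ->
  (mu2 (A `|` B) <= mu2 A + mu2 B)%E.
Proof. by move=> mA mB; exact: (measureU2 mu2). Qed.

Let mY (A B : set (R * R)) : measurable A -> measurable B ->
  measurable (I2 `&` (A `+` B)).
Proof.
move=> mA mB; apply: measurableI => //.
by rewrite /setY; apply: measurableU; exact: measurableD.
Qed.

Lemma grid_approximable_setU E E' :
  grid_approximable E -> grid_approximable E' -> grid_approximable (E `|` E').
Proof.
move=> [mE aE] [mE' aE']; split; first exact: measurableU.
move=> e e0; have e2 : 0 < e / 2 by rewrite divr_gt0.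
have [j [F le]] := aE _ e2; have [j' [F' le']] := aE' _ e2.
rewrite (grid_set_refine j j') in le; rewrite (grid_set_refine j' j) addnC in le'.
set F1 := (fun a b => F _ _) in le; set F1' := (fun a b => F' _ _) in le'.
exists (j + j')%N, (fun a b => F1 a b \/ F1' a b).
have m1 := measurable_grid_set (j + j') F1; have m2 := measurable_grid_set (j + j') F1'.
have m3 := measurable_grid_set (j + j') (fun a b => F1 a b \/ F1' a b).
have M1 := mY mE m1; have M2 := mY mE' m2.
apply: (le_trans (le_mu2 (mY (measurableU _ _ mE mE') m3) (measurableU _ _ M1 M2) _)).
  move=> z [Iz /= [[[Ez|Ez] /not_orP[nF nF']]|[[Fz|Fz] /not_orP[nE nE']]]].
  - by left; split=> //; left.
  - by right; split=> //; left.
  - by left; split=> //; right.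
  - by right; split=> //; right.
apply: (le_trans (mu2U M1 M2)).
by rewrite [e](splitr e) EFinD leeD.
Qed.

Lemma grid_approximable_setC E : grid_approximable E -> grid_approximable (~` E).
Proof.
move=> [mE aE]; split; first exact: measurableC.
move=> e /aE[j [F le]]; exists j, (fun a b => ~ F a b).
rewrite (_ : ~` E `+` _ = E `+` grid_set j F)//.
apply/seteqP; split=> z /=; rewrite /grid_set /=.
  by move=> [[nE /contrapT]|[nF /contrapT]]; [right|left].
by move=> [[Ez nF]|[Fz nE]]; [right|left]; split=> //; exact.
Qed.

Lemma grid_approximable0 : grid_approximable set0.
Proof.
split=> // e e0; exists 0%N, (fun _ _ => False).
rewrite (_ : _ `+` _ = set0); last first.
  by apply/seteqP; split=> // z /= [[]|[]].
by rewrite setI0 measure0 lee_fin ltW.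
Qed.

Lemma mu2_I2_fin : (mu2 I2 < +oo)%E.
Proof. by rewrite (mu2_rect unit_sub_I01 unit_sub_I01) ltry. Qed.

(** A countable union is approximated in measure by a finite one, by
continuity of the measure from above on the unit square, which has finite
measure. *)
Lemma sigma_algebra_grid_approximable : sigma_algebra setT grid_approximable.
Proof.
split; first exact: grid_approximable0.
  by move=> E; rewrite setTD; exact: grid_approximable_setC.
move=> E aE; have mE k : measurable (E k) by case: (aE k).
have mEE : measurable (\bigcup_k E k) by exact: bigcup_measurable.
split=> // e e0; have e2 : 0 < e / 2 by rewrite divr_gt0.
pose U n := \big[setU/set0]_(k < n) E k.
have aU n : grid_approximable (U n).
  rewrite /U; elim: n => [|n IH]; first by rewrite big_ord0; exact: grid_approximable0.
  by rewrite big_ord_recr; exact: grid_approximable_setU.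
have mU n : measurable (U n) by case: (aU n).
(* What the first [n] sets miss of the union. *)
pose D n := I2 `&` ((\bigcup_k E k) `\` U n).
have mD n : measurable (D n) by apply: measurableI => //; exact: measurableD.
have D0 : \bigcap_n D n = set0.
  apply/seteqP; split=> // z Dz; have [_ [[k _ Ekz] _]] := Dz 0%N I.
  have [_ [_]] := Dz k.+1 I; apply; rewrite /U -bigcup_mkord; exists k => //=.
have : mu2 \o D @ \oo --> mu2 (\bigcap_n D n).
  apply: (nonincreasing_cvg_mu (mu := mu2)) => //.
  - apply: (le_lt_trans _ mu2_I2_fin); apply: le_mu2 => //; exact: subIsetl.
  - by rewrite D0.
  - move=> m n mn; apply/subsetPset; apply: setIS; apply: setDS.
    rewrite /U -!bigcup_mkord => z [k /= km Ek]; exists k => //=.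
    exact: leq_trans mn.
rewrite D0 measure0 => /(_ _ (open_ereal_lt' (_ : (0 < (e / 2)%:E)%E))).
rewrite lte_fin => /(_ e2) [n _ /(_ n (leqnn n)) /= ltD].
have [_ /(_ _ e2)[j [F leF]]] := aU n; exists j, F.
have mF := measurable_grid_set j F; have mUF := mY (mU n) mF.
apply: (le_trans (le_mu2 (mY mEE mF) (measurableU _ _ (mD n) mUF) _)).
  move=> z [Iz /= [[EEz nF]|[Fz nEE]]].
    have [Uz|nUz] := pselect (U n z).
      by right; split=> //; left.
    by left; split.
  right; split=> //; right; split=> // Uz; apply: nEE.
  by move: Uz; rewrite /U -bigcup_mkord => -[k _ Ek]; exists k.
apply: (le_trans (mu2U (mD n) mUF)).
by rewrite [e](splitr e) EFinD leeD// ltW.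
Qed.

End grid_approximation.

Section kernel_approximation.
Context {R : realType}.
Local Notation mu := (@lebesgue_measure R).
Local Notation mu2 := (mu \x mu)%E.
Local Notation I01 := (`[0, 1]%classic : set R).
Local Notation I2 := (I01 `*` I01).

(** A half-plane differs from a union of columns of the grid only inside the
column of its boundary, whose measure is [2^-j]. *)
Lemma grid_approximable_half_plane (x : R) :
  grid_approximable (fst @^-1` `]x, +oo[%classic : set (R * R)) /\
  grid_approximable (snd @^-1` `]x, +oo[%classic : set (R * R)).
Proof.
have mH : measurable (`]x, +oo[%classic : set R) by exact: measurable_itv.
have uI := @unit_sub_I01 R.
have small e : 0 < e -> exists j : nat, (2 ^ j)%:R^-1 <= e :> R.
  move=> e0; exists (Num.truncn e^-1).+1.
  rewrite -[leRHS]invrK lef_pV2 ?posrE ?invr_gt0 ?ltr0n ?expn_gt0//.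
  rewrite (le_trans (ltW (truncnS_gt _)))// ler_nat ltnW//.
  exact: ltn_expl.
pose D j : set R := part (grid_cell (2 ^ j)) (grid_cell (2 ^ j) x).
have mono j (y : R) : x < y -> (grid_cell (2 ^ j) x <= grid_cell (2 ^ j) y)%N.
  move=> xy; have [->//|c0] := posnP (grid_cell (2 ^ j) x).
  have N0 : (0 < 2 ^ j)%N by rewrite expn_gt0.
  have cN := grid_cell_lt x N0.
  rewrite le_grid_cell ?c0//; apply: lt_trans xy.
  by rewrite -le_grid_cell ?c0.
have mono' j (y : R) : ~ x < y -> (grid_cell (2 ^ j) y <= grid_cell (2 ^ j) x)%N.
  move=> /negP; rewrite -leNgt => yx.
  have [->//|c0] := posnP (grid_cell (2 ^ j) y).
  have N0 : (0 < 2 ^ j)%N by rewrite expn_gt0.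
  have cN := grid_cell_lt y N0.
  rewrite le_grid_cell ?c0//; apply: lt_le_trans yx.
  by rewrite -le_grid_cell ?c0.
have uD j : unit_sub (D j).
  by apply: unit_sub_part (unit_label_grid _); rewrite expn_gt0.
have mD j : mass (D j) = (2 ^ j)%:R^-1.
  by apply: mass_part_grid; apply: grid_cell_lt; rewrite expn_gt0.
have close j (y : R) : I01 y -> (x < y /\ ~ (grid_cell (2 ^ j) x <= grid_cell (2 ^ j) y)%N) \/
    ((grid_cell (2 ^ j) x <= grid_cell (2 ^ j) y)%N /\ ~ x < y) -> D j y.
  move=> Iy [[xy]|[le nxy]]; first by move/(mono j) in xy.
  by split=> //=; apply/eqP; rewrite eqn_leq le mono'.
have mG1 : measurable (fst @^-1` `]x, +oo[%classic : set (R * R)).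
  by rewrite -[_ @^-1` _]setTI; exact: measurable_fst.
have mG2 : measurable (snd @^-1` `]x, +oo[%classic : set (R * R)).
  by rewrite -[_ @^-1` _]setTI; exact: measurable_snd.
have bound (E : set (R * R)) (j : nat) (A B : set R) e : unit_sub A -> unit_sub B ->
    measurable E -> E `<=` A `*` B -> mass A * mass B <= e -> (mu2 E <= e%:E)%E.
  move=> uA uB mE EAB le; apply: (@le_trans _ _ (mu2 (A `*` B))).
    by apply: (le_measure mu2) => //; rewrite inE//; exact: measurable_rect.
  by rewrite (mu2_rect uA uB) lee_fin.
have mI2 : measurable I2 by exact: measurable_rect.
split; split=> // e /small[j je].
  exists j, (fun a b => (grid_cell (2 ^ j) x <= a)%N).
  apply: (@bound _ j (D j) I01) => //.
  - apply: measurableI => //; apply: measurableU; apply: measurableD => //;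
      exact: measurable_grid_set.
  - move=> [y z] [[/= Iy Iz]]; rewrite /grid_set /= in_itv/= andbT => h.
    by split=> //=; exact: close.
  - by rewrite mD mass_I01 mulr1.
exists j, (fun a b => (grid_cell (2 ^ j) x <= b)%N).
apply: (@bound _ j I01 (D j)) => //.
- apply: measurableI => //; apply: measurableU; apply: measurableD => //;
    exact: measurable_grid_set.
- move=> [z y] [[/= Iz Iy]]; rewrite /grid_set /= in_itv/= andbT => h.
  by split=> //=; exact: close.
- by rewrite mD mass_I01 mul1r.
Qed.

(** The Borel sets of the plane are generated by the preimages of half-lines
under the two projections. *)
Lemma measurable_grid_approximable (E : set (R * R)) :
  measurable E -> grid_approximable E.
Proof.
have [A0 AC AU] := @sigma_algebra_grid_approximable R.
have sub (f : R * R -> R) :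
    (forall x : R, grid_approximable (f @^-1` `]x, +oo[%classic)) ->
    forall X : set R, measurable X -> grid_approximable (f @^-1` X).
  move=> fray X; pose B := [set X : set R | grid_approximable (f @^-1` X)].
  suff : (@measurable _ (measurableTypeR R)) `<=` B by apply.
  rewrite (_ : @measurable _ (measurableTypeR R) = (@ocitv R).-sigma.-measurable)//.
  rewrite RGenOInfty.measurableE; apply: smallest_sub.
    split; rewrite /B /=; first by rewrite preimage_set0.
      by move=> Y BY; rewrite setTD preimage_setC -setTD; exact: AC.
    by move=> Y BY; rewrite preimage_bigcup; exact: AU.
  by move=> _ [x ->]; exact: fray.
have subf := sub _ (fun x => (grid_approximable_half_plane x).1).
have subs := sub _ (fun x => (grid_approximable_half_plane x).2).
move: E; apply: smallest_sub => //.
by rewrite subUset; split=> _ [X mX <-]; rewrite setTI; [exact: subf|exact: subs].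
Qed.

End kernel_approximation.

Section step_approximation.
Context {R : realType}.
Local Notation mu := (@lebesgue_measure R).
Local Notation mu2 := (mu \x mu)%E.
Local Notation I01 := (`[0, 1]%classic : set R).
Local Notation I2 := (I01 `*` I01).

(** The sum counts the positive multiples of [1 / N] up to [t]. *)
Lemma layer_cake (t : R) (N M : nat) : (0 < N)%N -> 0 <= t -> t <= M%:R / N%:R ->
  `|t - N%:R^-1 * \sum_(i < M) (i.+1%:R / N%:R <= t)%R%:R| <= N%:R^-1.
Proof.
move=> N0 t0 tM; have N0' : 0 < N%:R :> R by rewrite ltr0n.
have tN0 : 0 <= t * N%:R by rewrite mulr_ge0.
pose T := Num.truncn (t * N%:R).
have TM : (T <= M)%N.
  by rewrite -(ler_nat R) (le_trans (_ : _ <= t * N%:R)) ?truncn_le// -ler_pdivlMr.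
have -> : \sum_(i < M) (i.+1%:R / N%:R <= t)%R%:R = T%:R :> R.
  rewrite -[in RHS](card_ord_below TM) -sum1_card natr_sum [RHS]big_mkcond /=.
  apply: eq_bigr => i _; rewrite inE truncn_gt_nat -ler_pdivrMr//.
  by case: ifP.
have /andP[le lt] := truncn_itv tN0; rewrite -/T in le lt.
have {}le : T%:R / N%:R <= t by rewrite ler_pdivrMr.
have {}lt : t < (T%:R + 1) / N%:R by rewrite ltr_pdivlMr// natr1.
rewrite mulrC ler_norml; apply/andP; split; last by lra.
by rewrite (@le_trans _ _ 0)// ?oppr_le0 ?invr_ge0// subr_ge0.
Qed.

Lemma step_fun_refine N d (c : nat -> nat -> R) : (0 < N)%N -> (0 < d)%N ->
  step_fun (grid_cell N) c =
  step_fun (grid_cell (N * d)) (fun a b => c (a %/ d)%N (b %/ d)%N).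
Proof.
by move=> N0 d0; apply/funext => z; rewrite /step_fun -!grid_cell_refine.
Qed.

Lemma bounded_meas_step_grid N (c : nat -> nat -> R) : (0 < N)%N ->
  bounded_meas (step_fun (grid_cell N) c).
Proof. by move=> N0; apply: bounded_meas_step_label; exact: unit_label_grid. Qed.

(** By [layer_cake] the kernel is uniformly close to [1 / N] times the sum of
the indicators of its superlevel sets at the multiples of [1 / N]; these sets
are finitely many, so one dyadic grid approximates all of them. *)
Lemma bounded_meas_step_approx (kappa : R * R -> R) (e : R) :
  bounded_meas kappa -> (forall z, I2 z -> 0 <= kappa z) -> 0 < e ->
  exists j c, l1_norm (fun z => kappa z - step_fun (grid_cell (2 ^ j)) c z) <= e.
Proof.
move=> bk k0 e0; have [mk [B kB]] := bk; have uI := @unit_sub_I01 R.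
have mI2 : measurable I2 by exact: measurable_rect.
pose N := (Num.truncn (2 / e)).+1.
have N0 : 0 < N%:R :> R by [].
have Ne : N%:R^-1 <= e / 2.
  rewrite -[leRHS]invrK lef_pV2 ?posrE ?invr_gt0 ?divr_gt0// invf_div.
  by rewrite ltW// truncnS_gt.
pose M := (Num.truncn (B * N%:R)).+1.
have BM : B <= M%:R / N%:R by rewrite ler_pdivlMr// ltW// truncnS_gt.
pose E i := I2 `&` kappa @^-1` `[i.+1%:R / N%:R, +oo[%classic.
have mE i : measurable (E i) by apply: mk => //; exact: measurable_itv.
pose e' := e / 2 / M%:R; have e'0 : 0 < e' by rewrite !divr_gt0.
have /choice[jF jFe] : forall i, exists jF : nat * (nat -> nat -> Prop),
    (mu2 (I2 `&` (E i `+` grid_set jF.1 jF.2)) <= e'%:E)%E.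
  move=> i; have [_ /(_ _ e'0)[j [F le]]] := measurable_grid_approximable (mE i).
  by exists (j, F).
(* A common refinement of the dyadic grids of all levels. *)
pose J := (\sum_(i < M) (jF i).1)%N.
have le_J (i : 'I_M) : ((jF i).1 <= J)%N by rewrite /J (bigD1 i)//= leq_addr.
have /choice[F Fe] : forall i : 'I_M, exists F : nat -> nat -> Prop,
    (mu2 (I2 `&` (E i `+` grid_set J F)) <= e'%:E)%E.
  move=> i; have := jFe i; rewrite (grid_set_refine _ (J - (jF i).1)) subnKC//.
  by move=> le; eexists; exact: le.
pose c a b : R := N%:R^-1 * \sum_(i < M) `[< F i a b >]%:R.
exists J, c.
pose Y (i : 'I_M) : set (R * R) := I2 `&` (E i `+` grid_set J (F i)).
have mY i : measurable (Y i).
  apply: measurableI => //; apply: measurableU; apply: measurableD => //;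
    exact: measurable_grid_set.
(* The error of [layer_cake] plus the levels at which the grid set is
wrong. *)
pose up z : R := N%:R^-1 + N%:R^-1 * \sum_(i < M) \1_(Y i) z.
have bS : bounded_meas (fun z => \sum_(i < M) \1_(Y i) z : R).
  by apply: bounded_meas_sum => i; exact: bounded_meas_indic.
have bZ : bounded_meas (fun z => N%:R^-1 * \sum_(i < M) \1_(Y i) z : R).
  exact: bounded_measZ.
have bW := @bounded_meas_step_grid (2 ^ J) c (expn_gt0 2 J).
apply: (@le_trans _ _ (rect_integral up I01 I01)).
  apply: le_rect_integral => //.
    by apply: bounded_meas_norm; exact: bounded_measB.
    by apply: bounded_measD => //; exact: bounded_meas_cst.
  move=> z zI; have kz0 := k0 z zI.
  have kzM : kappa z <= M%:R / N%:R.
    by apply: le_trans BM; rewrite (le_trans _ (kB z zI))// ler_norm.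
  have := layer_cake (ltn0Sn _ : (0 < N)%N) kz0 kzM.
  set s := \sum_(i < M) _ => near.
  have -> : kappa z - step_fun (grid_cell (2 ^ J)) c z =
      (kappa z - N%:R^-1 * s) + N%:R^-1 * (s - \sum_(i < M) \1_(grid_set J (F i)) z).
    rewrite mulrBr addrA subrK; congr (_ - _); rewrite /step_fun /c; congr (_ * _).
  apply: (le_trans (ler_normD _ _)); apply: lerD => //.
  rewrite normrM ger0_norm ?invr_ge0// ler_wpM2l ?invr_ge0//.
  rewrite /s -sumrB; apply: (le_trans (ler_norm_sum _ _ _)); apply: ler_sum => i _.
  have -> : (i.+1%:R / N%:R <= kappa z) = (z \in E i).
    apply/idP/idP => [le|]; last by rewrite inE => -[_ /=]; rewrite in_itv/= andbT.
    by rewrite inE; split=> //=; rewrite in_itv/= andbT.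
  rewrite !indicE; have [Ez|Ez] := boolP (z \in E i);
    have [Fz|Fz] := boolP (z \in grid_set J (F i)) => /=.
  - by rewrite subrr normr0.
  - rewrite subr0 normr1 mem_set//; split=> //; left; split; first exact/set_mem.
    by move/mem_set; apply/negP.
  - rewrite sub0r normrN normr1 mem_set//; split=> //; right; split; first exact/set_mem.
    by move/mem_set; apply/negP.
  - by rewrite subrr normr0.
have bcst := @bounded_meas_cst R N%:R^-1.
rewrite rect_integralD// rect_integralZ// rect_integral_sum//; last first.
  by move=> i; exact: bounded_meas_indic.
rewrite rect_integral_cst// mass_I01 !mulr1.
rewrite [e in leRHS](splitr e); apply: lerD => //.
apply: (@le_trans _ _ (1 * \sum_(i < M) e')); last first.
  by rewrite mul1r sumr_const card_ord -[leLHS]mulr_natr /e' divfK ?pnatr_eq0.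
apply: ler_pM; rewrite ?invr_ge0//.
- by apply: sumr_ge0 => i _; apply: Rintegral_ge0.
- by rewrite invf_le1// ler1n.
apply: ler_sum => i _; rewrite rect_integral_indic//.
have le : (mu2 (Y i `&` I2) <= e'%:E)%E.
  by apply: (le_trans _ (Fe i)); rewrite setIC setIA setIid.
by rewrite -lee_fin fineK// ge0_fin_numE// (le_lt_trans le)// ltry.
Qed.

Definition grid_average (kappa : R * R -> R) (N a b : nat) : R :=
  N%:R ^+ 2 * rect_integral kappa (part (grid_cell N) a) (part (grid_cell N) b).

Lemma l1_norm_step_grid N (c : nat -> nat -> R) : (0 < N)%N ->
  l1_norm (step_fun (grid_cell N) c) =
  N%:R ^- 2 * \sum_(a < N) \sum_(b < N) `|c a b|.
Proof.
move=> N0; have uI := @unit_sub_I01 R; have ul := @unit_label_grid R _ N0.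
rewrite /l1_norm (rect_integral_step_label (fun a b => `|c a b|) ul)//.
rewrite mulr_sumr; apply: eq_bigr => a _; rewrite mulr_sumr; apply: eq_bigr => b _.
rewrite -!/(part _ _) (mass_part_grid (ltn_ord a)) (mass_part_grid (ltn_ord b)).
by rewrite -expr2 exprVn mulrC.
Qed.

Lemma rect_integral_step_cell N a b (c : nat -> nat -> R) : (a < N)%N -> (b < N)%N ->
  rect_integral (step_fun (grid_cell N) c)
    (part (grid_cell N) a) (part (grid_cell N) b) = N%:R ^- 2 * c a b.
Proof.
move=> aN bN; have N0 : (0 < N)%N by exact: leq_trans aN.
have ul := @unit_label_grid R _ N0.
have up i := unit_sub_part i ul.
have disj i j : i != j -> part (grid_cell N) i `&` grid_cell N @^-1` [set j] = set0 :> set R.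
  move=> /eqP ij; apply/seteqP; split=> // x [[_ /= xi] /= xj].
  by apply: ij; rewrite -xi.
rewrite (rect_integral_step_label _ ul)//.
rewrite (bigD1 (Ordinal aN))//= [X in _ + X]big1 ?addr0; last first.
  move=> i ia; rewrite big1// => j _; rewrite disj ?mass0 ?mul0r ?mulr0//.
  by rewrite eq_sym; move: ia; rewrite -val_eqE.
rewrite (bigD1 (Ordinal bN))//= big1 ?addr0; last first.
  move=> j jb; rewrite (disj b) ?mass0 ?mulr0//.
  by rewrite eq_sym; move: jb; rewrite -val_eqE.
have same i : part (grid_cell N) i `&` grid_cell N @^-1` [set i] =
    part (grid_cell N) i :> set R by rewrite /part -setIA setIid.
by rewrite !same (mass_part_grid aN) (mass_part_grid bN) -expr2 exprVn mulrC.
Qed.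

(** The averages over the cells are as good as any step kernel up to a factor
two: the [L^1] distance from [c] to the averages of [kappa] is at most that
from [c] to [kappa], since averaging contracts the [L^1] norm. *)
Lemma grid_average_approx (kappa : R * R -> R) N (c : nat -> nat -> R) (e : R) :
  (0 < N)%N -> bounded_meas kappa ->
  l1_norm (fun z => kappa z - step_fun (grid_cell N) c z) <= e ->
  l1_norm (fun z => kappa z - step_fun (grid_cell N) (grid_average kappa N) z)
    <= e + e.
Proof.
move=> N0 bk le; have ul := @unit_label_grid R _ N0.
have bW := bounded_meas_step_grid c N0.
have bA := bounded_meas_step_grid (grid_average kappa N) N0.
apply: (le_trans (l1_norm_triangle bk bW bA)); apply: lerD => //.
apply: le_trans le.
have N2 : N%:R ^+ 2 != 0 :> R by rewrite expf_neq0// pnatr_eq0 -lt0n.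
have -> : (fun z => step_fun (grid_cell N) c z -
    step_fun (grid_cell N) (grid_average kappa N) z) =
    step_fun (grid_cell N) (fun a b => c a b - grid_average kappa N a b) by [].
rewrite l1_norm_step_grid//.
apply: le_trans (sum_rect_integral_le_l1 ul (bounded_measB bk bW)).
rewrite mulr_sumr; apply: ler_sum => a _; rewrite mulr_sumr; apply: ler_sum => b _.
have up i := unit_sub_part i ul.
rewrite rect_integralB// (rect_integral_step_cell c (ltn_ord a) (ltn_ord b)).
rewrite -[X in X * _]ger0_norm ?invr_ge0 ?exprn_ge0// -normrM mulrBr /grid_average.
by rewrite mulKf// distrC.
Qed.

(** The refinement by [2] provides a grid of more than one cell, as needed for
a partition into [N >= 2] parts. *)
Lemma kernel_grid_approx (kappa : R * R -> R) (e : R) :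
  bounded_meas kappa -> (forall z, I2 z -> 0 <= kappa z) -> 0 < e ->
  exists2 N, (1 < N)%N &
  l1_norm (fun z => kappa z - step_fun (grid_cell N) (grid_average kappa N) z) <= e.
Proof.
move=> bk k0 e0; have [j [c le]] := bounded_meas_step_approx bk k0 (divr_gt0 e0 (ltr0n R 2)).
have j0 : (0 < 2 ^ j)%N by rewrite expn_gt0.
exists (2 ^ j * 2)%N; first by lia.
rewrite (step_fun_refine c j0 (isT : (0 < 2)%N)) in le.
by have := grid_average_approx _ bk le; rewrite -splitr; apply; lia.
Qed.

End step_approximation.

(** * Rearrangement by measure-preserving bijections *)

Section change_of_variable.
Context {R : realType}.
Local Notation RR := (measurableTypeR R).
Local Notation mu := (@lebesgue_measure R).
Local Notation I01 := (`[0, 1]%classic : set R).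
Local Notation I2 := (I01 `*` I01).
Variable tau : R -> R.
Hypothesis mp : measure_preserving_bij tau.

(** The value [2] keeps the complement of the unit interval away from it, so
that the change of variables can be done on the whole line. *)
Definition extend_tau : RR -> RR := fun x => if (x : R) \in `[0, 1] then tau x else 2.

Let t := extend_tau.

Lemma tau_I01 x : I01 x -> I01 (tau x).
Proof. by case: mp => -[tI _ _] _ _ /tI. Qed.

Let tI x : I01 x -> t x = tau x.
Proof. by rewrite /t /extend_tau /= => ->. Qed.

Let tO x : ~ I01 x -> ~ I01 (t x).
Proof.
rewrite /t /extend_tau /= => /negP/negbTE ->.
by rewrite in_itv/=; move=> /andP[_]; lra.
Qed.

Let mt : measurable_fun [set: RR] t.
Proof.
have mI : measurable I01 := measurable_I01.
apply: measurable_fun_if => //.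
- by apply: (measurable_fun_bool true); rewrite setTI; exact: mI.
- by rewrite setTI; case: mp.
Qed.

Let pushforward_t (A : set RR) : measurable A -> A `<=` I01 ->
  pushforward mu t A = mu A.
Proof.
move=> mA AI; case: mp => _ _ /(_ A mA AI) <-; rewrite /pushforward.
congr (mu _); apply/seteqP; split=> x /=.
  move=> Atx; have Ix : I01 x by apply: contrapT => /tO; apply; exact: AI.
  by split=> //; rewrite -tI.
by move=> [Ix]; rewrite tI.
Qed.

Let integral_t (f : RR -> \bar R) : measurable_fun [set: RR] f ->
  (forall x, 0 <= f x)%E -> (forall x, ~ I01 x -> f x = 0%E) ->
  (\int[mu]_x f (t x) = \int[mu]_x f x)%E.
Proof.
move=> mf f0 fI.
have fE : f = f \_ I01.
  apply/funext => x; rewrite /patch; case: ifPn => // /negP; rewrite inE.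
  exact: fI.
have := @ge0_integral_pushforward _ _ RR RR R t mt mu setT f measurableT mf (fun x _ => f0 x).
rewrite preimage_setT => <-.
rewrite fE -!integral_mkcond; apply: eq_measure_integral => A mA AI.
exact: pushforward_t.
Qed.

Lemma bounded_meas_rearrange h : bounded_meas h -> bounded_meas (rearrange h tau).
Proof.
move=> [mh [M hM]]; split; last first.
  exists M => -[x y] [Ix Iy]; apply: hM; split=> /=; exact: tau_I01.
have mI2 : measurable I2 := measurable_rect unit_sub_I01 unit_sub_I01.
have mh0 : measurable_fun [set: RR * RR] (h \_ I2).
  exact/(measurable_restrictT _ mI2).
have mtt : measurable_fun [set: RR * RR] (fun z : RR * RR => (t z.1, t z.2)).
  by apply: measurable_fun_pair; apply: (measurableT_comp mt).
have := measurableT_comp mh0 mtt => /(measurable_funS measurableT (@subsetT _ I2)).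
apply: eq_measurable_fun => -[x y] /[!inE] -[/= Ix Iy].
rewrite /patch !tI// /rearrange /= mem_set//; split=> /=; exact: tau_I01.
Qed.

(** By Tonelli the double integral is iterated, and each of the two integrals
is invariant under the measure-preserving map. *)
Lemma l1_norm_rearrange h : bounded_meas h ->
  l1_norm (rearrange h tau) = l1_norm h.
Proof.
move=> bh; have [mh _] := bh.
have mI2 : measurable I2 := measurable_rect unit_sub_I01 unit_sub_I01.
pose g : RR * RR -> \bar R := (fun z => `|h z|%:E) \_ I2.
have mg : measurable_fun [set: RR * RR] g.
  apply/(measurable_restrictT _ mI2)/measurable_EFinP.
  exact: measurableT_comp.
have g0 z : (0 <= g z)%E by rewrite /g /patch; case: ifP.
have gO x y : ~ I01 x \/ ~ I01 y -> g (x, y) = 0%E.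
  by move=> nI; rewrite /g /patch memNset// => -[/= Ix Iy]; case: nI.
have mtt : measurable_fun [set: RR * RR] (fun z : RR * RR => (t z.1, t z.2)).
  by apply: measurable_fun_pair; apply: (measurableT_comp mt).
have mgt : measurable_fun [set: RR * RR] (fun z : RR * RR => g (t z.1, t z.2)).
  exact: (measurableT_comp mg mtt).
rewrite /l1_norm /rect_integral /Rintegral; congr fine.
rewrite integral_mkcond [RHS]integral_mkcond -/g.
rewrite (_ : _ \_ _ = (fun z => g (t z.1, t z.2))); last first.
  apply/funext => -[x y]; rewrite /patch; case: ifPn => [/set_mem[/= Ix Iy]|/negP nI].
    by rewrite /g /patch !tI// mem_set//; split=> /=; exact: tau_I01.
  rewrite gO//; have [Ix|nIx] := pselect (I01 x); last by left; exact: tO.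
  by right; apply: tO => Iy; apply: nI; rewrite inE.
have gt0 z : (0 <= g (t z.1, t z.2))%E by exact: g0.
apply: (etrans (fubini_tonelli1 (m1 := mu) (m2 := mu) _ mgt gt0)).
apply: etrans (esym (fubini_tonelli1 (m1 := mu) (m2 := mu) _ mg g0)).
rewrite /fubini_F /=.
have gy x : (\int[mu]_y g (x, t y) = \int[mu]_y g (x, y))%E.
  apply: (integral_t (f := fun y => g (x, y))) => //; last first.
    by move=> y nIy; apply: gO; right.
  by apply: (measurableT_comp mg); exact: measurable_pair1.
under eq_integral do rewrite gy.
apply: (integral_t (f := fun x => \int[mu]_y g (x, y))%E).
- exact: (measurable_fun_fubini_tonelli_F (m2 := mu) _ mg).
- by move=> x; exact: integral_ge0.
- move=> x nIx; apply: integral0_eq => y _; apply: gO; by left.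
Qed.

End change_of_variable.

(** * The kernel of a graph *)

Section vertex_cells.
Context {R : realType}.
Local Notation I01 := (`[0, 1]%classic : set R).

(** The index of the vertex whose interval contains [x].  These intervals are
open on the left and miss the origin, which receives the extra label [n]. *)
Definition vertex_label (n : nat) (x : R) : nat :=
  if x == 0 then n else grid_cell n x.

Lemma vertex_label_lt n x : (0 < n)%N -> I01 x -> x != 0 -> (vertex_label n x < n)%N.
Proof.
by move=> n0 Ix /negbTE x0; rewrite /vertex_label x0 grid_cell_lt.
Qed.

Lemma vertex_labelP n v x : (v < n)%N ->
  (I01 x /\ vertex_label n x = v) <-> v%:R / n%:R < x <= v.+1%:R / n%:R.
Proof.
move=> vn; have n0 : (0 < n)%N by exact: leq_trans vn.
have n0' : 0 < n%:R :> R by rewrite ltr0n.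
rewrite /vertex_label; split=> [[Ix]|].
  case: eqP => [_ nv|/eqP x0 xv]; first by rewrite nv ltnn in vn.
  have := grid_cell_bounds n0 Ix; rewrite xv => /andP[le1 ->]; rewrite andbT.
  have [v0|v0] := posnP v; last by rewrite -le_grid_cell ?v0// xv.
  move: Ix; rewrite /= in_itv/= => /andP[x_ge0 _].
  by rewrite v0 mul0r lt_neqAle eq_sym x0.
move=> /andP[lt le]; have xgt0 : 0 < x.
  by apply: le_lt_trans lt; rewrite divr_ge0.
split; last by rewrite gt_eqF//; apply: grid_cell_unique => //; rewrite lt.
rewrite /= in_itv/= (ltW xgt0)/= (le_trans le)//.
by rewrite ler_pdivrMr// mul1r ler_nat.
Qed.

Lemma part_vertex n v : (v < n)%N -> part (vertex_label n) v =
  [set` Interval (BRight (v%:R / n%:R)) (BRight (v.+1%:R / n%:R))] :> set R.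
Proof.
move=> vn; apply/seteqP; split=> [x /(vertex_labelP _ vn)|x /=].
  by rewrite /= in_itv.
by rewrite in_itv /= => /(vertex_labelP _ vn).
Qed.

Lemma unit_label_vertex n : (0 < n)%N -> unit_label (vertex_label n) n.+1.
Proof.
move=> n0; split=> [v|x Ix].
  have [vn|nv] := ltnP v n.
    by have := part_vertex vn; rewrite /part => ->; exact: measurable_itv.
  rewrite (_ : _ `&` _ = if v == n then [set 0] else set0); first by case: eqP.
  apply/seteqP; split=> x.
    move=> [Ix /=]; rewrite /vertex_label; case: eqP => [-> ->|_ xv]; first by rewrite eqxx.
    by have := grid_cell_lt x n0; rewrite xv ltnNge nv.
  case: eqP => // -> /= ->; split; last by rewrite /vertex_label eqxx.
  by rewrite /= in_itv/= lexx ler01.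
rewrite /vertex_label; case: eqP => // _.
by rewrite ltnS ltnW// grid_cell_lt.
Qed.

Lemma mass_part_vertex n v : (v < n)%N -> mass (part (vertex_label n) v) = n%:R^-1 :> R.
Proof.
move=> vn; rewrite part_vertex//.
have n0 : 0 < n%:R :> R by rewrite ltr0n; exact: leq_trans vn.
rewrite mass_itv; last by rewrite ler_pM2r ?invr_gt0// ler_nat.
by rewrite -mulrBl -natrB// subSnn mul1r.
Qed.

Lemma mass_vertex_origin n (A : set R) : (0 < n)%N -> unit_sub A ->
  mass (A `&` vertex_label n @^-1` [set n]) = 0.
Proof.
move=> n0 uA; have [_ AI] := uA.
apply/eqP; rewrite eq_le mass_ge0 andbT.
have u0 : unit_sub ([set 0] : set R).
  by split=> // x /= ->; rewrite /= in_itv/= lexx ler01.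
have -> : 0 = mass ([set 0] : set R).
  by rewrite /mass lebesgue_measure_set1.
apply: le_mass => //.
  have [mv _] := unit_label_vertex n0.
  rewrite (_ : _ `&` _ = A `&` (I01 `&` vertex_label n @^-1` [set n])).
    exact: unit_sub_setIl.
  by rewrite setIA (setIidl AI).
move=> x [Ax /=]; rewrite /vertex_label; case: eqP => // _ xn.
by have := grid_cell_lt x n0; rewrite xn ltnn.
Qed.

(** The share of the interval of [v] that lies in [A]. *)
Definition vertex_weight n (A : set R) (v : nat) : R :=
  n%:R * mass (A `&` vertex_label n @^-1` [set v]).

Lemma unit_sub_vertex n (A : set R) v : (0 < n)%N -> unit_sub A ->
  unit_sub (A `&` vertex_label n @^-1` [set v]).
Proof.
move=> n0 uA; have [_ AI] := uA; have [mv _] := unit_label_vertex n0.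
rewrite (_ : _ `&` _ = A `&` (I01 `&` vertex_label n @^-1` [set v])).
  exact: unit_sub_setIl.
by rewrite setIA (setIidl AI).
Qed.

Lemma vertex_weight01 n (A : set R) v : (v < n)%N -> unit_sub A ->
  0 <= vertex_weight n A v <= 1.
Proof.
move=> vn uA; have n0 : (0 < n)%N by exact: leq_trans vn.
have n0' : 0 < n%:R :> R by rewrite ltr0n.
rewrite mulr_ge0 ?mass_ge0//= -ler_pdivlMl// mulr1 -(mass_part_vertex vn).
apply: le_mass; first exact: unit_sub_vertex.
  exact: (unit_sub_part _ (unit_label_vertex n0)).
by case: uA => _ AI x [/AI].
Qed.

Lemma sum_vertex_weight n (A : set R) : (0 < n)%N -> unit_sub A ->
  \sum_(v < n) vertex_weight n A v = n%:R * mass A.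
Proof.
move=> n0 uA; rewrite (mass_parts (unit_label_vertex n0) uA) big_ord_recr /=.
by rewrite mass_vertex_origin// addr0 mulr_sumr.
Qed.

End vertex_cells.

Section vertex_functions.
Context {R : realType}.
Variables (n : nat) (e : 'I_n -> 'I_n -> R).
Hypothesis n0 : (0 < n)%N.

(** A function of two vertices as one of two labels; it vanishes on the extra
label of the origin. *)
Definition vertex_fun (a b : nat) : R :=
  if (insub a, insub b) is (Some u, Some v) then e u v else 0.

Lemma vertex_funE (u v : 'I_n) : vertex_fun u v = e u v.
Proof. by rewrite /vertex_fun !valK. Qed.

Lemma vertex_fun_origin a b : a = n \/ b = n -> vertex_fun a b = 0.
Proof.
have nn : insub n = None :> option 'I_n by rewrite insubF ?ltnn.
by move=> [->|->]; rewrite /vertex_fun nn//; case: insub.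
Qed.

Lemma rect_integral_vertex_fun (A B : set R) : unit_sub A -> unit_sub B ->
  rect_integral (step_fun (vertex_label n) vertex_fun) A B =
  \sum_u \sum_v n%:R ^- 2 * e u v * vertex_weight n A u * vertex_weight n B v.
Proof.
move=> uA uB; rewrite (rect_integral_step_label _ (unit_label_vertex n0))//.
rewrite big_ord_recr /= [X in _ + X]big1 ?addr0; last first.
  by move=> b _; rewrite vertex_fun_origin ?mul0r//; left.
apply: eq_bigr => u _.
rewrite big_ord_recr /= vertex_fun_origin ?mul0r ?addr0; last by right.
apply: eq_bigr => v _; rewrite vertex_funE /vertex_weight.
have n1 : n%:R != 0 :> R by rewrite pnatr_eq0 -lt0n.
by set a := mass _; set b := mass _; field.
Qed.

End vertex_functions.

Section graph_kernel_integral.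
Context {R : realType}.
Local Notation I01 := (`[0, 1]%classic : set R).
Local Notation I2 := (I01 `*` I01).
Variables (n : nat) (p : R) (G : sgraph n).
Hypothesis n0 : (0 < n)%N.

Let adj_value := vertex_fun (fun u v : 'I_n => p^-1 * (adj G u v)%:R).

Lemma graph_kernel_step z : I2 z ->
  graph_kernel p G z = step_fun (vertex_label n) adj_value z.
Proof.
case: z => x y [/= Ix Iy]; rewrite /graph_kernel /step_fun /=.
have P (i : 'I_n) w : I01 w -> (i%:R / n%:R < w <= i.+1%:R / n%:R) = (vertex_label n w == i).
  move=> Iw; apply/idP/eqP => [/(vertex_labelP _ (ltn_ord i))[]//|wi].
  exact/(vertex_labelP _ (ltn_ord i)).
have [x0|x0] := eqVneq x 0.
  rewrite /adj_value vertex_fun_origin; last by left; rewrite /vertex_label x0 eqxx.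
  case: existsP => // -[i /existsP[j /and3P[_ ]]].
  by rewrite P// /vertex_label x0 eqxx => /eqP ni; have := ltn_ord i; rewrite -ni ltnn.
have [y0|y0] := eqVneq y 0.
  rewrite /adj_value vertex_fun_origin; last by right; rewrite /vertex_label y0 eqxx.
  case: existsP => // -[i /existsP[j /and3P[_ _]]].
  by rewrite P// /vertex_label y0 eqxx => /eqP ni; have := ltn_ord j; rewrite -ni ltnn.
pose u := Ordinal (vertex_label_lt n0 Ix x0).
pose v := Ordinal (vertex_label_lt n0 Iy y0).
rewrite /adj_value (vertex_funE _ u v); case: existsP => [[i /existsP[j /and3P[aij]]]|].
  rewrite !P// => /eqP xi /eqP yj.
  have -> : u = i by exact: val_inj.
  have -> : v = j by exact: val_inj.
  by rewrite aij mulr1.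
case: (boolP (adj G u v)) => [auv|_ _]; last by rewrite mulr0.
by case; exists u; apply/existsP; exists v; rewrite auv !P//= !eqxx.
Qed.

Lemma bounded_meas_graph : bounded_meas (graph_kernel p G).
Proof.
apply: eq_bounded_meas (fun z zI => esym (graph_kernel_step zI)) _.
exact: bounded_meas_step_label (unit_label_vertex n0).
Qed.

(** The graph kernel is constant on products of vertex intervals, so a
rectangle [A x B] sees it through the weights of [A] and [B] only. *)
Lemma rect_integral_graph (A B : set R) : unit_sub A -> unit_sub B ->
  rect_integral (graph_kernel p G) A B =
  edge_form p G (vertex_weight n A) (vertex_weight n B).
Proof.
move=> uA uB.
rewrite (eq_rect_integral (fun z zAB => graph_kernel_step (rect_sub uA uB zAB))).
rewrite rect_integral_vertex_fun// /edge_form mulr_sumr; apply: eq_bigr => u _.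
rewrite mulr_sumr; apply: eq_bigr => v _; rewrite [in RHS]invfM /=.
set x := vertex_weight n A u; set y := vertex_weight n B v.
by move: (p^-1) (n%:R ^- 2) => q N; ring.
Qed.

End graph_kernel_integral.

(** * Permutations of the intervals of the vertices *)

Section cell_permutation.
Context {R : realType}.
Local Notation RR := (measurableTypeR R).
Local Notation mu := (@lebesgue_measure R).
Local Notation I01 := (`[0, 1]%classic : set R).

(** Uniqueness of a measure with prescribed values on half-open intervals. *)
Lemma lebesgue_measure_shift (c : R) (A : set RR) : measurable A ->
  mu ((fun x : RR => (x + c : RR)) @^-1` A) = mu A.
Proof.
have mc : measurable_fun [set: RR] (fun x : RR => (x + c : RR)).
  by apply: measurable_funD => //; exact: measurable_id.
move=> mA.
suff : pushforward mu (fun x : RR => (x + c : RR)) A = mu A by [].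
apply/esym/lebesgue_measure_unique => //= _ [[a b]] _ <-.
rewrite /pushforward (_ : _ @^-1` _ = `]a - c, b - c]%classic); last first.
  by apply/seteqP; split=> x /=; rewrite !in_itv/= ltrBlDr lerBrDr.
rewrite !lebesgue_measure_itv/= !lte_fin ltrD2r; case: ifP => // _.
by rewrite -!EFinB; congr (_%:E); ring.
Qed.

(** The piecewise translation that moves the interval of vertex [v] to that of
vertex [s v].  The origin, which belongs to no interval, stays fixed. *)
Definition cell_shift (n : nat) (s : nat -> nat) (x : R) : R :=
  if x == 0 then 0
  else x + ((s (vertex_label n x))%:R - (vertex_label n x)%:R) / n%:R.

Variables (n : nat) (s : nat -> nat).
Hypothesis n0 : (0 < n)%N.
Hypothesis s_lt : forall v, (v < n)%N -> (s v < n)%N.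

Lemma cell_shift_label x v : (v < n)%N -> I01 x -> vertex_label n x = v ->
  I01 (cell_shift n s x) /\ vertex_label n (cell_shift n s x) = s v.
Proof.
move=> vn Ix xv; have n0' : 0 < n%:R :> R by rewrite ltr0n.
have /andP[lt le] := (vertex_labelP x vn).1 (conj Ix xv).
have xgt0 : 0 < x by apply: le_lt_trans lt; rewrite divr_ge0.
apply/vertex_labelP; first exact: s_lt.
rewrite /cell_shift gt_eqF// xv mulrBl.
move: lt le; rewrite -[v.+1%:R]natr1 -[(s v).+1%:R]natr1 !mulrDl !mul1r; lra.
Qed.

End cell_permutation.

Section cell_permutation_preserves.
Context {R : realType}.
Local Notation RR := (measurableTypeR R).
Local Notation mu := (@lebesgue_measure R).
Local Notation I01 := (`[0, 1]%classic : set R).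
Variables (n : nat) (s r : nat -> nat).
Hypothesis n0 : (0 < n)%N.
Hypothesis s_lt : forall v, (v < n)%N -> (s v < n)%N.
Hypothesis r_lt : forall v, (v < n)%N -> (r v < n)%N.
Hypothesis sK : forall v, (v < n)%N -> r (s v) = v.
Hypothesis rK : forall v, (v < n)%N -> s (r v) = v.

Let n0' : 0 < n%:R :> R.
Proof. by rewrite ltr0n. Qed.

Lemma cell_shift0 q : cell_shift n q 0 = 0 :> R.
Proof. by rewrite /cell_shift eqxx. Qed.

Lemma cell_shift_I01 (q : nat -> nat) (x : R) : (forall v, (v < n)%N -> (q v < n)%N) ->
  I01 x -> I01 (cell_shift n q x).
Proof.
move=> qlt Ix; have [->|x0] := eqVneq x 0.
  by rewrite cell_shift0 /= in_itv/= lexx ler01.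
by have [] := cell_shift_label n0 qlt (vertex_label_lt n0 Ix x0) Ix erefl.
Qed.

Lemma cell_shiftK (q q' : nat -> nat) (x : R) :
  (forall v, (v < n)%N -> (q v < n)%N) -> (forall v, (v < n)%N -> q' (q v) = v) ->
  I01 x -> cell_shift n q' (cell_shift n q x) = x.
Proof.
move=> qlt qK Ix; have [->|x0] := eqVneq x 0; first by rewrite !cell_shift0.
have lt := vertex_label_lt n0 Ix x0.
have [Iy yl] := cell_shift_label n0 qlt lt Ix erefl.
have /andP[y0 _] := (vertex_labelP _ (qlt _ lt)).1 (conj Iy yl).
have {}y0 : cell_shift n q x != 0.
  by rewrite gt_eqF// (le_lt_trans _ y0)// divr_ge0.
rewrite [LHS]/cell_shift (negbTE y0) yl qK// /cell_shift (negbTE x0).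
by rewrite !mulrBl; ring.
Qed.

(** The intersection of the preimage of [A] with the interval of [v] is a
translate of the intersection of [A] with the interval of [s v], and [s]
permutes the intervals. *)
Lemma cell_shift_measure_preserving : measure_preserving_bij (@cell_shift R n s).
Proof.
have uI := @unit_sub_I01 R.
have ul := @unit_label_vertex R _ n0; have [ml ltl] := ul.
have mpart v : measurable (part (vertex_label n) v : set RR) := ml v.
have mshift : measurable_fun I01 (cell_shift n s : RR -> RR).
  apply: (@eq_measurable_fun _ _ RR RR I01 (fun x => \sum_(v < n)
    (x + ((s v)%:R - v%:R) / n%:R) * \1_(part (vertex_label n) v) x)).
    move=> x /[!inE] Ix; have [->|x0] := eqVneq x 0.
      rewrite cell_shift0 big1// => v _; rewrite indicE memNset ?mulr0// => -[_ /=].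
      by rewrite /vertex_label eqxx => nv; have := ltn_ord v; rewrite -nv ltnn.
    have lt := vertex_label_lt n0 Ix x0.
    rewrite (bigD1 (Ordinal lt))//= big1 ?addr0; last first.
      move=> v vx; rewrite indicE memNset ?mulr0// => -[_ /= xv].
      by move/eqP: vx; apply; apply: val_inj; rewrite /= xv.
    by rewrite indicE mem_set// mulr1 /cell_shift (negbTE x0).
  apply: measurable_sum => v; apply: measurable_funM; last exact: measurable_indic.
  by apply: measurable_funD => //; exact: measurable_id.
split=> //.
  split.
  - by move=> x Ix; exact: cell_shift_I01.
  - move=> x y /[!inE] Ix Iy xy.
    by rewrite -(cell_shiftK s_lt sK Ix) xy cell_shiftK.
  - move=> y Iy; exists (cell_shift n r y); first exact: cell_shift_I01.
    exact: cell_shiftK.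
move=> A mA AI; have uA : unit_sub A by [].
have uP : unit_sub (I01 `&` cell_shift n s @^-1` A).
  by split; [exact: mshift|move=> x []].
rewrite !mass_fin//; congr EFin.
rewrite (mass_parts ul uA) (mass_parts ul uP) !big_ord_recr /=.
rewrite !mass_vertex_origin// !addr0.
pose s' (v : 'I_n) := Ordinal (s_lt (ltn_ord v)).
have s'I : injective s'.
  by move=> u v /(congr1 (r \o val)) /=; rewrite !sK//; exact: val_inj.
rewrite [RHS](reindex_inj s'I) /=; apply: eq_bigr => v _.
pose c : R := ((s v)%:R - v%:R) / n%:R.
rewrite /mass -[in RHS](lebesgue_measure_shift c); last first.
  exact: (proj1 (unit_sub_vertex (s v) n0 uA)).
congr (fine (mu _)); apply/seteqP; split=> x /=.
  move=> [[Ix Ax] xv]; have [Iy yl] := cell_shift_label n0 s_lt (ltn_ord v) Ix xv.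
  have E : cell_shift n s x = x + c.
    rewrite /cell_shift xv; case: eqP xv => // x0.
    by rewrite /vertex_label x0 eqxx => nv; have := ltn_ord v; rewrite -nv ltnn.
  by rewrite -E.
move=> [Axc xcv]; have Ixc := AI _ Axc.
have /andP[lt le] := (vertex_labelP _ (s_lt (ltn_ord v))).1 (conj Ixc xcv).
have [Ix xv] : I01 x /\ vertex_label n x = v.
  apply/(vertex_labelP _ (ltn_ord v)).
  move: lt le; rewrite /c mulrBl -[v.+1%:R]natr1 -[(s v).+1%:R]natr1 !mulrDl !mul1r; lra.
split=> //; split=> //.
suff -> : cell_shift n s x = x + c by [].
rewrite /cell_shift xv; case: eqP xv => // x0.
by rewrite /vertex_label x0 eqxx => nv; have := ltn_ord v; rewrite -nv ltnn.
Qed.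

End cell_permutation_preserves.

(** * Partitions of the unit interval into parts of equal measure *)

Section equal_partitions.
Context {R : realType}.
Local Notation mu := (@lebesgue_measure R).
Local Notation mu2 := (mu \x mu)%E.
Local Notation I01 := (`[0, 1]%classic : set R).

Definition equal_label (alpha : R -> nat) k :=
  unit_label alpha k /\ forall i, (i < k)%N -> mass (part alpha i) = k%:R^-1.

Definition label_matrix (kappa : R * R -> R) k (alpha : R -> nat) : 'M[R]_k :=
  \matrix_(i, j) (k%:R ^+ 2 * rect_integral kappa (part alpha i) (part alpha j)).

(** A partition is recovered from the index of the part of each point; choice
assigns an index to the points outside the unit interval as well. *)
Lemma equal_partition_label k (P : 'I_k -> set R) : equal_partition P ->
  exists2 alpha, equal_label alpha k & forall i, P i = part alpha i.
Proof.
move=> [mP tP cP massP].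
have PI i x : P i x -> I01 x by move=> Pix; rewrite -cP; exists i.
have /choice[alpha alphaP] : forall x, exists a : nat, I01 x ->
    exists2 i : 'I_k, a = i & P i x.
  move=> x; have [Ix|nIx] := pselect (I01 x); last by exists 0%N.
  by move: Ix; rewrite -cP => -[i _ Pix]; exists i => _; exists i.
have Pp i : P i = part alpha i.
  apply/seteqP; split=> x.
    move=> Pix; split; first exact: PI Pix.
    have [j /= -> Pjx] := alphaP x (PI _ _ Pix).
    by have -> : j = i by apply: tP => //; exists x.
  move=> [Ix /= xi]; have [j aj Pjx] := alphaP x Ix.
  by have <- : j = i by apply: val_inj; rewrite /= -aj.
exists alpha => //; split; first split.
- move=> a; have [ak|ka] := ltnP a k.
    by have := mP (Ordinal ak); rewrite Pp.
  rewrite (_ : _ `&` _ = set0)//; apply/seteqP; split=> // x [Ix /= xa].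
  by have [i ai _] := alphaP x Ix; have := ltn_ord i; rewrite -ai xa ltnNge ka.
- by move=> x /alphaP[i -> _].
- by move=> i ik; have := massP (Ordinal ik); rewrite Pp /mass /= => ->.
Qed.

Lemma equal_label_partition k alpha : equal_label alpha k ->
  equal_partition (fun i : 'I_k => part alpha i).
Proof.
move=> [[ma ltk] massP]; split.
- by move=> i; exact: ma.
- by move=> i j _ _ [x [[_ /= xi] [_ /= xj]]]; apply: val_inj; rewrite /= -xi -xj.
- apply/seteqP; split=> [x [i _ []]//|x Ix].
  by exists (Ordinal (ltk x Ix)).
- move=> i; rewrite mass_fin ?massP//.
  exact: unit_sub_part (conj ma ltk).
Qed.

Lemma label_matrix_kernel_matrices kappa k alpha : equal_label alpha k ->
  kernel_matrices kappa k (label_matrix kappa k alpha).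
Proof.
move=> ea; apply: subset_closure.
by exists (fun i : 'I_k => part alpha i); first exact: equal_label_partition.
Qed.

Lemma kernel_matrices_approx kappa k (M : 'M[R]_k) (e : R) : 0 < e ->
  kernel_matrices kappa k M ->
  exists2 alpha, equal_label alpha k & `|M - label_matrix kappa k alpha| < e.
Proof.
move=> e0 /(_ _ (nbhs_ball_norm M (PosNum e0)))[_ [[P eP ->]]].
have [alpha ea Pp] := equal_partition_label eP.
move=> lt; exists alpha; first exact: ea.
suff -> : label_matrix kappa k alpha = \matrix_(i, j) (k%:R ^+ 2 *
  \int[mu2]_(z in P i `*` P j) kappa z) by exact: lt.
by apply/matrixP => i j; rewrite !mxE !Pp.
Qed.

Lemma equal_label_grid k : (0 < k)%N -> equal_label (grid_cell k) k.
Proof. by move=> k0; split=> [|i ik]; [exact: unit_label_grid|exact: mass_part_grid]. Qed.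

Section subdivide.
Variables (m k : nat) (y : nat -> nat -> R).
Hypothesis m0 : (0 < m)%N.
Hypothesis k0 : (0 < k)%N.
Hypothesis y0 : forall a i, 0 <= y a i.
Hypothesis y1 : forall a, (a < m)%N -> \sum_(i < k) y a i = 1.

Let Y a i : R := \sum_(l < i) y a l.

Let Y_homo a i j : (i <= j)%N -> Y a i <= Y a j.
Proof.
move=> ij; rewrite /Y -!(big_mkord xpredT (y a)) (big_cat_nat _ ij)//=.
by rewrite lerDl sumr_ge0.
Qed.

Let Y0 a : Y a 0 = 0.
Proof. by rewrite /Y big_ord0. Qed.

Let Yk a : (a < m)%N -> Y a k = 1.
Proof. exact: y1. Qed.

Let YS a i : Y a i.+1 = Y a i + y a i.
Proof. by rewrite /Y big_ord_recr. Qed.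

(** Cell [a] of the grid of [m] cells is cut into [k] consecutive intervals of
relative lengths [y a 0, ..., y a (k - 1)]; [m * x - grid_cell m x] is the
relative position of [x] in its cell. *)
Definition subdivision_label (x : R) : nat :=
  threshold_label (Y (grid_cell m x)) k (m%:R * x - (grid_cell m x)%:R).

Let m0' : 0 < m%:R :> R.
Proof. by rewrite ltr0n. Qed.

Lemma unit_label_subdivision : unit_label subdivision_label k.
Proof.
split=> [i|x _]; last exact: threshold_label_lt.
rewrite (_ : _ `&` _ = \bigcup_(a in [set a | (a < m)%N]) (part (grid_cell m) a `&`
    (fun x => threshold_label (Y a) k (m%:R * x - a%:R)) @^-1` [set i])); last first.
  apply/seteqP; split=> x.
    by move=> [Ix xi]; exists (grid_cell m x) => //=; exact: grid_cell_lt.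
  by move=> [a am [[Ix /= <-] xi]].
apply: bigcup_measurable => a _; apply: measurableI.
  exact: (unit_label_grid m0).1.
apply: measurable_threshold_label; first exact: Y_homo.
apply: measurable_funB; last exact: measurable_cst.
by apply: measurable_funM => //; exact: measurable_id.
Qed.

(** The set is an interval from [lo] to [hi], the endpoints of which may or
may not belong to it; it is squeezed between the open-closed and the closed
interval. *)
Lemma mass_subdivision a i : (a < m)%N -> (i < k)%N ->
  mass (part (grid_cell m) a `&` subdivision_label @^-1` [set i]) = y a i / m%:R.
Proof.
move=> am ik.
have Yi0 : 0 <= Y a i by rewrite -(Y0 a) Y_homo.
have Yi1 : Y a i.+1 <= 1 by rewrite -(Yk am) Y_homo.
pose lo := (a%:R + Y a i) / m%:R; pose hi := (a%:R + Y a i.+1) / m%:R.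
have lohi : lo <= hi by rewrite ler_pM2r ?invr_gt0// lerD2l Y_homo.
have len : hi - lo = y a i / m%:R by rewrite -mulrBl YS; congr (_ / _); ring.
pose X := part (grid_cell m) a `&` subdivision_label @^-1` [set i].
have uX : unit_sub X.
  have -> : X = part (grid_cell m) a `&` (I01 `&` subdivision_label @^-1` [set i]).
    by rewrite /X setIA [_ `&` I01]setIidl// => x [].
  apply: unit_sub_setIl; first exact: (unit_sub_part _ (unit_label_grid m0)).
  exact: unit_label_subdivision.1.
have lo0 : 0 <= lo by rewrite divr_ge0// addr_ge0.
have hi1 : hi <= 1.
  rewrite ler_pdivrMr// mul1r (le_trans (_ : _ <= a%:R + 1)) ?lerD2l//.
  by rewrite natr1 ler_nat.
have sub_unit b : unit_sub [set` Interval (BSide b lo) (BRight hi)].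
  split; first exact: measurable_itv.
  move=> x; rewrite /= !in_itv/= => /andP[lox xhi].
  rewrite (le_trans xhi hi1) andbT (le_trans lo0)//.
  by case: b lox => //= /ltW.
have sub1 : [set` Interval (BRight lo) (BRight hi)] `<=` X.
  move=> x xin; have Ix : I01 x by exact: (sub_unit false).2.
  move: xin; rewrite /= in_itv/= /lo /hi => /andP[lox xhi].
  rewrite ltr_pdivrMr// mulrC in lox; rewrite ler_pdivlMr// mulrC in xhi.
  have xa : grid_cell m x = a.
    apply: grid_cell_unique => //; apply/andP; split.
      by rewrite ltr_pdivrMr// mulrC (le_lt_trans _ lox)// lerDl.
    by rewrite ler_pdivlMr// mulrC (le_trans xhi)// -natr1 lerD2l.
  split; first by split.
  rewrite /= /subdivision_label xa; apply/eqP; rewrite eqn_leq; apply/andP; split.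
    have := ik; rewrite leq_eqVlt => /orP[/eqP ik'|ik'].
      by rewrite -ltnS ik'; exact: threshold_label_lt.
    rewrite -ltnS ltnNge le_threshold_label ?ik'//; last exact: Y_homo.
    by rewrite -leNgt lerBlDl.
  have [->//|i0] := posnP i.
  rewrite le_threshold_label ?i0//; last exact: Y_homo.
  by rewrite ltrBrDl.
have sub2 : X `<=` [set` Interval (BLeft lo) (BRight hi)].
  move=> x [[Ix /= xa] /=]; rewrite /subdivision_label xa => xi.
  have /andP[] := grid_cell_bounds m0 Ix.
  rewrite xa ler_pdivrMr// ler_pdivlMr// mulrC -natr1 => ax xa1.
  rewrite in_itv/= /lo /hi ler_pdivrMr// ler_pdivlMr// [x * _]mulrC.
  apply/andP; split; [rewrite -lerBrDl|rewrite -lerBlDl].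
    have [->|i0] := posnP i; first by rewrite Y0 subr_ge0.
    by rewrite ltW// -(le_threshold_label (N := k) (Y_homo a)) ?i0// xi.
  have := ik; rewrite leq_eqVlt => /orP[/eqP ->|ik'].
    by rewrite (Yk am) lerBlDl.
  by rewrite leNgt -(le_threshold_label (N := k) (Y_homo a)) ?ik'// xi ltnn.
apply/eqP; rewrite -len eq_le -{1}(mass_itv true false lohi) -(mass_itv false false lohi).
by apply/andP; split; apply: le_mass => //; exact: sub_unit.
Qed.

Lemma equal_label_subdivision :
  (forall i, (i < k)%N -> \sum_(a < m) y a i = m%:R / k%:R) ->
  equal_label subdivision_label k.
Proof.
move=> ysum; split=> [|i ik]; first exact: unit_label_subdivision.
have up := unit_sub_part i unit_label_subdivision.
rewrite (mass_parts (unit_label_grid m0) up).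
rewrite (eq_bigr (fun a : 'I_m => y a i / m%:R)) => [|a _]; last first.
  rewrite -mass_subdivision//; congr mass.
  by rewrite /part setIAC.
rewrite -mulr_suml ysum// mulrAC divff ?mul1r//.
by rewrite pnatr_eq0 -lt0n.
Qed.

End subdivide.

End equal_partitions.

(** * The partition metric *)

Section partition_metric.
Context {R : realType}.

(** The two inequalities of the Hausdorff distance being less than [e], stated
without infima and suprema. *)
Definition matrices_close k (e : R) (X Y : set 'M[R]_k) :=
  (forall M, X M -> exists2 M', Y M' & `|M - M'| < e) /\
  (forall M', Y M' -> exists2 M, X M & `|M - M'| < e).

(** The minimum with the side of the cube excludes the empty set, which is at
distance exactly [c] from every nonempty set. *)
Lemma d_H_close (c : {posnum R}) k (X Y : cube_compact c k) (e : R) :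
  Y !=set0 -> 0 < e -> d_H X Y < Num.min e c%:num -> matrices_close e X Y.
Proof.
move=> Y0 e0; rewrite lt_min; case: d_HP => [_ YE|_ _|_ YE|X0 _] /andP[lt_e lt_c].
- by move/set0P/eqP: Y0; rewrite YE.
- by rewrite ltxx in lt_c.
- by move/set0P/eqP: Y0; rewrite YE.
move: lt_e; rewrite gt_max => /andP[XY YX].
have near (A B : cube_compact c k) M : B !=set0 -> excess A B < e -> cc_set A M ->
    exists2 M', cc_set B M' & `|M - M'| < e.
  move=> B0 AB AM; have le := le_lt_trans (dist_to_excess B0 AM) AB.
  have hinf : has_inf [set `|M - y| | y in (B : set _)].
    by split; [case: B0 => y By; exists `|M - y|, y|exists 0 => _ [z _ <-]].
  have := inf_adherent (_ : 0 < e - dist_to M B) hinf.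
  rewrite subr_gt0 => /(_ le)[_ [y By <-]]; rewrite -/(dist_to M B).
  by rewrite [ltRHS]addrC subrK => lt; exists y.
split=> M AM; first exact: near XY AM.
by have [M' XM' lt] := near _ _ _ X0 YX AM; exists M' => //; rewrite distrC.
Qed.

Lemma close_d_H (c : {posnum R}) k (X Y : cube_compact c k) (e : R) :
  Y !=set0 -> matrices_close e X Y -> d_H X Y <= e.
Proof.
move=> Y0 [XY YX]; have X0 : X !=set0.
  by case: Y0 => M' /YX[M XM _]; exists M.
have near (A B : cube_compact c k) : A !=set0 ->
    (forall M, cc_set A M -> exists2 M', cc_set B M' & `|M - M'| < e) ->
    excess A B <= e.
  move=> [M0 AM0] AB; apply: ge_sup; first by exists (dist_to M0 B), M0.
  move=> _ [M AM <-]; have [M' BM' lt] := AB M AM.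
  exact: le_trans (dist_to_le _ BM') (ltW lt).
case: d_HP => [_ YE|XE _|_ YE|_ _].
- by move/set0P/eqP: Y0; rewrite YE.
- by move/set0P/eqP: X0; rewrite XE.
- by move/set0P/eqP: Y0; rewrite YE.
rewrite ge_max !near// => M /YX[M' XM' lt].
by exists M' => //; rewrite distrC.
Qed.

Variable C : nat -> {posnum R}.

Lemma cvg_profile (F : set_system nat) (FF : Filter F) (x : nat -> profile_space C)
    (y : profile_space C) :
  (x @ F --> y) <-> forall j, (fun n => x n j) @ F --> y j.
Proof.
split=> [xy j|xy].
  have := @proj_continuous nat (fun j => cube_compact (C j.+2) j.+2) j y.
  by move=> projj; exact: (cvg_comp _ _ xy projj).
apply/cvg_sup => j A [_ [[B oB <-] /= Byj] BA].
apply: filterS BA _; apply: xy.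
exact: open_nbhs_nbhs.
Qed.

(** A metric that generates the neighbourhoods of a topology has the same
convergent sequences.  It is applied to the product topology, in which
convergence is convergence of every coordinate. *)
Lemma cvg_metrizes (T : topologicalType) (d : T -> T -> R) (F : set_system nat)
    (FF : Filter F) (x : nat -> T) (y : T) : metrizes d ->
  (d (x n) y @[n --> F] --> (0 : R)) <-> (x @ F --> y).
Proof.
move=> [d0 dsym dtri dnbhs].
have dge0 u v : 0 <= d u v.
  have := dtri u v u; rewrite (d0 u u).2// [d v u]dsym; lra.
split=> [dxy A /dnbhs[e e0 eA]|xy].
  move/cvgrPdist_lt : dxy => /(_ e e0).
  apply: filterS => n /=; rewrite sub0r normrN ger0_norm// => lt.
  by apply: eA; rewrite /= dsym.
apply/cvgrPdist_lt => e e0.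
have : nbhs y [set z | d y z < e] by apply/dnbhs; exists e.
move=> /xy near; apply: (filterS (F := F) _ near) => n /=.
by rewrite sub0r normrN ger0_norm// dsym.
Qed.

Lemma d_part_cvg (d : profile_space C -> profile_space C -> R)
    (F : set_system nat) (FF : Filter F)
    (X : nat -> forall k, set 'M[R]_k) (Y : forall k, set 'M[R]_k) :
  metrizes d ->
  (forall k, (2 <= k)%N -> \forall n \near F,
     compact (X n k) /\ X n k `<=` cube (C k)%:num k) ->
  (forall k, (2 <= k)%N -> compact (Y k) /\ Y k `<=` cube (C k)%:num k) ->
  (forall k, (2 <= k)%N -> Y k !=set0) ->
  (d_part d (X n) Y @[n --> F] --> (0 : R)) <->
  (forall k (e : R), (2 <= k)%N -> 0 < e -> \forall n \near F,
     matrices_close e (X n k) (Y k)).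
Proof.
move=> dm cX cY Y0.
rewrite /d_part (cvg_metrizes FF (fun n => profile C (X n)) (profile C Y) dm).
rewrite cvg_profile.
have YK j : profile C Y j = Y j.+2 :> set _.
  by have [cYj sYj] := cY j.+2 isT; exact: to_cube_compactK.
have XK j : \forall n \near F, profile C (X n) j = X n j.+2 :> set _.
  by apply: filterS (cX j.+2 isT) => n [cXj sXj]; exact: to_cube_compactK.
have Yj0 j : profile C Y j !=set0 by rewrite YK; exact: Y0.
split=> [cv [|[|j]] e // _ e0|cl j].
  have m0 : 0 < Num.min e (C j.+2)%:num by rewrite lt_min e0 /=.
  have near := cv j _ (nbhsx_ballx (profile C Y j) _ m0).
  apply: filterS2 (XK j) near => n XnE.
  rewrite ballEmdist /= => lt; rewrite -YK -XnE; apply: d_H_close => //.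
  by rewrite d_H_sym.
move=> A /nbhs_ballP[e /= e0 eA].
have := cl j.+2 (e / 2) isT (divr_gt0 e0 (ltr0n R 2)).
apply: filterS2 (XK j) => n XnE; rewrite -YK -XnE => close; apply: eA.
rewrite ballEmdist /=.
apply: le_lt_trans (_ : e / 2 < e); last by lra.
rewrite (_ : mdist _ _ = d_H (profile C Y j) (profile C (X n) j))//.
by rewrite d_H_sym; exact: close_d_H close.
Qed.

End partition_metric.

(** * Transfer of partitions along a cut-norm approximation *)

Section pullback.
Context {R : realType}.
Local Notation I01 := (`[0, 1]%classic : set R).
Variable tau : R -> R.
Hypothesis mp : measure_preserving_bij tau.

Lemma unit_sub_pullback (A : set R) : unit_sub A -> unit_sub (I01 `&` tau @^-1` A).
Proof.
move=> [mA AI]; split; last by move=> x [].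
by case: mp => _ mt _; apply: mt => //; exact: measurable_I01.
Qed.

Lemma mass_pullback (A : set R) : unit_sub A -> mass (I01 `&` tau @^-1` A) = mass A.
Proof. by move=> [mA AI]; rewrite /mass; case: mp => _ _ ->. Qed.

Lemma part_comp (alpha : R -> nat) a :
  part (alpha \o tau) a = I01 `&` tau @^-1` (part alpha a).
Proof.
apply/seteqP; split=> x [Ix /=]; last by move=> [].
by move=> xa; split=> //; split=> //; exact: tau_I01.
Qed.

Lemma unit_label_comp alpha N : unit_label alpha N -> unit_label (alpha \o tau) N.
Proof.
move=> ul; have [ma ltN] := ul; split=> [a|x Ix]; last first.
  by apply: ltN; exact: tau_I01.
have := part_comp alpha a; rewrite /part => ->.
by case: (unit_sub_pullback (unit_sub_part a ul)).
Qed.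

Lemma equal_label_comp alpha k : equal_label alpha k -> equal_label (alpha \o tau) k.
Proof.
move=> [ul massE]; split=> [|i ik]; first exact: unit_label_comp.
by rewrite part_comp mass_pullback ?massE//; exact: unit_sub_part ul.
Qed.

(** As [tau] preserves the measure, pulling back two labellings keeps all the
masses of their common refinement. *)
Lemma mass_part_comp alpha beta N M a b : unit_label alpha N -> unit_label beta M ->
  mass (part (alpha \o tau) a `&` (beta \o tau) @^-1` [set b]) =
  mass (part alpha a `&` beta @^-1` [set b]).
Proof.
move=> ua ub; rewrite -(mass_pullback (A := part alpha a `&` beta @^-1` [set b])).
  by rewrite part_comp -setIA.
have -> : part alpha a `&` beta @^-1` [set b] =
    part alpha a `&` (I01 `&` beta @^-1` [set b]).
  by rewrite setIA [_ `&` I01]setIidl// => x [].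
exact: unit_sub_setIl (unit_sub_part a ua) (ub.1 b).
Qed.

End pullback.

Section cells_of_vertex_sets.
Context {R : realType}.

(** The set of vertices [U] as a subset of the unit interval. *)
Definition vertex_region n (U : {set 'I_n}) : set R :=
  \bigcup_(v in [set v | v \in U]) part (vertex_label n) v.

Lemma unit_sub_vertex_region n (U : {set 'I_n}) : (0 < n)%N ->
  unit_sub (vertex_region U).
Proof.
move=> n0; split; last by move=> x [v _ []].
apply: fin_bigcup_measurable; first exact: finite_finset.
by move=> v _; exact: (unit_label_vertex n0).1.
Qed.

Lemma vertex_region_cell n (U : {set 'I_n}) (v : 'I_n) :
  vertex_region U `&` vertex_label n @^-1` [set val v] =
  if v \in U then part (vertex_label n) v else set0.
Proof.
apply/seteqP; split=> x.
  move=> [[u /= uU [Ix /= xu]] /= xv].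
  have -> : v = u by apply: val_inj; rewrite /= -xv xu.
  by rewrite uU.
by case: ifP => // vU xv; split; [exists v|case: xv].
Qed.

Lemma vertex_weight_region n (U : {set 'I_n}) (v : 'I_n) : (0 < n)%N ->
  vertex_weight n (vertex_region U) v = set_ind U v.
Proof.
move=> n0; rewrite /vertex_weight vertex_region_cell /set_ind.
case: (v \in U); last by rewrite mass0 mulr0.
by rewrite mass_part_vertex// divff// pnatr_eq0 -lt0n.
Qed.

End cells_of_vertex_sets.

Section kernel_facts.
Context {R : realType}.
Local Notation I01 := (`[0, 1]%classic : set R).
Local Notation I2 := (I01 `*` I01).

Lemma bounded_kernel_meas (kappa : R * R -> R) : bounded_kernel kappa ->
  [/\ bounded_meas kappa, forall z, I2 z -> 0 <= kappa z &
      exists2 B, 0 <= B & forall z, I2 z -> kappa z <= B].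
Proof.
move=> [[mk _ k0] [B kB]]; split.
- split=> //; exists B => -[x y] [Ix Iy] /=.
  by rewrite ger0_norm ?k0// kB.
- by move=> [x y] [Ix Iy]; exact: k0.
- exists `|B| => // -[x y] [Ix Iy].
  by rewrite (le_trans (kB x y Ix Iy))// ler_norm.
Qed.

Lemma rect_integral_bounds (h : R * R -> R) (B : R) (X Y : set R) :
  unit_sub X -> unit_sub Y -> bounded_meas h ->
  (forall z, I2 z -> 0 <= h z) -> (forall z, I2 z -> h z <= B) ->
  0 <= rect_integral h X Y <= B * (mass X * mass Y).
Proof.
move=> uX uY bh h0 hB; rewrite -rect_integral_cst//; apply/andP; split.
  by apply: Rintegral_ge0 => z zXY; apply: h0; exact: rect_sub zXY.
apply: le_rect_integral => //; first exact: bounded_meas_cst.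
by move=> z zXY; apply: hB; exact: rect_sub zXY.
Qed.

Lemma grid_average_bounds (kappa : R * R -> R) B m a b : bounded_meas kappa ->
  (forall z, I2 z -> 0 <= kappa z) -> (forall z, I2 z -> kappa z <= B) ->
  (a < m)%N -> (b < m)%N -> 0 <= grid_average kappa m a b <= B.
Proof.
move=> bk k0 kB am bm; have m0 : (0 < m)%N by exact: leq_trans am.
have ul := @unit_label_grid R _ m0.
have := rect_integral_bounds (unit_sub_part a ul) (unit_sub_part b ul) bk k0 kB.
rewrite !mass_part_grid// => /andP[r0 rB].
have m2 : 0 < m%:R ^+ 2 :> R by rewrite exprn_gt0// ltr0n.
rewrite /grid_average mulr_ge0 ?(ltW m2)//= -ler_pdivlMl//.
by rewrite -exprVn expr2 mulrC.
Qed.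

End kernel_facts.

Section transfer.
Context {R : realType}.
Local Notation I01 := (`[0, 1]%classic : set R).

(** The integral of the step kernel with values [c] over [A x B], as a
function of the masses [x], [z] of [A] and [B] in the cells. *)
Definition step_form (m : nat) (c : nat -> nat -> R) (x z : nat -> R) : R :=
  \sum_(a < m) \sum_(b < m) c a b * (x a * z b).

Lemma step_form_perturb m (c : nat -> nat -> R) (B t r : R) (x z x' z' : nat -> R) :
  0 <= r -> 0 <= t ->
  (forall a b, (a < m)%N -> (b < m)%N -> 0 <= c a b <= B) ->
  (forall a, (a < m)%N -> `|x' a - x a| <= t) ->
  (forall a, (a < m)%N -> `|z' a - z a| <= t) ->
  (forall a, (a < m)%N -> `|x' a| <= r) -> (forall a, (a < m)%N -> `|z a| <= r) ->
  `|step_form m c x' z' - step_form m c x z| <= m%:R ^+ 2 * (2 * B * r * t).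
Proof.
move=> r0 t0 c0B xt zt xr zr; rewrite /step_form -sumrB.
apply: (le_trans (ler_norm_sum _ _ _)).
apply: (@le_trans _ _ (\sum_(a < m) \sum_(b < m) (2 * B * r * t))); last first.
  by rewrite !sumr_const !card_ord -mulrnA -[leLHS]mulr_natl natrM expr2.
apply: ler_sum => a _; rewrite -sumrB; apply: (le_trans (ler_norm_sum _ _ _)).
apply: ler_sum => b _; have /andP[c0 cB] := c0B a b (ltn_ord a) (ltn_ord b).
have -> : c a b * (x' a * z' b) - c a b * (x a * z b) =
    c a b * (x' a * (z' b - z b) + (x' a - x a) * z b) by ring.
rewrite normrM ger0_norm// -!mulrA mulrCA; apply: ler_pM => //.
apply: (le_trans (ler_normD _ _)); rewrite !normrM mulr2n mulrDl mul1r.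
by apply: lerD; [|rewrite mulrC]; apply: ler_pM; rewrite ?xr ?zt ?xt ?zr.
Qed.

Lemma rect_integral_step_form m (c : nat -> nat -> R) gamma (A B : set R) :
  unit_label gamma m -> unit_sub A -> unit_sub B ->
  rect_integral (step_fun gamma c) A B = step_form m c
    (fun a => mass (A `&` gamma @^-1` [set a]))
    (fun a => mass (B `&` gamma @^-1` [set a])).
Proof. exact: rect_integral_step_label. Qed.

Lemma rect_integral_approx (h g : R * R -> R) (e : R) A B :
  bounded_meas h -> bounded_meas g -> l1_norm (fun z => h z - g z) <= e ->
  unit_sub A -> unit_sub B ->
  `|rect_integral h A B - rect_integral g A B| <= e.
Proof.
move=> bh bg le uA uB; rewrite -rect_integralB//.
by apply: le_trans le; apply: rect_integral_le_l1 => //; exact: bounded_measB.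
Qed.

Variables (kappa : R * R -> R) (m : nat) (c : nat -> nat -> R) (B eps : R).
Hypothesis bk : bounded_meas kappa.
Hypothesis m0 : (0 < m)%N.
Hypothesis cB : forall a b, (a < m)%N -> (b < m)%N -> 0 <= c a b <= B.
Hypothesis kc : l1_norm (fun z => kappa z - step_fun (grid_cell m) c z) <= eps.

Let bW : bounded_meas (step_fun (grid_cell m) c).
Proof. exact: bounded_meas_step_grid. Qed.

Lemma rearranged_step_approx tau A A' : measure_preserving_bij tau ->
  unit_sub A -> unit_sub A' ->
  `|rect_integral (rearrange kappa tau) A A' - step_form m c
      (fun a => mass (A `&` (grid_cell m \o tau) @^-1` [set a]))
      (fun a => mass (A' `&` (grid_cell m \o tau) @^-1` [set a]))| <= eps.
Proof.
move=> mp uA uA'.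
have ug := unit_label_comp mp (unit_label_grid m0).
rewrite -(rect_integral_step_form c ug)//.
apply: rect_integral_approx => //.
- exact: bounded_meas_rearrange.
- exact: bounded_meas_step_label ug.
- rewrite (_ : (fun z => _) =
    rearrange (fun z => kappa z - step_fun (grid_cell m) c z) tau)//.
  by rewrite (l1_norm_rearrange mp)//; exact: bounded_measB.
Qed.

Lemma step_approx A A' : unit_sub A -> unit_sub A' ->
  `|rect_integral kappa A A' - step_form m c
      (fun a => mass (A `&` grid_cell m @^-1` [set a]))
      (fun a => mass (A' `&` grid_cell m @^-1` [set a]))| <= eps.
Proof.
move=> uA uA'; rewrite -(rect_integral_step_form c (unit_label_grid m0))//.
exact: rect_integral_approx.
Qed.

Variables (n : nat) (p : R) (G : sgraph n) (tau : R -> R) (e : R).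
Hypothesis n0 : (0 < n)%N.
Hypothesis mp : measure_preserving_bij tau.
Hypothesis cut : forall A A', unit_sub A -> unit_sub A' ->
  `|rect_integral (graph_kernel p G) A A' -
    rect_integral (rearrange kappa tau) A A'| <= e.

Let n0' : 0 < n%:R :> R.
Proof. by rewrite ltr0n. Qed.

(** The part [i] pulled back along [tau] gives vertex [u] the share of its
interval that lies in it.  The matrix does not change under the pull-back as
far as the step kernel is concerned, because the masses in the cells do
not. *)
Lemma kernel_partition_to_graph k alpha : (0 < k)%N -> equal_label alpha k ->
  exists x : 'I_n -> 'I_k -> R, [/\ fractional x,
    forall i, \sum_u x u i = n%:R / k%:R &
    forall i j, `|edge_form p G (x^~ i) (x^~ j) -
      rect_integral kappa (part alpha i) (part alpha j)| <= e + 2 * eps].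
Proof.
move=> k0 ea; have [ua massa] := ea.
have eat := equal_label_comp mp ea; have [uat massat] := eat.
have up i := unit_sub_part i uat; have upa i := unit_sub_part i ua.
have ug := unit_label_grid (R := R) m0.
exists (fun u i => vertex_weight n (part (alpha \o tau) i) u); split.
- move=> u; split=> [i|].
    by have /andP[] := vertex_weight01 (ltn_ord u) (up i).
  rewrite /vertex_weight -mulr_sumr.
  have uv := unit_sub_part u (unit_label_vertex (R := R) n0).
  have := mass_parts uat uv; rewrite mass_part_vertex// => E.
  under eq_bigr => i _.
    rewrite (_ : _ `&` _ = part (vertex_label n) u `&` (alpha \o tau) @^-1` [set val i]).
      over.
    by rewrite /part setIAC.
  by rewrite -E divff// gt_eqF.
- by move=> i; rewrite sum_vertex_weight// massat.
move=> i j; rewrite -rect_integral_graph//.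
have h1 := cut (up i) (up j).
have h2 := rearranged_step_approx mp (up i) (up j).
have h3 := step_approx (upa i) (upa j).
have E l : (fun a => mass (part (alpha \o tau) l `&` (grid_cell m \o tau) @^-1` [set a])) =
    (fun a => mass (part alpha l `&` grid_cell m @^-1` [set a])).
  by apply/funext => a; exact: mass_part_comp mp _ _ _ _ _ _ ua ug.
rewrite !E in h2.
move: h1 h2 h3; set r1 := rect_integral _ _ _; set r2 := rect_integral _ _ _.
set r3 := step_form _ _ _ _; set r4 := rect_integral _ _ _.
by rewrite !ler_norml => /andP[? ?] /andP[? ?] /andP[? ?]; apply/andP; split; lra.
Qed.

(** The classes of [b], as subsets of the unit interval, occupy a fraction [y
i a] of each cell [a] pulled back along [tau].  Subdividing the cells
themselves in these proportions would give parts of measure [|P_i| / n] rather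
than [1 / k].  So the proportions are first mixed as [(1 - t) y i a + rho i]:
for [t = k / n] the corrections [rho i] that make the parts equal are
nonnegative, and they sum to [t] in each cell. *)
Lemma graph_partition_to_kernel k (b : 'I_n -> 'I_k) : (0 < k)%N -> (k <= n)%N ->
  balanced_label b ->
  exists2 alpha, equal_label alpha k & forall i j : 'I_k,
    `|edge_form p G (set_ind (label_class b i)) (set_ind (label_class b j)) -
      rect_integral kappa (part alpha i) (part alpha j)|
      <= e + 2 * eps + 2 * B * (k%:R / n%:R).
Proof.
move=> k0 kn bal; have k0' : 0 < k%:R :> R by rewrite ltr0n.
have m0' : 0 < m%:R :> R by rewrite ltr0n.
pose gamma := grid_cell m \o tau.
have ug := unit_label_grid (R := R) m0.
have ugt : unit_label gamma m := unit_label_comp mp ug.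
have uv := unit_label_vertex (R := R) n0.
pose A (i : 'I_k) : set R := vertex_region (label_class b i).
have uA i : unit_sub (A i) by exact: unit_sub_vertex_region.
pose t : R := k%:R / n%:R.
have t0 : 0 <= t by rewrite divr_ge0.
have t1 : t <= 1 by rewrite ler_pdivrMr// mul1r ler_nat.
pose y (i : 'I_k) a : R := m%:R * mass (A i `&` gamma @^-1` [set a]).
have ugc i a : unit_sub (A i `&` gamma @^-1` [set a]).
  have -> : A i `&` gamma @^-1` [set a] = A i `&` (I01 `&` gamma @^-1` [set a]).
    by rewrite setIA (setIidl (uA i).2).
  exact: unit_sub_setIl (uA i) (ugt.1 a).
have y0 i a : 0 <= y i a by rewrite mulr_ge0// mass_ge0.
have massg a : (a < m)%N -> mass (part gamma a) = m%:R^-1.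
  by move=> am; rewrite part_comp// mass_pullback ?mass_part_grid//; exact: unit_sub_part ug.
have ysum a : (a < m)%N -> \sum_i y i a = 1.
  move=> am; rewrite -mulr_sumr.
  have -> : \sum_i mass (A i `&` gamma @^-1` [set a]) = mass (part gamma a).
    rewrite (mass_parts uv (unit_sub_part a ugt)) big_ord_recr /=.
    rewrite mass_vertex_origin//; last exact: unit_sub_part ugt.
    rewrite addr0 (partition_big b xpredT)//=; apply: eq_bigr => i _.
    rewrite (mass_parts uv (ugc i a)) big_ord_recr /= mass_vertex_origin// addr0.
    rewrite [RHS]big_mkcond /=; apply: eq_bigr => v _.
    rewrite setIAC [A i `&` _]vertex_region_cell inE; case: (b v == i).
      by congr mass; rewrite /part setIAC.
    by rewrite set0I mass0.
  by rewrite massg// divff// gt_eqF.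
pose w (i : 'I_k) : R := #|label_class b i|%:R / n%:R.
have massA i : mass (A i) = w i.
  apply: (mulfI (_ : n%:R != 0)); first by rewrite gt_eqF.
  rewrite -sum_vertex_weight// /w mulrC divfK ?gt_eqF//.
  under eq_bigr do rewrite vertex_weight_region//.
  rewrite -sum1_card natr_sum [RHS]big_mkcond /=; apply: eq_bigr => v _.
  by rewrite /set_ind; case: (v \in _).
have ycol i : \sum_(a < m) y i a = m%:R * w i.
  by rewrite -mulr_sumr -massA (mass_parts ugt (uA i)).
have wsum : \sum_i w i = 1.
  by rewrite -mulr_suml -natr_sum sum_card_label divff// gt_eqF.
have wle i : (1 - t) * w i <= k%:R^-1.
  have := balanced_label_card (R := R) i n0 bal; rewrite -/(w i).
  rewrite ler_norml => /andP[_]; rewrite lerBlDr => wi.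
  apply: (@le_trans _ _ ((1 - t) * (n%:R^-1 + k%:R^-1))).
    by rewrite ler_wpM2l// subr_ge0.
  have : t * k%:R^-1 = n%:R^-1 by rewrite /t mulrAC divff ?mul1r// gt_eqF.
  have : 0 <= t * n%:R^-1 by rewrite mulr_ge0// invr_ge0.
  lra.
pose rho i := k%:R^-1 - (1 - t) * w i.
have rho0 i : 0 <= rho i by rewrite subr_ge0.
have rhosum : \sum_i rho i = t.
  rewrite /rho sumrB -mulr_sumr wsum sumr_const card_ord -[X in X - _]mulr_natr.
  by rewrite mulVf ?gt_eqF//; ring.
pose ext (f : 'I_k -> nat -> R) a (i : nat) : R :=
  if insub i is Some i' then f i' a else 0.
pose y' i a := (1 - t) * y i a + rho i.
have extE f a (i : 'I_k) : ext f a i = f i a by rewrite /ext valK.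
have y'0 i a : 0 <= y' i a by rewrite addr_ge0// mulr_ge0// subr_ge0.
pose z := ext y'.
have z0 a i : 0 <= z a i by rewrite /z /ext; case: insub.
have z1 a : (a < m)%N -> \sum_(i < k) z a i = 1.
  move=> am; under eq_bigr do rewrite /z extE.
  by rewrite big_split /= -mulr_sumr ysum// rhosum; ring.
have zcol i : (i < k)%N -> \sum_(a < m) z a i = m%:R / k%:R.
  move=> ik; under eq_bigr do rewrite /z (extE y' _ (Ordinal ik)).
  rewrite big_split /= -mulr_sumr ycol sumr_const card_ord -[X in _ + X]mulr_natl /rho.
  by ring.
pose alpha := subdivision_label m k z.
exists alpha; first exact: equal_label_subdivision.
move=> i j.
have ua : unit_label alpha k by exact: unit_label_subdivision.
have h1 := cut (uA i) (uA j).
have h2 := rearranged_step_approx mp (uA i) (uA j).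
have h3 := step_approx (unit_sub_part i ua) (unit_sub_part j ua).
have -> : edge_form p G (set_ind (label_class b i)) (set_ind (label_class b j)) =
    rect_integral (graph_kernel p G) (A i) (A j).
  rewrite rect_integral_graph//; congr (edge_form _ _ _ _);
    by apply/funext => v; rewrite vertex_weight_region.
have zmass a (l : 'I_k) : (a < m)%N ->
    mass (part alpha l `&` grid_cell m @^-1` [set a]) = y' l a / m%:R.
  move=> am; rewrite -(extE y') -/z -(mass_subdivision m0 k0 z0 z1 am (ltn_ord l)).
  by congr mass; rewrite /part setIAC.
have y1 l a : (a < m)%N -> y l a <= 1.
  by move=> am; rewrite -(ysum a am) (bigD1 l)//= lerDl sumr_ge0.
have y'1 l a : (a < m)%N -> y' l a <= 1.
  move=> am; rewrite -(z1 a am) -(extE y' a l) -/z (bigD1 l)//= lerDl.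
  by rewrite sumr_ge0.
have rhot l : rho l <= t by rewrite -rhosum (bigD1 l)//= lerDl sumr_ge0.
have B0 : 0 <= B by have /andP[/le_trans] := cB m0 m0; apply.
have dev (l : 'I_k) a : (a < m)%N -> `|mass (part alpha l `&` grid_cell m @^-1` [set a]) -
    mass (A l `&` gamma @^-1` [set a])| <= t / m%:R.
  move=> am; rewrite zmass// (_ : mass (A l `&` _) = y l a / m%:R); last first.
    by rewrite /y mulrAC divff ?mul1r// gt_eqF.
  rewrite -mulrBl normrM [X in _ * X]ger0_norm ?invr_ge0// ler_pM2r ?invr_gt0//.
  rewrite /y' ler_norml.
  have := rho0 l; have := rhot l; have := mulr_ge0 t0 (y0 l a).
  have := ler_wpM2l t0 (y1 l a am); rewrite mulr1.
  by move=> ? ? ? ?; apply/andP; split; lra.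
have h4 : `|step_form m c
      (fun a => mass (part alpha i `&` grid_cell m @^-1` [set a]))
      (fun a => mass (part alpha j `&` grid_cell m @^-1` [set a])) -
    step_form m c (fun a => mass (A i `&` gamma @^-1` [set a]))
      (fun a => mass (A j `&` gamma @^-1` [set a]))| <= 2 * B * t.
  apply: (le_trans (step_form_perturb (B := B) (t := t / m%:R) (r := m%:R^-1) _ _ cB _ _ _ _)).
  - by rewrite invr_ge0.
  - by rewrite divr_ge0.
  - by move=> a am; exact: dev.
  - by move=> a am; exact: dev.
  - move=> a am; rewrite zmass// ger0_norm ?divr_ge0//.
    by rewrite -[leRHS]mul1r ler_wpM2r ?invr_ge0// y'1.
  - move=> a am; rewrite ger0_norm ?mass_ge0// -(massg a am).
    apply: le_mass => //; first exact: unit_sub_part ugt.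
    by move=> x [Ax gx]; split=> //; exact: (uA j).2.
  rewrite expr2; have -> : m%:R * m%:R * (2 * B * m%:R^-1 * (t / m%:R)) =
    2 * B * t * (m%:R * m%:R^-1) * (m%:R * m%:R^-1) :> R by ring.
  by rewrite divff ?gt_eqF// !mulr1.
rewrite -/t; move: h1 h2 h3 h4.
set r1 := rect_integral _ _ _; set r2 := rect_integral _ _ _.
set r3 := step_form _ _ _ _; set r4 := rect_integral _ _ _; set r5 := step_form _ _ _ _.
by rewrite !ler_norml => /andP[? ?] /andP[? ?] /andP[? ?] /andP[? ?]; apply/andP; split; lra.
Qed.

End transfer.

(** * Test values of labelled functions *)

Section blocks.
Local Open Scope set_scope.
Local Open Scope nat_scope.

(** Sort the vertices by label and cut the order into [K] blocks.  A block
with two labels contains the start of a class, so at most one block per label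
is bad; [U] is the union of the bad blocks. *)
Lemma refining_blocks n L K (lam : 'I_n -> 'I_L) : 0 < K -> K <= n ->
  exists (b : 'I_n -> 'I_K) (U : {set 'I_n}),
  [/\ @balanced_label n K b, #|U| <= L * (n %/ K).+1 &
      forall u v, u \notin U -> b u = b v -> lam u = lam v].
Proof.
move=> K0 Kn; have n0 : 0 < n by exact: leq_trans Kn.
have [s [sI sb]] := sorting_perm lam.
pose b v := Ordinal (block_lt (s v) K0).
(* The block in which the class [l] starts. *)
pose blk (l : 'I_L) := class_start lam l * K %/ n.
pose U := \bigcup_(l : 'I_L) [set v | b v == blk l :> nat].
exists b, U; split; first exact: block_label_balanced.
  apply: (@leq_trans (\sum_(l < L) (n %/ K).+1)); last first.
    by rewrite sum_nat_const card_ord.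
  apply: (@leq_trans (\sum_(l < L) #|[set v | b v == blk l :> nat]|)).
    rewrite /U; elim/big_rec2: _ => [|l x y _ xy]; first by rewrite cards0.
    by rewrite (leq_trans (leq_card_setU _ _))// leq_add2l.
  apply: leq_sum => l _; have [lK|Kl] := ltnP (blk l) K; last first.
    rewrite (_ : #|_| = 0)//; apply: eq_card0 => v; rewrite !inE.
    by apply/eqP => bv; have := ltn_ord (b v); rewrite bv ltnNge Kl.
  rewrite -(card_imset _ sI); apply: leq_trans (card_block_le K0 n0 lK).
  apply/subset_leq_card/fintype.subsetP => _ /imsetP[v + ->].
  by rewrite !inE.
have lt_case u v : b u = b v -> lam u < lam v -> u \in U.
  move=> buv uv; apply/bigcupP; exists (lam v) => //; rewrite inE /blk /=.
  have /andP[_ su] := class_start_sorted sI sb u.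
  have /andP[sv _] := class_start_sorted sI sb v.
  have mono : class_start lam (lam u).+1 <= class_start lam (lam v).
    apply/subset_leq_card/fintype.subsetP => x; rewrite !inE ltnS => /leq_ltn_trans.
    exact.
  rewrite eqn_leq; apply/andP; split.
    by apply: leq_div2r; rewrite leq_mul2r (leq_trans (ltnW su) mono) orbT.
  rewrite -[leqRHS]/(b u : nat) buv /=.
  by apply: leq_div2r; rewrite leq_mul2r sv orbT.
move=> u v uU buv; apply/eqP; apply: contraT => /eqP uv.
have [lt|gt|/val_inj//] := ltngtP (lam u) (lam v).
  by rewrite (lt_case _ _ buv lt) in uU.
have := lt_case _ _ (esym buv) gt => /bigcupP[l _]; rewrite inE -buv => bl.
suff : u \in U by rewrite (negbTE uU).
apply/bigcupP; exists l => //; rewrite inE; exact: bl.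
Qed.

End blocks.

Section test_functions.
Local Open Scope set_scope.
Local Open Scope ring_scope.
Context {R : realType}.
Variables (n : nat) (p : R) (G : sgraph n).
Hypothesis n0 : (0 < n)%N.
Hypothesis p0 : 0 < p.
Implicit Types f g : 'I_n -> 'I_n -> R.

Let n0' : 0 < n%:R :> R.
Proof. by rewrite ltr0n. Qed.

(** The pairing of [f] with the kernel of the graph, where [f] is seen as a
kernel constant on pairs of vertex intervals; [pair_mean] is its integral. *)
Definition edge_mean f : R :=
  \sum_u \sum_v ((p * n%:R ^+ 2)^-1 * (adj G u v)%:R) * f u v.

Definition pair_mean f : R := \sum_u \sum_v n%:R ^- 2 * f u v.

(** With [W] the kernel of the graph this is [2 <f, W> - |f|^2], or [|W|^2 -
|W - f|^2].  The first form avoids the term [|W|^2], which can be of order [1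
/ p] and need not be bounded. *)
Definition test_value f : R := 2 * edge_mean f - pair_mean (fun u v => f u v ^+ 2).

Lemma edge_form_mean x y : edge_form p G x y = edge_mean (fun u v => x u * y v).
Proof.
rewrite /edge_form /edge_mean mulr_sumr; apply: eq_bigr => u _.
by rewrite mulr_sumr; apply: eq_bigr => v _; exact: mulrA.
Qed.

Lemma edge_meanD f g : edge_mean (fun u v => f u v + g u v) = edge_mean f + edge_mean g.
Proof.
rewrite /edge_mean -big_split /=; apply: eq_bigr => u _; rewrite -big_split /=.
by apply: eq_bigr => v _; rewrite mulrDr.
Qed.

Lemma edge_meanZ a f : edge_mean (fun u v => a * f u v) = a * edge_mean f.
Proof.
rewrite /edge_mean mulr_sumr; apply: eq_bigr => u _; rewrite mulr_sumr.
by apply: eq_bigr => v _; rewrite mulrCA.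
Qed.

Lemma pair_meanD f g : pair_mean (fun u v => f u v + g u v) = pair_mean f + pair_mean g.
Proof.
rewrite /pair_mean -big_split /=; apply: eq_bigr => u _; rewrite -big_split /=.
by apply: eq_bigr => v _; rewrite mulrDr.
Qed.

Lemma pair_meanZ a f : pair_mean (fun u v => a * f u v) = a * pair_mean f.
Proof.
rewrite /pair_mean mulr_sumr; apply: eq_bigr => u _; rewrite mulr_sumr.
by apply: eq_bigr => v _; rewrite mulrCA.
Qed.

Lemma le_edge_mean f g : (forall u v, f u v <= g u v) -> edge_mean f <= edge_mean g.
Proof.
move=> fg; apply: ler_sum => u _; apply: ler_sum => v _; apply: ler_wpM2l => //.
by rewrite mulr_ge0// edge_form_coef_ge0.
Qed.

Lemma le_pair_mean f g : (forall u v, f u v <= g u v) -> pair_mean f <= pair_mean g.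
Proof.
by move=> fg; apply: ler_sum => u _; apply: ler_sum => v _; exact: ler_wpM2l.
Qed.

Lemma pair_mean_cst a : pair_mean (fun _ _ => a) = a.
Proof.
rewrite /pair_mean !sumr_const card_ord -mulrnA -[LHS]mulr_natr natrM -expr2.
by rewrite mulrAC mulVf ?mul1r// expf_neq0// gt_eqF.
Qed.

Lemma pair_mean_set (U : {set 'I_n}) :
  pair_mean (fun u _ => set_ind U u) = #|U|%:R / n%:R.
Proof.
have cancel (x : R) : (n%:R ^- 2 * x) *+ n = n%:R^-1 * x.
  by rewrite -[LHS]mulr_natr; field; rewrite gt_eqF.
rewrite /pair_mean; under eq_bigr do rewrite sumr_const card_ord cancel.
rewrite -mulr_sumr mulrC; congr (_ / _).
rewrite -sum1_card natr_sum [RHS]big_mkcond /=; apply: eq_bigr => u _.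
by rewrite /set_ind; case: (u \in U).
Qed.

Lemma pair_mean_tr f : pair_mean (fun u v => f v u) = pair_mean f.
Proof. by rewrite /pair_mean exchange_big. Qed.

Lemma edge_mean_sum (I : finType) (h : I -> 'I_n -> 'I_n -> R) :
  edge_mean (fun u v => \sum_i h i u v) = \sum_i edge_mean (h i).
Proof.
rewrite /edge_mean [RHS]exchange_big /=; apply: eq_bigr => u _.
by rewrite [RHS]exchange_big /=; apply: eq_bigr => v _; rewrite mulr_sumr.
Qed.

Lemma pair_mean_sum (I : finType) (h : I -> 'I_n -> 'I_n -> R) :
  pair_mean (fun u v => \sum_i h i u v) = \sum_i pair_mean (h i).
Proof.
rewrite /pair_mean [RHS]exchange_big /=; apply: eq_bigr => u _.
by rewrite [RHS]exchange_big /=; apply: eq_bigr => v _; rewrite mulr_sumr.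
Qed.

Lemma label_fun_sum k (b : 'I_n -> 'I_k) (g : 'I_k -> 'I_k -> R) :
  (fun u v => g (b u) (b v)) = (fun u v => \sum_(ij : 'I_k * 'I_k) g ij.1 ij.2 *
    (set_ind (label_class b ij.1) u * set_ind (label_class b ij.2) v)).
Proof.
apply/funext => u; apply/funext => v.
rewrite (bigD1 (b u, b v))//= big1 ?addr0.
  by rewrite /set_ind !inE !eqxx !mulr1.
move=> [i j] /= ij; rewrite /set_ind !inE.
case: eqP => [ui|_]; last by rewrite mul0r mulr0.
case: eqP => [vj|_]; last by rewrite !mulr0.
by rewrite -ui -vj eqxx in ij.
Qed.

Lemma edge_mean_labels k (b : 'I_n -> 'I_k) (g : 'I_k -> 'I_k -> R) :
  edge_mean (fun u v => g (b u) (b v)) = \sum_i \sum_j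
    g i j * edge_form p G (set_ind (label_class b i)) (set_ind (label_class b j)).
Proof.
rewrite label_fun_sum edge_mean_sum [RHS]pair_bigA /=; apply: eq_bigr => -[i j] _ /=.
by rewrite edge_meanZ edge_form_mean.
Qed.

Lemma pair_mean_rect (A B : {set 'I_n}) :
  pair_mean (fun u v => set_ind A u * set_ind B v) =
  (#|A|%:R / n%:R) * (#|B|%:R / n%:R).
Proof.
have card (X : {set 'I_n}) : #|X|%:R = \sum_u set_ind X u :> R.
  rewrite -sum1_card natr_sum [LHS]big_mkcond /=; apply: eq_bigr => u _.
  by rewrite /set_ind; case: (u \in _).
rewrite !card mulrACA -invfM -expr2 mulrC big_distrlr /= mulr_sumr.
by apply: eq_bigr => u _; rewrite mulr_sumr.
Qed.

Lemma pair_mean_labels k (b : 'I_n -> 'I_k) (g : 'I_k -> 'I_k -> R) :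
  pair_mean (fun u v => g (b u) (b v)) = \sum_i \sum_j
    g i j * ((#|label_class b i|%:R / n%:R) * (#|label_class b j|%:R / n%:R)).
Proof.
rewrite label_fun_sum pair_mean_sum [RHS]pair_bigA /=; apply: eq_bigr => -[i j] _ /=.
by rewrite pair_meanZ pair_mean_rect.
Qed.

(** A pair on which [f] and [g] differ meets [U].  The edges at [U] bound the
change of [edge_mean], the size of [U] that of the square norm. *)
Lemma test_value_perturb f g (F : R) (U : {set 'I_n}) : 0 <= F ->
  (forall u v, `|f u v| <= F) -> (forall u v, `|g u v| <= F) ->
  (forall u v, u \notin U -> v \notin U -> f u v = g u v) ->
  test_value f <= test_value g +
    8 * F * edge_form p G (set_ind U) (fun=> 1) + 2 * F ^+ 2 * (#|U|%:R / n%:R).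
Proof.
move=> F0 fF gF fg.
have ind0 u : 0 <= set_ind U u :> R by have /andP[] := set_ind01 U u (R := R).
have bad u v : f u v = g u v \/ 1 <= set_ind U u + set_ind U v :> R.
  have [uU|uU] := boolP (u \in U).
    by right; rewrite {1}/set_ind uU lerDl.
  have [vU|vU] := boolP (v \in U); last by left; exact: fg.
  by right; rewrite {2}/set_ind vU lerDr.
have h1 : edge_mean f - edge_mean g <= 4 * F * edge_form p G (set_ind U) (fun=> 1).
  have -> : 4 * F * edge_form p G (set_ind U) (fun=> 1) =
      edge_mean (fun u v => 2 * F * (set_ind U u * 1 + 1 * set_ind U v)).
    rewrite edge_meanZ edge_meanD -!edge_form_mean [edge_form p G (fun=> 1) _]edge_form_sym.
    by ring.
  rewrite lerBlDr -edge_meanD; apply: le_edge_mean => u v.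
  rewrite mulr1 mul1r; case: (bad u v) => [->|ge1].
    by rewrite lerDr mulr_ge0 ?addr_ge0// mulr_ge0.
  have := fF u v; have := gF u v; rewrite !ler_norml => /andP[g1 _] /andP[_ f2].
  have := ler_wpM2l (mulr_ge0 (ler0n R 2) F0) ge1; lra.
have h2 : pair_mean (fun u v => g u v ^+ 2) - pair_mean (fun u v => f u v ^+ 2) <=
    2 * F ^+ 2 * (#|U|%:R / n%:R).
  have -> : 2 * F ^+ 2 * (#|U|%:R / n%:R) =
      pair_mean (fun u v => F ^+ 2 * (set_ind U u + set_ind U v)).
    rewrite pair_meanZ pair_meanD (pair_mean_tr (fun u v => set_ind U u)).
    by rewrite pair_mean_set; ring.
  rewrite lerBlDr -pair_meanD; apply: le_pair_mean => u v.
  case: (bad u v) => [->|ge1].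
    by rewrite lerDr mulr_ge0 ?addr_ge0// exprn_ge0.
  have gF2 : g u v ^+ 2 <= F ^+ 2.
    by rewrite -[leLHS]real_normK ?num_real// lerXn2r ?nnegrE.
  have := ler_wpM2l (exprn_ge0 2 F0) ge1; have := sqr_ge0 (f u v); lra.
rewrite /test_value; lra.
Qed.

(** Indicators are equal to their squares. *)
Lemma test_value_add_rect f (A B : {set 'I_n}) (t : R) :
  test_value (fun u v => f u v + t * (set_ind A u * set_ind B v)) =
  test_value f + 2 * t * (edge_form p G (set_ind A) (set_ind B) -
    pair_mean (fun u v => f u v * (set_ind A u * set_ind B v)))
  - t ^+ 2 * pair_mean (fun u v => set_ind A u * set_ind B v).
Proof.
have ind2 (X : {set 'I_n}) u : set_ind X u * set_ind X u = set_ind X u :> R.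
  by rewrite /set_ind; case: (u \in X); rewrite ?mulr1 ?mulr0.
rewrite /test_value edge_meanD edge_meanZ -edge_form_mean.
have -> : (fun u v => (f u v + t * (set_ind A u * set_ind B v)) ^+ 2) =
    (fun u v => f u v ^+ 2 + ((2 * t) * (f u v * (set_ind A u * set_ind B v)) +
       t ^+ 2 * (set_ind A u * set_ind B v))).
  apply/funext => u; apply/funext => v.
  have : set_ind A u * set_ind B v * (set_ind A u * set_ind B v) =
      set_ind A u * set_ind B v :> R by rewrite mulrACA !ind2.
  by set w := _ * set_ind B v => w2; rewrite -[w in t ^+ 2 * w]w2; ring.
by rewrite !pair_meanD !pair_meanZ; ring.
Qed.

End test_functions.

(** * Energy of partitions and cut deviation *)

Section energy.
Context {R : realType}.

(** The variance of [x] under the weights [w] is nonnegative. *)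
Lemma weighted_square_le (I : finType) (w x : I -> R) :
  (forall i, 0 <= w i) -> \sum_i w i = 1 ->
  (\sum_i w i * x i) ^+ 2 <= \sum_i w i * x i ^+ 2.
Proof.
move=> w0 w1; set N := \sum_i w i * x i.
have : 0 <= \sum_i w i * (x i - N) ^+ 2.
  by apply: sumr_ge0 => i _; rewrite mulr_ge0// sqr_ge0.
have -> : \sum_i w i * (x i - N) ^+ 2 = \sum_i w i * x i ^+ 2 - N ^+ 2.
  rewrite (eq_bigr (fun i => w i * x i ^+ 2 + (- (2 * N)) * (w i * x i) + N ^+ 2 * w i)).
    by rewrite !big_split /= -!mulr_sumr w1 -/N; ring.
  by move=> i _; ring.
by rewrite subr_ge0.
Qed.

Lemma product_weights_close k (w v : 'I_k -> R) :
  (forall i, 0 <= w i) -> (forall i, 0 <= v i) ->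
  \sum_i w i = 1 -> \sum_i v i = 1 ->
  \sum_i \sum_j `|w i * w j - v i * v j| <= 2 * \sum_i `|w i - v i|.
Proof.
move=> w0 v0 w1 v1.
apply: (@le_trans _ _ (\sum_i \sum_j (`|w i - v i| * w j + v i * `|w j - v j|))).
  apply: ler_sum => i _; apply: ler_sum => j _.
  have -> : w i * w j - v i * v j = (w i - v i) * w j + v i * (w j - v j) by ring.
  by rewrite (le_trans (ler_normD _ _))// !normrM (ger0_norm (w0 j)) (ger0_norm (v0 i)).
under eq_bigr do rewrite big_split /= -!mulr_sumr w1 mulr1.
by rewrite big_split /= -mulr_suml v1 mul1r mulr_natl mulr2n.
Qed.

(** If [kappa] were the step kernel [c], each entry of the matrix of [alpha]
would be an average of the values of [c], with weights given by the masses in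
the cells, and Jensen would give the bound with [eps = 0], the weights of a
cell adding up to its mass.  Squaring entries in [[0, B]] multiplies the [L^1]
error by at most [2 B]. *)
Lemma label_energy_le (kappa : R * R -> R) m (c : nat -> nat -> R) (B eps : R) K alpha :
  (0 < m)%N -> (0 < K)%N -> equal_label alpha K -> bounded_meas kappa ->
  (forall a b, (a < m)%N -> (b < m)%N -> 0 <= c a b <= B) ->
  (forall i j : 'I_K, 0 <= label_matrix kappa K alpha i j <= B) ->
  l1_norm (fun z => kappa z - step_fun (grid_cell m) c z) <= eps ->
  \sum_(i < K) \sum_(j < K) K%:R ^- 2 * label_matrix kappa K alpha i j ^+ 2 <=
  \sum_(a < m) \sum_(b < m) m%:R ^- 2 * c a b ^+ 2 + 2 * B * eps.
Proof.
move=> m0 K0 [ua massa] bk cB MB kc.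
have K0' : 0 < K%:R :> R by rewrite ltr0n.
have m0' : 0 < m%:R :> R by rewrite ltr0n.
have ug := unit_label_grid (R := R) m0.
have bW := bounded_meas_step_grid c m0.
have up i := unit_sub_part i ua.
pose nu (i : 'I_K) (a : 'I_m) : R := mass (part alpha i `&` grid_cell m @^-1` [set val a]).
have nu0 i a : 0 <= nu i a by exact: mass_ge0.
have nu_sum i : \sum_a nu i a = K%:R^-1 by rewrite -(mass_parts ug (up i)) massa.
have nu_col a : \sum_i nu i a = m%:R^-1.
  rewrite -(mass_part_grid (ltn_ord a)) (mass_parts ua (unit_sub_part a ug)).
  by apply: eq_bigr => i _; rewrite /nu /part setIAC.
pose N (i j : 'I_K) : R := \sum_(ab : 'I_m * 'I_m)
  (K%:R ^+ 2 * (nu i ab.1 * nu j ab.2)) * c ab.1 ab.2.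
have wt i j : \sum_(ab : 'I_m * 'I_m) K%:R ^+ 2 * (nu i ab.1 * nu j ab.2) = 1.
  rewrite -mulr_sumr -(pair_bigA _ (fun a b => nu i a * nu j b)) /= -big_distrlr /=.
  by rewrite !nu_sum -expr2 exprVn divff// expf_neq0// gt_eqF.
have rectN (i j : 'I_K) : rect_integral (step_fun (grid_cell m) c) (part alpha i) (part alpha j) =
    K%:R ^- 2 * N i j.
  rewrite (rect_integral_step_label c ug)// pair_bigA /= mulr_sumr.
  apply: eq_bigr => -[a b] _ /=; rewrite -/(nu i a) -/(nu j b).
  rewrite -[K%:R ^+ 2 * _ * _]mulrA mulKf; first by rewrite mulrC.
  by rewrite expf_neq0// gt_eqF.
have NB i j : 0 <= N i j <= B.
  have w0 ab : 0 <= K%:R ^+ 2 * (nu i ab.1 * nu j ab.2).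
    by rewrite mulr_ge0 ?exprn_ge0// mulr_ge0.
  apply/andP; split.
    apply: sumr_ge0 => -[a b] _ /=; have /andP[c0 _] := cB a b (ltn_ord a) (ltn_ord b).
    exact: mulr_ge0 (w0 (a, b)) c0.
  rewrite -[leRHS]mul1r -(wt i j) mulr_suml; apply: ler_sum => -[a b] _ /=.
  by have /andP[_ c1] := cB a b (ltn_ord a) (ltn_ord b); exact: ler_wpM2l (w0 (a, b)) _ _ c1.
have B0 : 0 <= B by have /andP[/le_trans] := cB 0%N 0%N m0 m0; apply.
apply: (@le_trans _ _ (\sum_(i < K) \sum_(j < K) (K%:R ^- 2 * N i j ^+ 2 +
   2 * B * `|rect_integral (fun z => kappa z - step_fun (grid_cell m) c z)
              (part alpha i) (part alpha j)|))).
  apply: ler_sum => i _; apply: ler_sum => j _.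
  rewrite rect_integralB// rectN.
  have := MB i j; have := NB i j; rewrite mxE; set r := rect_integral _ _ _.
  move=> /andP[N0 N1] /andP[M0 M1].
  have -> : r - K%:R ^- 2 * N i j = K%:R ^- 2 * (K%:R ^+ 2 * r - N i j).
    by rewrite mulrBr mulKf// expf_neq0// gt_eqF.
  rewrite normrM (ger0_norm (_ : 0 <= K%:R ^- 2)) ?invr_ge0 ?exprn_ge0//.
  rewrite [2 * B * _]mulrCA -mulrDr.
  rewrite ler_wpM2l ?invr_ge0 ?exprn_ge0//.
  move: (K%:R ^+ 2 * r) M0 M1 => M M0 M1; move: (N i j) N0 N1 => x x0 x1.
  have : (M - x) * (M + x) <= `|M - x| * (2 * B).
    by rewrite (le_trans (ler_norm _))// normrM ler_wpM2l// ger0_norm; lra.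
  lra.
under eq_bigr do rewrite big_split /=.
rewrite big_split /=; apply: lerD; last first.
  under eq_bigr do rewrite -mulr_sumr.
  rewrite -mulr_sumr ler_wpM2l ?mulr_ge0//.
  exact: le_trans (sum_rect_integral_le_l1 ua (bounded_measB bk bW)) kc.
apply: (@le_trans _ _ (\sum_(i < K) \sum_(j < K) \sum_(ab : 'I_m * 'I_m)
    (nu i ab.1 * nu j ab.2) * c ab.1 ab.2 ^+ 2)).
  apply: ler_sum => i _; apply: ler_sum => j _.
  rewrite ler_pdivrMl ?exprn_gt0// mulr_sumr.
  under [leRHS]eq_bigr do rewrite mulrA.
  apply: weighted_square_le (wt i j) => ab.
  by rewrite mulr_ge0 ?exprn_ge0// mulr_ge0.
rewrite (eq_bigr (fun i => \sum_(ab : 'I_m * 'I_m) \sum_(j < K)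
    (nu i ab.1 * nu j ab.2) * c ab.1 ab.2 ^+ 2)); last first.
  by move=> i _; rewrite exchange_big.
rewrite exchange_big /= [leRHS]pair_bigA /=; apply: ler_sum => -[a b] _ /=.
rewrite (eq_bigr (fun i => nu i a * m%:R^-1 * c a b ^+ 2)); last first.
  by move=> i _; rewrite -mulr_suml -mulr_sumr nu_col.
by rewrite -mulr_suml -mulr_suml nu_col -expr2 exprVn.
Qed.

End energy.

Section cut_bound.
Local Open Scope set_scope.
Local Open Scope ring_scope.
Context {R : realType}.
Variables (n : nat) (p : R) (G : sgraph n) (m K : nat).
Variables (lam : 'I_n -> 'I_m) (b : 'I_n -> 'I_K).
Variables (c : 'I_m -> 'I_m -> R) (M : 'I_K -> 'I_K -> R) (B : R).
Variables (A A' U : {set 'I_n}) (delta eps eps' eta : R).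
Hypothesis n0 : (0 < n)%N.
Hypothesis p0 : 0 < p.
Hypothesis lam_bal : balanced_label lam.
Hypothesis b_bal : balanced_label b.
Hypothesis U_blocks : forall u v, u \notin U -> b u = b v ->
  [/\ lam u = lam v, (u \in A) = (v \in A) & (u \in A') = (v \in A')].
Hypothesis cB : forall i j, 0 <= c i j <= B.
Hypothesis MB : forall i j, 0 <= M i j <= B.
Hypothesis c_near : forall i j,
  `|density p G (label_class lam i) (label_class lam j) - c i j| <= eps.
Hypothesis M_near : forall i j,
  `|density p G (label_class b i) (label_class b j) - M i j| <= eps'.
Hypothesis energy_le : \sum_i \sum_j K%:R ^- 2 * M i j ^+ 2 <=
  \sum_i \sum_j m%:R ^- 2 * c i j ^+ 2 + eta.
Hypothesis eps'1 : eps' <= 1.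

Let n0' : 0 < n%:R :> R.
Proof. by rewrite ltr0n. Qed.

Let size_weight k (q : 'I_n -> 'I_k) i : R := #|label_class q i|%:R / n%:R.

Let size_weight_ge0 k (q : 'I_n -> 'I_k) i : 0 <= size_weight q i.
Proof. by rewrite divr_ge0. Qed.

Let size_weight_gt0 k (q : 'I_n -> 'I_k) i : balanced_label q -> 0 < size_weight q i.
Proof. by move=> [q0 _]; rewrite divr_gt0// ltr0n. Qed.

Let size_weight_sum k (q : 'I_n -> 'I_k) : \sum_i size_weight q i = 1.
Proof. by rewrite -mulr_suml -natr_sum sum_card_label divff// gt_eqF. Qed.

Let edge_form_density k (q : 'I_n -> 'I_k) i j : balanced_label q ->
  edge_form p G (set_ind (label_class q i)) (set_ind (label_class q j)) =
  density p G (label_class q i) (label_class q j) * (size_weight q i * size_weight q j).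
Proof.
move=> qb; rewrite density_edge_form// divfK//.
by rewrite mulf_neq0// gt_eqF// size_weight_gt0.
Qed.

(** The classes of a balanced labelling have relative sizes within [1 / n] of
[1 / k]. *)
Let equal_weights k (q : 'I_n -> 'I_k) (x : 'I_k -> 'I_k -> R) : balanced_label q ->
  (forall i j, 0 <= x i j <= B) ->
  `|\sum_i \sum_j x i j ^+ 2 * (size_weight q i * size_weight q j) -
    \sum_i \sum_j k%:R ^- 2 * x i j ^+ 2| <= 2 * B ^+ 2 * (k%:R / n%:R).
Proof.
move=> qb xB; have k0 : 0 < k%:R :> R.
  by rewrite ltr0n; case: (q (Ordinal n0)) => i; apply: leq_ltn_trans.
apply: (@le_trans _ _ (B ^+ 2 * \sum_i \sum_j
    `|size_weight q i * size_weight q j - k%:R^-1 * k%:R^-1|)).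
  rewrite -sumrB (le_trans (ler_norm_sum _ _ _))// mulr_sumr; apply: ler_sum => i _.
  rewrite -sumrB (le_trans (ler_norm_sum _ _ _))// mulr_sumr; apply: ler_sum => j _.
  have /andP[x0 xBij] := xB i j.
  rewrite -exprVn (expr2 k%:R^-1) [_ * x i j ^+ 2]mulrC -mulrBr normrM ler_wpM2r//.
  by rewrite ger0_norm ?sqr_ge0// lerXn2r ?nnegrE// (le_trans x0).
have -> : 2 * B ^+ 2 * (k%:R / n%:R) = B ^+ 2 * (2 * (k%:R / n%:R)) by ring.
apply: ler_wpM2l; first exact: sqr_ge0.
apply: (le_trans (product_weights_close _ _ _ _)) => //.
  by rewrite sumr_const card_ord -[LHS]mulr_natr mulVf// gt_eqF.
rewrite ler_wpM2l//.
apply: (@le_trans _ _ (\sum_(i < k) n%:R^-1)).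
  by apply: ler_sum => i _; exact: balanced_label_card.
by rewrite sumr_const card_ord -[leLHS]mulr_natl.
Qed.

Let clam u v : R := c (lam u) (lam v).

Let Delta : R := edge_form p G (set_ind A) (set_ind A') -
  pair_mean (fun u v => clam u v * (set_ind A u * set_ind A' v)).

Let energy : R := \sum_i \sum_j m%:R ^- 2 * c i j ^+ 2.

Let B0 : 0 <= B.
Proof.
have v := Ordinal n0.
by have /andP[/le_trans] := cB (lam v) (lam v); apply.
Qed.

(** The densities of the classes of [lam] are near [c], so the pairing of [c o
lam] with the graph is near the energy of [c], which is also the square norm
of [c o lam]. *)
Lemma test_value_labels_ge :
  energy - 2 * B ^+ 2 * (m%:R / n%:R) - 2 * B * eps <= test_value p G clam.
Proof.
have := equal_weights lam_bal cB; rewrite -/energy ler_norml => /andP[lo _].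
have eps0 : 0 <= eps by exact: le_trans (c_near (lam (Ordinal n0)) (lam (Ordinal n0))).
rewrite /test_value /clam (edge_mean_labels p G lam c).
rewrite (pair_mean_labels lam (fun i j => c i j ^+ 2)).
have : \sum_i \sum_j (c i j ^+ 2 - B * eps) * (size_weight lam i * size_weight lam j) <=
    \sum_i \sum_j c i j *
      edge_form p G (set_ind (label_class lam i)) (set_ind (label_class lam j)).
  apply: ler_sum => i _; apply: ler_sum => j _; rewrite edge_form_density// [leRHS]mulrA.
  apply: ler_wpM2r; first by rewrite mulr_ge0.
  have /andP[c0 cBij] := cB i j; have := c_near i j.
  rewrite ler_norml => /andP[near _].
  have := ler_wpM2l c0 near; have := ler_wpM2r eps0 cBij; nra.
have -> : \sum_i \sum_j (c i j ^+ 2 - B * eps) * (size_weight lam i * size_weight lam j) =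
    \sum_i \sum_j c i j ^+ 2 * (size_weight lam i * size_weight lam j) - B * eps.
  under eq_bigr do under eq_bigr do rewrite mulrBl.
  under eq_bigr do rewrite sumrB -!mulr_sumr size_weight_sum mulr1.
  by rewrite sumrB -mulr_sumr size_weight_sum mulr1.
move: lo; rewrite /size_weight; lra.
Qed.

(** For every pair of blocks, [2 f d - f^2 <= d^2] with [d] the density
between them; the densities are near [M], whose energy exceeds that of [c] by
at most [eta]. *)
Lemma test_value_block_le (f : 'I_K -> 'I_K -> R) :
  test_value p G (fun u v => f (b u) (b v)) <=
  energy + eta + 2 * B ^+ 2 * (K%:R / n%:R) + (2 * B + 1) * eps'.
Proof.
have := equal_weights b_bal MB; rewrite ler_norml => /andP[_ up].
have eps'0 : 0 <= eps' by exact: le_trans (M_near (b (Ordinal n0)) (b (Ordinal n0))).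
rewrite /test_value (edge_mean_labels p G b f).
rewrite (pair_mean_labels b (fun i j => f i j ^+ 2)) mulr_sumr -sumrB.
apply: (@le_trans _ _ (\sum_i \sum_j (M i j ^+ 2 + (2 * B + 1) * eps') *
    (size_weight b i * size_weight b j))).
  apply: ler_sum => i _; rewrite mulr_sumr -sumrB; apply: ler_sum => j _.
  rewrite edge_form_density//.
  have factor (t d w : R) : 2 * (t * (d * w)) - t ^+ 2 * w = (2 * (t * d) - t ^+ 2) * w.
    by ring.
  rewrite factor.
  apply: ler_wpM2r; first by rewrite mulr_ge0.
  have /andP[M0 M1] := MB i j; have := M_near i j.
  rewrite ler_norml => /andP[dl du]; set d := density _ _ _ _ in dl du *.
  have d0 : 0 <= d by rewrite divr_ge0// !mulr_ge0// ltW.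
  have : 0 <= (f i j - d) ^+ 2 by exact: sqr_ge0.
  have : d ^+ 2 <= (M i j + eps') ^+ 2 by rewrite lerXn2r ?nnegrE//; lra.
  have := ler_wpM2r eps'0 M1; have := ler_wpM2r eps'0 eps'1; nra.
under eq_bigr do under eq_bigr do rewrite mulrDl.
under eq_bigr do rewrite big_split /= -!mulr_sumr size_weight_sum mulr1.
rewrite big_split /= -mulr_sumr size_weight_sum mulr1.
move: energy_le; rewrite -/energy; lra.
Qed.

(** Adding [t 1_(A x A')] to [c o lam], with [|t| = delta] and [t] of the sign
of the deviation, raises the test value by at least [2 delta^2 - delta^2].
The result depends, off [U], on the blocks of [b] only, so
[test_value_block_le] bounds it. *)
Lemma cut_deviation_bound : 0 <= delta -> delta < `|Delta| ->
  delta ^+ 2 <= 2 * B * eps + 2 * B ^+ 2 * ((m%:R + K%:R) / n%:R) + eta +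
    (2 * B + 1) * eps' +
    8 * (B + delta) * edge_form p G (set_ind U) (fun=> 1) +
    2 * (B + delta) ^+ 2 * (#|U|%:R / n%:R).
Proof.
move=> d0 dD.
pose t := Num.sg Delta * delta.
have tD : t * Delta = delta * `|Delta|.
  by rewrite /t mulrAC -normrEsg mulrC.
have t2 : t ^+ 2 <= delta ^+ 2.
  rewrite /t exprMn -[leRHS]mul1r ler_wpM2r ?sqr_ge0// sqr_sg.
  by case: (Delta != 0); rewrite ?lexx ?ler01.
have tabs : `|t| <= delta.
  by rewrite -(@ler_pXn2r _ 2)// ?nnegrE// real_normK ?num_real.
pose f u v := clam u v + t * (set_ind A u * set_ind A' v).
have F0 : 0 <= B + delta by rewrite addr_ge0.
have fF u v : `|f u v| <= B + delta.
  rewrite (le_trans (ler_normD _ _))// lerD//.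
    by have /andP[c0 c1] := cB (lam u) (lam v); rewrite ger0_norm.
  rewrite normrM -[leRHS]mulr1 ler_pM// ger0_norm.
    rewrite -[leRHS]mul1r; have /andP[? ?] := set_ind01 (R := R) A u.
    by have /andP[? ?] := set_ind01 (R := R) A' v; exact: ler_pM.
  by rewrite /set_ind -natrM ler0n.
have /choice[rep repP] : forall i, exists v, b v = i.
  move=> i; have := b_bal.1 i; rewrite card_gt0 => /set0Pn[v].
  by rewrite inE => /eqP; exists v.
have f_rep u v : u \notin U -> v \notin U -> f u v = f (rep (b u)) (rep (b v)).
  move=> uU vU; rewrite /f /clam /set_ind.
  have [-> -> _] := U_blocks uU (esym (repP (b u))).
  by have [-> _ ->] := U_blocks vU (esym (repP (b v))).
have h1 := @test_value_perturb R n p G n0 p0 f (fun u v => f (rep (b u)) (rep (b v)))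
  (B + delta) U F0 fF (fun u v => fF _ _) f_rep.
have h2 := test_value_block_le (fun i j => f (rep i) (rep j)).
have h3 := test_value_labels_ge.
have := test_value_add_rect p G clam A A' t; rewrite -/Delta -/f -/(f _ _) => h4.
have pm : 0 <= (pair_mean (fun u v => set_ind A u * set_ind A' v) : R) <= 1.
  rewrite -(pair_mean_cst n0 (1 : R)); apply/andP; split.
    by rewrite pair_mean_rect mulr_ge0// divr_ge0.
  apply: le_pair_mean => u v; rewrite -[leRHS]mul1r.
  have /andP[? ?] := set_ind01 (R := R) A u.
  by have /andP[? ?] := set_ind01 (R := R) A' v; exact: ler_pM.
move: pm => /andP[pm0 pm1].
have h5 : t ^+ 2 * pair_mean (fun u v => set_ind A u * set_ind A' v) <= delta ^+ 2.
  by rewrite -[leRHS]mulr1 ler_pM// sqr_ge0.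
have h6 : delta * delta <= delta * `|Delta| by rewrite ler_wpM2l// ltW.
have h7 : test_value p G clam + 2 * (delta * `|Delta|) - delta ^+ 2 <= test_value p G f.
  by rewrite h4 -mulrA tD; lra.
move: h1 h2 h3 h6 h7; rewrite [(m%:R + _) / _]mulrDl expr2.
set e1 := edge_form _ _ _ _; set tv := test_value _ _ _; set tv2 := test_value _ _ _.
set tv3 := test_value _ _ _; lra.
Qed.

End cut_bound.

(** * The cut metric *)

Section cut_closeness.
Context {R : realType}.

(** The cut distance is at most [e], with the infimum over [tau] attained and
the integrals real-valued. *)
Definition cut_close n (p : R) (G : sgraph n) (kappa : R * R -> R) (e : R) :=
  exists2 tau, measure_preserving_bij tau &
  forall A A', unit_sub A -> unit_sub A' ->
    `|rect_integral (graph_kernel p G) A A' -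
      rect_integral (rearrange kappa tau) A A'| <= e.

Lemma d_cut_ge0 (h g : R * R -> R) : (0 <= d_cut h g)%E.
Proof.
apply: le_ereal_inf_tmp => _ [tau mp <-].
apply: (@le_trans _ _ (`|\int[(@lebesgue_measure R \x @lebesgue_measure R)%E]_(z in set0 `*` set0)
   (h z - rearrange g tau z)%:E|)%E); first exact: abse_ge0.
by apply: ereal_sup_ubound; exists set0, set0; split.
Qed.

Lemma cut_close_d_cut n (p : R) (G : sgraph n) kappa e : (0 < n)%N ->
  bounded_meas kappa -> cut_close p G kappa e ->
  (d_cut (graph_kernel p G) kappa <= e%:E)%E.
Proof.
move=> n0 bk [tau mp close].
apply: (@le_trans _ _ (cut_norm (fun z => graph_kernel p G z - rearrange kappa tau z))).
  by apply: ereal_inf_lbound; exists tau.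
have bg := bounded_meas_graph p G n0; have bt := bounded_meas_rearrange mp bk.
apply: cut_norm_le; first exact: bounded_measB.
by move=> A A' uA uA'; rewrite rect_integralB// close.
Qed.

Lemma d_cut_cut_close n (p : R) (G : sgraph n) kappa e : (0 < n)%N ->
  bounded_meas kappa -> (d_cut (graph_kernel p G) kappa < e%:E)%E ->
  cut_close p G kappa e.
Proof.
move=> n0 bk /ereal_inf_lt[_ [tau mp <-] lt]; exists tau => // A A' uA uA'.
have bg := bounded_meas_graph p G n0; have bt := bounded_meas_rearrange mp bk.
rewrite -rect_integralB// -lee_fin (le_trans _ (ltW lt))//.
apply: rect_integral_le_cut_norm => //; exact: bounded_measB.
Qed.

(** The infimum defining [d_cut] gives a bijection for every strictly larger
bound, which is enough for statements about all positive [e]. *)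
Lemma d_cut_cvg (S : set nat) (p : nat -> R) (G : forall n, sgraph n) kappa :
  bounded_meas kappa ->
  (d_cut (graph_kernel (p n) (G n)) kappa @[n --> within S \oo] --> (0 : \bar R)%E) <->
  (forall e, 0 < e -> \forall n \near within S \oo, cut_close (p n) (G n) kappa e).
Proof.
move=> bk; split=> [cv e e0|close].
  have e0' : (0 < e%:E)%E by rewrite lte_fin.
  have near : \forall n \near within S \oo,
    (d_cut (graph_kernel (p n) (G n)) kappa < e%:E)%E := cv _ (open_ereal_lt' e0').
  apply: filterS2 near (near_within_nat S 1) => n lt n0.
  exact: d_cut_cut_close lt.
have le e : 0 < e -> \forall n \near within S \oo,
    (d_cut (graph_kernel (p n) (G n)) kappa <= e%:E)%E.
  move=> e0; apply: filterS2 (close e e0) (near_within_nat S 1) => n cl n0.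
  exact: cut_close_d_cut.
apply/fine_cvgP; split.
  apply: filterS (le 1 ltr01) => n le1.
  by rewrite ge0_fin_numE ?d_cut_ge0// (le_lt_trans le1)// ltry.
apply/cvgrPdist_le => e e0; apply: filterS (le e e0) => n le_e /=.
rewrite sub0r normrN ger0_norm; last exact/fine_ge0/d_cut_ge0.
rewrite -lee_fin fineK// ge0_fin_numE ?d_cut_ge0//.
by rewrite (le_lt_trans le_e)// ltry.
Qed.

End cut_closeness.

Section cut_closeness_from_labels.
Context {R : realType}.
Local Notation I01 := (`[0, 1]%classic : set R).

(** A permutation of ['I_n] and its inverse as functions on [nat], the form in
which [cell_shift] uses them. *)
Lemma injective_ord_inverse n (s : 'I_n -> 'I_n) : injective s ->
  exists s' r : nat -> nat, [/\ forall u : 'I_n, s' u = s u,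
    forall v, (v < n)%N -> (s' v < n)%N, forall v, (v < n)%N -> (r v < n)%N,
    forall v, (v < n)%N -> r (s' v) = v & forall v, (v < n)%N -> s' (r v) = v].
Proof.
move=> sI; have [g gK Kg] : bijective s by exact: injF_bij.
pose ext (f : 'I_n -> 'I_n) (v : nat) : nat := if insub v is Some u then f u else v.
have extE f (u : 'I_n) : ext f u = f u by rewrite /ext valK.
exists (ext s), (ext g); split=> [u|v vn|v vn|v vn|v vn]; first exact: extE.
- by rewrite (extE _ (Ordinal vn)).
- by rewrite (extE _ (Ordinal vn)).
- by rewrite (extE _ (Ordinal vn)) extE gK.
- by rewrite (extE _ (Ordinal vn)) extE Kg.
Qed.

Variables (n : nat) (p : R) (G : sgraph n) (kappa : R * R -> R) (m : nat).
Variables (c : nat -> nat -> R) (B eps delta : R) (lam : 'I_n -> 'I_m).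
Hypothesis n0 : (0 < n)%N.
Hypothesis m0 : (0 < m)%N.
Hypothesis bk : bounded_meas kappa.
Hypothesis cB : forall a b, (a < m)%N -> (b < m)%N -> 0 <= c a b <= B.
Hypothesis kc : l1_norm (fun z => kappa z - step_fun (grid_cell m) c z) <= eps.
Hypothesis lam_bal : balanced_label lam.
Hypothesis cut : forall A A' : {set 'I_n},
  `|edge_form p G (set_ind A) (set_ind A') -
    pair_mean (fun u v => c (lam u) (lam v) * (set_ind A u * set_ind A' v))| <= delta.

Let n0' : 0 < n%:R :> R.
Proof. by rewrite ltr0n. Qed.

Let m0' : 0 < m%:R :> R.
Proof. by rewrite ltr0n. Qed.

Let clam := fun u v : 'I_n => c (lam u) (lam v).

(** The hypothesis on vertex sets, extended to the weights of arbitrary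
measurable sets by [bilinear_form_extreme]. *)
Lemma cut_weights (x y : 'I_n -> R) :
  (forall u, 0 <= x u <= 1) -> (forall u, 0 <= y u <= 1) ->
  `|edge_form p G x y - \sum_u \sum_v n%:R ^- 2 * clam u v * x u * y v| <= delta.
Proof.
move=> x01 y01.
pose a u v := (p * n%:R ^+ 2)^-1 * (adj G u v)%:R - n%:R ^- 2 * clam u v.
have split_sum (f g : 'I_n -> R) : \sum_u \sum_v a u v * f u * g v =
    edge_form p G f g - \sum_u \sum_v n%:R ^- 2 * clam u v * f u * g v.
  rewrite edge_form_mean /edge_mean -sumrB; apply: eq_bigr => u _.
  rewrite -sumrB; apply: eq_bigr => v _; rewrite /a.
  by move: (_^-1) (n%:R ^- 2) => q N; ring.
rewrite -split_sum; apply: bilinear_form_extreme => // A A'.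
apply: le_trans (cut A A'); rewrite le_eqVlt; apply/orP; left; apply/eqP.
congr `|_|.
transitivity (\sum_u \sum_v a u v * set_ind A u * set_ind A' v).
  rewrite [LHS]big_mkcond /=; apply: eq_bigr => u _; rewrite /set_ind.
  case: (u \in A); last by rewrite big1// => v _; rewrite mulr0 mul0r.
  rewrite [LHS]big_mkcond /=; apply: eq_bigr => v _.
  by rewrite mulr1; case: (v \in A'); rewrite ?mulr1 ?mulr0.
rewrite split_sum; congr (_ - _); apply: eq_bigr => u _; apply: eq_bigr => v _.
by rewrite -!mulrA.
Qed.

(** Let [s] sort the vertices by label.  Then [cell_shift n s] moves the
interval of a vertex [u] outside [off_boundary] into the grid cell [lam u], so
the rearranged step kernel and [c o lam] agree except on the few vertices in
[off_boundary]. *)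
Lemma labels_cut_close :
  cut_close p G kappa (delta + eps + 2 * B * ((m.+1 * (2 * m).+1)%:R / n%:R)).
Proof.
have B0 : 0 <= B by have /andP[/le_trans] := cB m0 m0; apply.
have [s [sI sb]] := sorting_perm lam.
have [s' [r [s'E s'lt rlt s'K rK]]] := injective_ord_inverse sI.
have mp := cell_shift_measure_preserving (R := R) n0 s'lt rlt s'K rK.
exists (cell_shift n s') => // X Y uX uY.
have near_class i :
    `|#|label_class lam i|%:R - n%:R / m%:R| <= m%:R / m%:R :> R.
  have -> : #|label_class lam i|%:R - n%:R / m%:R =
      n%:R * (#|label_class lam i|%:R / n%:R - m%:R^-1) :> R.
    by rewrite mulrBr [n%:R * (_ / n%:R)]mulrC divfK// gt_eqF.
  rewrite normrM (gtr0_norm n0') -ler_pdivlMl// divff ?gt_eqF// mulr1.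
  exact: balanced_label_card.
pose U := off_boundary lam s.
have U_le : (#|U| <= m.+1 * (2 * m).+1)%N.
  by apply: card_off_boundary => // l lm; have [] := class_start_near near_class m0 lm.
have uv := unit_label_vertex (R := R) n0.
pose W := step_fun (grid_cell m) c.
have bW : bounded_meas W by exact: bounded_meas_step_grid.
pose V := step_fun (vertex_label n) (vertex_fun clam).
have bV : bounded_meas V by exact: bounded_meas_step_label uv.
(* The label [n] of the origin counts as bad; it has mass zero. *)
pose bad (a : nat) : R := if insub a is Some u then set_ind U u else 1.
have bad0 a : 0 <= bad a.
  by rewrite /bad; case: insub => // u; have /andP[] := set_ind01 (R := R) U u.
have bWt := bounded_meas_rearrange mp bW.
have good x : I01 x -> bad (vertex_label n x) < 1 ->
    exists2 u : 'I_n, vertex_label n x = u & grid_cell m (cell_shift n s' x) = lam u.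
  move=> Ix; rewrite /bad; case: insubP => [u _ ux|_]; last by rewrite ltxx.
  rewrite /set_ind; case: (boolP (u \in U)) => [_|uU _]; first by rewrite ltxx.
  exists u => //; have [Iy yl] := cell_shift_label n0 s'lt (ltn_ord u) Ix (esym ux).
  have /andP[y1 y2] := (vertex_labelP _ (s'lt _ (ltn_ord u))).1 (conj Iy yl).
  move: uU; rewrite inE negbK => /andP[l1 l2].
  apply: grid_cell_unique => //; apply/andP; split.
    apply: le_lt_trans y1; rewrite s'E.
    by rewrite ler_pdivrMr// mulrAC ler_pdivlMr// -!natrM ler_nat.
  apply: (le_trans y2); rewrite s'E.
  by rewrite ler_pdivrMr// mulrAC ler_pdivlMr// -!natrM ler_nat.
have clamB u v : 0 <= clam u v <= B by exact: cB.
have vclamB a b : 0 <= vertex_fun clam a b <= B.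
  rewrite /vertex_fun; case: insub => [u|]; last by rewrite lexx B0.
  by case: insub => [v|]; rewrite ?lexx ?B0 ?clamB.
have l1WV : l1_norm (fun z => rearrange W (cell_shift n s') z - V z) <=
    2 * B * (#|U|%:R / n%:R).
  pose d (a b : nat) : R := B * (bad a + bad b).
  have -> : 2 * B * (#|U|%:R / n%:R) = rect_integral (step_fun (vertex_label n) d) I01 I01.
    rewrite (rect_integral_step_label d uv) ?unit_sub_I01//; try exact: unit_sub_I01.
    pose w a : R := mass (I01 `&` vertex_label n @^-1` [set a]).
    have w1 : \sum_(a < n.+1) w a = 1.
      by rewrite -(mass_parts uv (unit_sub_I01 (R := R))) mass_I01.
    have wn : w n = 0 by apply: mass_vertex_origin => //; exact: unit_sub_I01.
    have wU : \sum_(a < n.+1) bad a * w a = #|U|%:R / n%:R.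
      rewrite big_ord_recr /= wn mulr0 addr0 -sum1_card natr_sum mulr_suml.
      rewrite [RHS]big_mkcond /=; apply: eq_bigr => u _.
      rewrite /bad valK /w (mass_part_vertex (ltn_ord u)) /set_ind.
      by case: (u \in U); rewrite ?mul0r.
    rewrite (eq_bigr (fun a : 'I_n.+1 => B * (bad a * w a) + w a * (B * (#|U|%:R / n%:R)))).
      by rewrite big_split /= -mulr_suml w1 -mulr_sumr wU; ring.
    move=> a _; transitivity (\sum_(b < n.+1)
        ((B * bad a * w a) * w b + (B * w a) * (bad b * w b))).
      by apply: eq_bigr => b _; rewrite /d -/(w a) -/(w b); ring.
    by rewrite big_split /= -!mulr_sumr w1 wU; ring.
  apply: le_rect_integral; try exact: unit_sub_I01.
  - by apply: bounded_meas_norm; exact: bounded_measB.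
  - exact: bounded_meas_step_label uv.
  move=> [x y] [/= Ix Iy]; rewrite /V /step_fun /rearrange /W /step_fun /=.
  have cgB : 0 <= c (grid_cell m (cell_shift n s' x)) (grid_cell m (cell_shift n s' y)) <= B.
    by apply: cB; exact: grid_cell_lt.
  have dist : `|c (grid_cell m (cell_shift n s' x)) (grid_cell m (cell_shift n s' y)) -
      vertex_fun clam (vertex_label n x) (vertex_label n y)| <= B.
    have := vclamB (vertex_label n x) (vertex_label n y).
    by move: cgB; rewrite ler_norml; lra.
  rewrite /d; have [bx|bx] := leP 1 (bad (vertex_label n x)).
    by rewrite (le_trans dist)// ler_peMr// (le_trans bx)// lerDl.
  have [by_|by_] := leP 1 (bad (vertex_label n y)).
    by rewrite (le_trans dist)// ler_peMr// (le_trans by_)// lerDr.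
  have [u xu ->] := good x Ix bx; have [v yv ->] := good y Iy by_.
  by rewrite xu yv vertex_funE subrr normr0 mulr_ge0// addr_ge0.
have h1 : `|rect_integral (rearrange kappa (cell_shift n s')) X Y -
    rect_integral (rearrange W (cell_shift n s')) X Y| <= eps.
  apply: rect_integral_approx => //; first exact: bounded_meas_rearrange.
  rewrite (_ : (fun z => _) = rearrange (fun z => kappa z - W z) (cell_shift n s'))//.
  by rewrite (l1_norm_rearrange mp)//; exact: bounded_measB.
have h2 := rect_integral_approx bWt bV l1WV uX uY.
have h3 := cut_weights (fun u : 'I_n => vertex_weight01 (ltn_ord u) uX)
                       (fun u : 'I_n => vertex_weight01 (ltn_ord u) uY).
have h4 : 2 * B * (#|U|%:R / n%:R) <= 2 * B * ((m.+1 * (2 * m).+1)%:R / n%:R).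
  by rewrite ler_wpM2l ?mulr_ge0// ler_pM2r ?invr_gt0// ler_nat.
rewrite rect_integral_graph//.
rewrite (rect_integral_vertex_fun clam n0 uX uY) in h2.
move: h1 h2 h3; set r1 := rect_integral _ _ _; set r2 := rect_integral _ _ _.
set r3 := edge_form _ _ _ _; set r4 := \sum_u _.
by rewrite !ler_norml => /andP[? ?] /andP[? ?] /andP[? ?]; apply/andP; split; lra.
Qed.

End cut_closeness_from_labels.

(** * The two implications *)

Section matrix_norm.
Context {R : realType}.

Lemma matrix_dist_le k (M N : 'M[R]_k) (e : R) : 0 <= e ->
  (forall i j, `|M i j - N i j| <= e) -> `|M - N| <= e.
Proof.
move=> e0 le; rewrite [leLHS]/Num.norm/= mx_normrE.
by apply/bigmax_leP; split => // -[i j] _ /=; rewrite !mxE.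
Qed.

Lemma matrix_entry_le k (M N : 'M[R]_k) i j : `|M i j - N i j| <= `|M - N|.
Proof.
rewrite [leRHS]/Num.norm/= mx_normrE.
have := @le_bigmax _ R ('I_k * 'I_k)%type 0 (fun ij => `|(M - N) ij.1 ij.2|) (i, j).
by rewrite /= !mxE.
Qed.

End matrix_norm.

Section directions.
Context {R : realType}.
Local Notation I01 := (`[0, 1]%classic : set R).
Local Notation I2 := (I01 `*` I01).
Variables (S : set nat) (p : nat -> R) (G : forall n, sgraph n) (kappa : R * R -> R).
Hypothesis p_gt0 : forall n, S n -> 0 < p n.
Hypothesis np_infty : n%:R * p n @[n --> within S \oo] --> +oo.
Hypothesis bounded : bounded_density S p G.
Hypothesis kb : bounded_kernel kappa.

(** The entries are averages of [kappa]. *)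
Lemma label_matrix_bounds B k alpha (i j : 'I_k) : equal_label alpha k ->
  (forall z, I2 z -> kappa z <= B) -> 0 <= label_matrix kappa k alpha i j <= B.
Proof.
move=> [ua massa] kB; have [bk k0 _] := bounded_kernel_meas kb.
have := rect_integral_bounds (unit_sub_part i ua) (unit_sub_part j ua) bk k0 kB.
rewrite !massa// mxE => /andP[r0 rB].
have k2 : 0 < k%:R ^+ 2 :> R by rewrite exprn_gt0// ltr0n (leq_ltn_trans _ (ltn_ord i)).
by rewrite mulr_ge0 ?(ltW k2)//= -ler_pdivlMl// -exprVn expr2 mulrC.
Qed.

(** Matrix entries are [k^2] times integrals, so [q u = e / 32] makes room for
the errors of the cut distance, the step approximation and the rounding. *)
Lemma cut_close_matrices_close :
  (forall e, 0 < e -> \forall n \near within S \oo, cut_close (p n) (G n) kappa e) ->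
  forall k (e : R), (2 <= k)%N -> 0 < e -> \forall n \near within S \oo,
    matrices_close e (graph_matrices (p n) (G n) k) (kernel_matrices kappa k).
Proof.
move=> close k e k2 e0; have [bk k_ge0 [B B0 kB]] := bounded_kernel_meas kb.
have k0 : (0 < k)%N by exact: leq_trans k2.
have k0' : 0 < k%:R :> R by rewrite ltr0n.
pose q : R := k%:R ^+ 2; have q0 : 0 < q by rewrite exprn_gt0.
pose u := e / (32 * q); have u0 : 0 < u by rewrite divr_gt0// mulr_gt0.
have qu : q * u = e / 32 by rewrite /u; field; rewrite gt_eqF.
have [m m1 kc] := kernel_grid_approx bk k_ge0 u0.
have m0 : (0 < m)%N by exact: ltnW.
have cB a b : (a < m)%N -> (b < m)%N -> 0 <= grid_average kappa m a b <= B.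
  exact: grid_average_bounds.
have u20 : 0 < 2 * u by rewrite mulr_gt0.
have e16 : 0 < e / 16 by rewrite divr_gt0.
have near_dens := near_density_balanced p_gt0 bounded k0 e16.
have near_round := near_rounding_balanced p_gt0 np_infty bounded k0 u20.
have near_cut := close _ u20.
near=> n.
have kn : (k <= n)%N by near: n; exact: near_within_nat.
have n0 : (0 < n)%N by exact: leq_trans kn.
have n0' : 0 < n%:R :> R by rewrite ltr0n.
have Sn : S n by near: n; exact: near_within_mem.
have dens : forall b : 'I_n -> 'I_k, balanced_label b ->
  forall i j, `|density (p n) (G n) (label_class b i) (label_class b j) -
    q * edge_form (p n) (G n) (set_ind (label_class b i)) (set_ind (label_class b j))|
    <= e / 16 by near: n.
have round : forall x : 'I_n -> 'I_k -> R, fractional x ->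
  (forall i, \sum_u x u i = n%:R / k%:R) ->
  exists2 b : 'I_n -> 'I_k, balanced_label b & forall i j,
  `|edge_form (p n) (G n) (set_ind (label_class b i)) (set_ind (label_class b j))
    - edge_form (p n) (G n) (x^~ i) (x^~ j)| <= 2 * u by near: n.
have [tau mp cut] : cut_close (p n) (G n) kappa (2 * u) by near: n.
have small : q * (2 * B * (k%:R / n%:R)) <= e / 16.
  have -> : q * (2 * B * (k%:R / n%:R)) = (q * 2 * B * k%:R) / n%:R by ring.
  by rewrite ler_pdivrMr// -ler_pdivrMl//; near: n; exact: near_within_real.
have e2 : 0 < e / 2 by rewrite divr_gt0.
split=> [M /graph_matricesP[b bal ->]|M' /(kernel_matrices_approx e2)[alpha ea lt]].
  have [alpha ea le] := graph_partition_to_kernel bk m0 cB kc n0 mp cut k0 kn bal.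
  exists (label_matrix kappa k alpha); first exact: label_matrix_kernel_matrices.
  apply: (@le_lt_trans _ _ (e / 2)); last by lra.
  apply: matrix_dist_le => [|i j]; first by rewrite divr_ge0// ltW.
  rewrite !mxE -/q; have := dens b bal i j; have := ler_wpM2l (ltW q0) (le i j).
  rewrite -[X in X * `|_|]gtr0_norm// -normrM mulrBr !mulrDr.
  set d := density _ _ _ _; set x := q * edge_form _ _ _ _; set r := q * rect_integral _ _ _.
  rewrite !ler_norml => /andP[? ?] /andP[? ?]; apply/andP; split; lra.
have [x [fx xsum xe]] := kernel_partition_to_graph bk m0 kc n0 mp cut k0 ea.
have [b bal be] := round x fx xsum.
exists (\matrix_(i, j) density (p n) (G n) (label_class b i) (label_class b j)).
  by apply/graph_matricesP; exists b.
rewrite (splitr e); apply: (le_lt_trans (ler_distD (label_matrix kappa k alpha) _ _)).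
apply: ler_ltD; last by rewrite distrC.
apply: matrix_dist_le => [|i j]; first by rewrite divr_ge0// ltW.
rewrite !mxE -/q; have := dens b bal i j; have := ler_wpM2l (ltW q0) (be i j).
have := ler_wpM2l (ltW q0) (xe i j).
rewrite -[X in X * `|_|]gtr0_norm// -normrM mulrBr => h1.
rewrite -[X in X * `|_|]gtr0_norm// -normrM mulrBr; move: h1; rewrite mulrDr.
set d := density _ _ _ _; set y := q * edge_form _ _ (x^~ i) _.
set z := q * edge_form _ _ _ _; set r := q * rect_integral _ _ _.
rewrite !ler_norml => /andP[? ?] /andP[? ?] /andP[? ?]; apply/andP; split; lra.
Unshelve. all: by end_near. Qed.

(** The parameters are chosen in the order [delta], grid, number of blocks,
[n].  The number [K] of blocks depends on the number [L] of joint labels [(lam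
u, u \in A, u \in A')], which is fixed with the grid and does not depend on
[A] and [A'].  Each of the six terms of [cut_deviation_bound] is then at most
[delta^2 / 8]. *)
Lemma matrices_close_cut_close :
  (forall k (e : R), (2 <= k)%N -> 0 < e -> \forall n \near within S \oo,
    matrices_close e (graph_matrices (p n) (G n) k) (kernel_matrices kappa k)) ->
  forall e, 0 < e -> \forall n \near within S \oo, cut_close (p n) (G n) kappa e.
Proof.
move=> close e e0; have [bk k_ge0 [B B0 kB]] := bounded_kernel_meas kb.
pose delta := e / 4; have delta0 : 0 < delta by rewrite divr_gt0.
have d2 : 0 < delta ^+ 2 by rewrite exprn_gt0.
have B1 : 0 < 2 * B + 1 by rewrite ltr_wpDl// mulr_ge0.
pose t := delta ^+ 2 / (8 * (2 * B + 1)).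
have t0 : 0 < t by rewrite divr_gt0// mulr_gt0.
have tB : (2 * B + 1) * t = delta ^+ 2 / 8 by rewrite /t; field; rewrite gt_eqF.
have tB' : 2 * B * t <= delta ^+ 2 / 8 by move: tB t0; rewrite mulrDl mul1r; lra.
pose eps := Num.min delta t.
have eps0 : 0 < eps by rewrite lt_min delta0.
have eps_d : eps <= delta by rewrite ge_min lexx.
have eps_t : eps <= t by rewrite ge_min lexx orbT.
have [m m1 kc] := kernel_grid_approx bk k_ge0 eps0.
have m0 : (0 < m)%N by exact: ltnW.
have cB a b : (a < m)%N -> (b < m)%N -> 0 <= grid_average kappa m a b <= B.
  exact: grid_average_bounds.
pose eps' := Num.min 1 t.
have eps'0 : 0 < eps' by rewrite lt_min ltr01.
have eps'1 : eps' <= 1 by rewrite ge_min lexx.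
have eps'_t : eps' <= t by rewrite ge_min lexx orbT.
pose F := B + delta; have F0 : 0 < F by rewrite ltr_wpDl.
pose eta := delta ^+ 2 / (64 * F).
have eta0 : 0 < eta by rewrite divr_gt0// mulr_gt0.
have Feta : 8 * F * eta = delta ^+ 2 / 8 by rewrite /eta; field; rewrite gt_eqF.
have [g g0 small] := edge_form_small p_gt0 bounded eta0.
pose g' := Num.min g (delta ^+ 2 / (16 * F ^+ 2)).
have g'0 : 0 < g' by rewrite lt_min g0 divr_gt0// mulr_gt0// exprn_gt0.
have g'g : g' <= g by rewrite ge_min lexx.
have Fg' : 2 * F ^+ 2 * g' <= delta ^+ 2 / 8.
  have F2 : 0 < F ^+ 2 by rewrite exprn_gt0.
  have : g' <= delta ^+ 2 / (16 * F ^+ 2) by rewrite ge_min lexx orbT.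
  by rewrite ler_pdivlMr ?mulr_gt0//; lra.
pose L := #|{: 'I_m * bool * bool}|.
pose K := (Num.truncn (2 * L%:R / g')).+2.
have LK : L%:R / K%:R <= g' / 2.
  have : 2 * L%:R / g' <= K%:R by rewrite (le_trans (ltW (truncnS_gt _)))// ler_nat.
  by rewrite ler_pdivrMr// ler_pdivrMr ?ltr0n//; lra.
have near_m := close m _ m1 t0.
have near_K := close K (eps' / 2) isT (divr_gt0 eps'0 (ltr0n R 2)).
near=> n.
have Kn : (K <= n)%N by near: n; exact: near_within_nat.
have mn : (m <= n)%N by near: n; exact: near_within_nat.
have n0 : (0 < n)%N by exact: leq_trans Kn.
have n0' : 0 < n%:R :> R by rewrite ltr0n.
have Sn : S n by near: n; exact: near_within_mem.
have [_ close_m] : matrices_close t (graph_matrices (p n) (G n) m)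
  (kernel_matrices kappa m) by near: n.
have [close_K _] : matrices_close (eps' / 2) (graph_matrices (p n) (G n) K)
  (kernel_matrices kappa K) by near: n.
have smallU : forall U : {set 'I_n}, #|U|%:R <= g * n%:R ->
    edge_form (p n) (G n) (set_ind U) (fun=> 1) <= eta by near: n.
have [_ /graph_matricesP[lam lam_bal ->] lam_near] :=
  close_m _ (label_matrix_kernel_matrices (kappa := kappa) (equal_label_grid m0)).
have cut (A A' : {set 'I_n}) :
  `|edge_form (p n) (G n) (set_ind A) (set_ind A') -
    pair_mean (fun u v => grid_average kappa m (lam u) (lam v) *
      (set_ind A u * set_ind A' v))| <= delta.
  rewrite leNgt; apply/negP => dev.
  pose lam' u : 'I_L := enum_rank (lam u, u \in A, u \in A').
  have [b [U [b_bal U_le U_blocks]]] := refining_blocks lam' (ltn0Sn _ : (0 < K)%N) Kn.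
  have Mb : graph_matrices (p n) (G n) K
      (\matrix_(i, j) density (p n) (G n) (label_class b i) (label_class b j)).
    by apply/graph_matricesP; exists b.
  have [M' M'k M'_near] := close_K _ Mb.
  have [alpha ea alpha_near] := kernel_matrices_approx (divr_gt0 eps'0 (ltr0n R 2)) M'k.
  have b_near i j : `|density (p n) (G n) (label_class b i) (label_class b j) -
      label_matrix kappa K alpha i j| <= eps'.
    have lt := le_lt_trans (ler_distD M' _ _) (ltrD M'_near alpha_near).
    rewrite -splitr in lt; apply: le_trans (ltW lt).
    by have := matrix_entry_le (\matrix_(i, j) density (p n) (G n) (label_class b i)
      (label_class b j)) (label_matrix kappa K alpha) i j; rewrite [X in `|X - _|]mxE.
  have lam_near' i j : `|density (p n) (G n) (label_class lam i) (label_class lam j) -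
      grid_average kappa m i j| <= t.
    apply: le_trans (ltW lam_near).
    by have := matrix_entry_le (\matrix_(i, j) density (p n) (G n) (label_class lam i)
      (label_class lam j)) (label_matrix kappa m (grid_cell m)) i j; rewrite !mxE.
  have blocks u v : u \notin U -> b u = b v ->
      [/\ lam u = lam v, (u \in A) = (v \in A) & (u \in A') = (v \in A')].
    by move=> uU /(U_blocks _ _ uU)/enum_rank_inj[-> -> ->].
  have MB i j := label_matrix_bounds i j ea kB.
  have energy := label_energy_le m0 (ltn0Sn _ : (0 < K)%N) ea bk cB MB kc.
  have := @cut_deviation_bound R n (p n) (G n) m K lam b
    (fun i j => grid_average kappa m i j) (label_matrix kappa K alpha) B A A' U
    delta t eps' (2 * B * eps) n0 (p_gt0 Sn) lam_bal b_bal blocks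
    (fun i j => cB _ _ (ltn_ord i) (ltn_ord j)) MB lam_near' b_near energy eps'1
    (ltW delta0) dev.
  have U_small : #|U|%:R <= g' * n%:R.
    apply: (@le_trans _ _ (L%:R * (n%:R / K%:R + 1))).
      apply: (@le_trans _ _ (L%:R * (n %/ K).+1%:R)); first by rewrite -natrM ler_nat.
      rewrite ler_wpM2l// -natr1 lerD2r ler_pdivlMr// -natrM ler_nat.
      exact: leq_divM.
    have : L%:R <= g' / 2 * n%:R.
      by rewrite -ler_pdivrMl ?divr_gt0//; near: n; exact: near_within_real.
    have := ler_wpM2r (ltW n0') LK.
    have -> : L%:R / K%:R * n%:R = L%:R * (n%:R / K%:R) :> R by ring.
    by rewrite mulrDr mulr1; lra.
  have U_edge : edge_form (p n) (G n) (set_ind U) (fun=> 1) <= eta.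
    by apply: smallU; rewrite (le_trans U_small)// ler_wpM2r// ltW.
  have U_frac : #|U|%:R / n%:R <= g' by rewrite ler_pdivrMr.
  have n_big : 2 * B ^+ 2 * ((m%:R + K%:R) / n%:R) <= delta ^+ 2 / 8.
    rewrite mulrA ler_pdivrMr// -ler_pdivrMl ?divr_gt0//.
    by near: n; exact: near_within_real.
  have B_eps : 2 * B * eps <= delta ^+ 2 / 8.
    by rewrite (le_trans _ tB')// ler_wpM2l// mulr_ge0.
  have B_eps' : (2 * B + 1) * eps' <= delta ^+ 2 / 8.
    by rewrite -tB ler_wpM2l// ltW.
  have U1 : 8 * F * edge_form (p n) (G n) (set_ind U) (fun=> 1) <= delta ^+ 2 / 8.
    by rewrite -Feta ler_wpM2l// mulr_ge0// ltW.
  have U2 : 2 * F ^+ 2 * (#|U|%:R / n%:R) <= delta ^+ 2 / 8.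
    by rewrite (le_trans _ Fg')// ler_wpM2l// mulr_ge0// sqr_ge0.
  move: U1 U2 B_eps' B_eps n_big tB' d2; rewrite -/F.
  set e1 := edge_form _ _ _ _; lra.
have [tau mp le] := labels_cut_close n0 m0 bk cB kc lam_bal cut.
exists tau => // X Y uX uY; apply: (le_trans (le X Y uX uY)).
have : 2 * B * ((m.+1 * (2 * m).+1)%:R / n%:R) <= e / 4.
  rewrite mulrA ler_pdivrMr// -ler_pdivrMl ?divr_gt0//.
  by near: n; exact: near_within_real.
move: eps_d; rewrite /delta; lra.
Unshelve. all: by end_near. Qed.

End directions.

Theorem theorem6p2 (R : realType) (S : set nat) (p : nat -> R)
    (G : forall n, sgraph n) (kappa : R * R -> R)
    (C : nat -> {posnum R}) (d : profile_space C -> profile_space C -> R)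
    (Sinf : infinite_set S)
    (p_gt0 : forall n, S n -> 0 < p n)
    (np_infty : n%:R * p n @[n --> within S \oo] --> +oo)
    (G_bounded : bounded_density S p G)
    (kappa_bounded : bounded_kernel kappa)
    (graph_cube : forall n k, S n -> (2 <= k)%N ->
       graph_matrices (p n) (G n) k `<=` cube (C k)%:num k)
    (kernel_cube : forall k, (2 <= k)%N ->
       kernel_matrices kappa k `<=` cube (C k)%:num k)
    (d_metrizes : metrizes d) :
  (d_part d (graph_matrices (p n) (G n)) (kernel_matrices kappa)
     @[n --> within S \oo] --> (0 : R)) <->
  (d_cut (graph_kernel (p n) (G n)) kappa
     @[n --> within S \oo] --> (0 : \bar R)%E).
Proof.
have [bk _ _] := bounded_kernel_meas kappa_bounded.
rewrite (d_cut_cvg S p G bk).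
rewrite (@d_part_cvg R C d (within S \oo) _ (fun n => graph_matrices (p n) (G n))
  (kernel_matrices kappa))//.
- split; first exact: matrices_close_cut_close.
  exact: cut_close_matrices_close.
- move=> k k2; apply: filterS (near_within_mem S) => n Sn.
  by split; [exact: graph_matrices_compact|exact: graph_cube].
- move=> k k2; split; last exact: kernel_cube.
  exact: kernel_matrices_compact (kernel_cube k k2).
- move=> k k2; exists (label_matrix kappa k (grid_cell k)).
  apply: label_matrix_kernel_matrices; apply: equal_label_grid.
  exact: leq_trans k2.
Qed.
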